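(* Let $r\ge 2$ be an integer, let $\{G_n\}_{n\ge1}$ be a sequence of finite simple graphs, and let $\{c_n\}_{n\ge1}$ be a sequence of positive integers with $c_n\to\infty$. For each $n$, color the vertices of $G_n$ independently and uniformly at random with $c_n$ colors, and let $T(K_{1,r},G_n)$ be the number of monochromatic $r$-stars in $G_n$. (Sufficiency) Assume that: (1) for every $k\in\{1,\dots,r+1\}$ there exists $\lambda_k\ge 0$ such that $$\lim_{n\to\infty}\frac{1}{c_n^{r}}\sum_{F\in\mathcal C_{r,k}}N_{\mathrm{ind}}(F,G_n)=\lambda_k;$$ (2) if $d_{(1)}\ge d_{(2)}\ge\cdots\ge d_{(|V(G_n)|)}$ denote the degrees of the vertices of $G_n$ in non-increasing order, then for every fixed $v\ge1$ the limit $\lim_{n\to\infty} d_{(v)}/c_n=\theta_v$ exists. Then $$T(K_{1,r},G_n)\longrightarrow \sum_{v=1}^\infty\binom{T_v}{r}+\sum_{k=1}^{r+1}kZ_k ,$$ where the convergence is in distribution and in all moments, and where $T_1,T_2,\dots$ are independent with $T_v\sim\mathrm{Pois}(\theta_v)$; $Z_1,\dots,Z_{r+1}$ are independent with $Z_1\sim\mathrm{Pois}\big(\lambda_1-\frac1{r!}\sum_{u=1}^\infty\theta_u^r\big)$ and $Z_k\sim\mathrm{Pois}(\lambda_k)$ for $2\le k\le r+1$; and the collections $\{T_v\}_{v\ge1}$ and $\{Z_k\}_{1\le k\le r+1}$ are independent of each other. (Converse) If (without assuming (1) and (2)) $T(K_{1,r},G_n)$ converges in distribution to a finite random variable, then there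 exist non-negative constants $\theta_1\ge\theta_2\ge\cdots$ and $\lambda_1,\dots,\lambda_{r+1}$ such that the limit has the law of $\sum_{v=1}^\infty\binom{T_v}{r}+\sum_{k=1}^{r+1}kZ_k$, where all the variables $T_1,T_2,\dots,Z_1,\dots,Z_{r+1}$ are mutually independent, $T_v\sim\mathrm{Pois}(\theta_v)$ for $v\ge1$, $Z_1\sim\mathrm{Pois}\big(\lambda_1-\frac1{r!}\sum_{u=1}^\infty\theta_u^r\big)$, and $Z_k\sim\mathrm{Pois}(\lambda_k)$ for $2\le k\le r+1$.
   Context: $K_{1,r}$ is the $r$-star (one central vertex joined to $r$ leaves). If $X_v$ is the color of $v$, the variables $X_v$, $v\in V(G_n)$, are i.i.d. uniform on $\{1,\dots,c_n\}$, and $$T(K_{1,r},G_n)=\sum_{v\in V(G_n)}\ \sum_{\{u_1,\dots,u_r\}\subseteq V(G_n)}\ \prod_{s=1}^r a_{vu_s}(G_n)\ \mathbf 1\{X_v=X_{u_1}=\cdots=X_{u_r}\},$$ where the inner sum is over $r$-element subsets and $(a_{uv}(G_n))$ is the adjacency matrix of $G_n$. For graphs $H,G$, $N(H,G)$ is the number of (not necessarily induced) subgraphs of $G$ isomorphic to $H$, and $N_{\mathrm{ind}}(F,G)$ is the number of induced copies of $F$ in $G$, i.e. the number of vertex subsets of $G$ inducing a graph isomorphic to $F$. $\mathcal C_{r,k}$ is the set of (isomorphism classes of) graphs $F\supseteq K_{1,r}$ with $|V(F)|=r+1$ and $N(K_{1,r},F)=k$. By convention $d_{(v)}=0$ for $v>|V(G_n)|$,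 and $\mathrm{Pois}(0)$ is the point mass at $0$. In the sufficiency part, that $\lambda_1-\frac1{r!}\sum_u\theta_u^r\ge0$ is implicit in the conclusion; in the converse part the constants are understood to satisfy this. *)

(* Defs.v *)
From HB Require Import structures.
From mathcomp Require Import all_boot all_order all_algebra.
From mathcomp Require Import all_classical all_reals all_analysis.
From mathcomp Require Import measurable_realfun.

Set Implicit Arguments.
Unset Strict Implicit.
Unset Printing Implicit Defensive.

Import Order.TTheory GRing.Theory Num.Theory.
Import numFieldNormedType.Exports.

Structure sgraph (V : finType) := SGraph {
  edges : {set {set V}};
  edgesP : [forall e in edges, #|e| == 2]
}.

HB.instance Definition _ (V : finType) := [isSub for @edges V].
HB.instance Definition _ (V : finType) := [Finite of sgraph V by <:].

Definition adj (V : finType) (G : sgraph V) (u v : V) : bool :=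
  [set u; v] \in edges G.

Definition degree (V : finType) (G : sgraph V) (v : V) : nat :=
  #|[set u | adj G v u]|.

(* Entry v is d_(v+1) in the usual numbering; it is 0 when v >= #|V|. *)
Definition ordered_degree (V : finType) (G : sgraph V) (v : nat) : nat :=
  nth 0 (sort geq [seq degree G u | u <- enum V]) v.

(* The graph with vertex set W and edge set E is isomorphic to H. *)
Definition is_copy (U V : finType) (H : sgraph U)
    (W : {set V}) (E : {set {set V}}) : bool :=
  [exists f : {ffun U -> V},
    [&& injectiveb f,
        f @: [set: U] == W
      & [set f @: (e : {set U}) | e in edges H] == E]].

Definition isomorphic (U V : finType) (F : sgraph U) (F' : sgraph V) : bool :=
  is_copy F [set: V] (edges F').

(* N(H, G): a subgraph is a pair (vertex set, edge set). *)
Definition Nsub (U V : finType) (H : sgraph U) (G : sgraph V) : nat :=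
  #|[set S : {set V} * {set {set V}} |
      [&& S.2 \subset edges G,
          [forall e in S.2, e \subset S.1]
        & is_copy H S.1 S.2]]|.

Definition Nind (U V : finType) (F : sgraph U) (G : sgraph V) : nat :=
  #|[set W : {set V} | is_copy F W [set e in edges G | e \subset W]]|.

Definition star_edges (r : nat) : {set {set 'I_r.+1}} :=
  [set [set ord0; lift ord0 i] | i : 'I_r].

Lemma star_edgesP r : [forall e in star_edges r, #|e| == 2].
Proof.
by apply/forall_inP => e /imsetP[i _ ->]; rewrite cards2 neq_lift.
Qed.

Definition star (r : nat) : sgraph 'I_r.+1 := SGraph (star_edgesP r).

(* One representative on the vertex set 'I_r.+1 per isomorphism class. *)
Definition star_class (r k : nat) : {set sgraph 'I_r.+1} :=
  [set F in transversal
              (equivalence_partition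
                 (fun F F' : sgraph 'I_r.+1 => isomorphic F F') [set: _])
              [set: _]
     | (0 < Nsub (star r) F) && (Nsub (star r) F == k)].

Definition mono_stars (r : nat) (V : finType) (G : sgraph V) (x : V -> nat)
    : nat :=
  \sum_(v : V) \sum_(A : {set V} | #|A| == r)
     (\prod_(u in A) adj G v u) * [forall u in A, x u == x v].

Local Open Scope classical_set_scope.
Local Open Scope ring_scope.

Definition mutually_independent (R : realType) (d : measure_display)
    (Om : measurableType d) (P : probability Om R)
    (d' : measure_display) (T : measurableType d')
    (I : choiceType) (D : set I) (X : I -> {RV P >-> T}) : Prop :=
  forall J : seq I, uniq J -> [set` J] `<=` D ->
  forall A : I -> set T, (forall i, measurable (A i)) ->
    P (\bigcap_(i in [set` J]) (X i @^-1` A i)) =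
    (\prod_(i <- J) P (X i @^-1` A i))%E.

(* Uniform law on {1, ..., c}. *)
Definition uniform_color (R : realType) (d : measure_display)
    (Om : measurableType d) (P : probability Om R)
    (X : {RV P >-> nat}) (c : nat) : Prop :=
  forall a : nat, (1 <= a <= c)%N -> distribution P X [set a] = (c%:R^-1)%:E.

(* The last argument of [poisson_prob] is unused in the library definition;
   for rate 0, [poisson_prob] is the point mass at 0. *)
Definition poisson_law (R : realType) (d : measure_display)
    (Om : measurableType d) (P : probability Om R)
    (X : {RV P >-> nat}) (rate : R) : Prop :=
  forall A : set nat, distribution P X A = poisson_prob rate 0 A.

Definition cvg_in_distribution (R : realType)
    (d : nat -> measure_display) (Om : forall n, measurableType (d n))
    (P : forall n, probability (Om n) R) (X : forall n, Om n -> R)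
    (d' : measure_display) (Om' : measurableType d')
    (Q : probability Om' R) (Y : Om' -> R) : Prop :=
  forall f : R -> R, continuous f -> (exists M : R, forall x, `|f x| <= M) ->
    ('E_(P n)[f \o X n] @[n --> \oo] --> 'E_Q[f \o Y])%E.

Definition cvg_in_moments (R : realType)
    (d : nat -> measure_display) (Om : forall n, measurableType (d n))
    (P : forall n, probability (Om n) R) (X : forall n, Om n -> R)
    (d' : measure_display) (Om' : measurableType d')
    (Q : probability Om' R) (Y : Om' -> R) : Prop :=
  forall m : nat, Q.-integrable setT (fun w => (Y w ^+ m)%:E) /\
    ('E_(P n)[fun w => (X n w ^+ m)%R] @[n --> \oo] -->
     'E_Q[fun w => (Y w ^+ m)%R])%E.

(* Here theta v and T v stand for theta_{v+1} and T_{v+1} (v : nat),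
   while lambda and Z are indexed from 1 and only used at 1 <= k <= r + 1. *)

Definition Z1_rate (R : realType) (r : nat) (theta lambda : nat -> R)
    : \bar R :=
  ((lambda 1%N)%:E - (r`!%:R^-1)%:E * \sum_(0 <= u <oo) (theta u ^+ r)%:E)%E.

Definition limit_index (r : nat) : set (nat + nat) :=
  [set i | match i with inl _ => True | inr k => is_true (1 <= k <= r.+1)%N end].

Definition limit_family (R : realType) (d : measure_display)
    (Om : measurableType d) (P : probability Om R)
    (T Z : nat -> {RV P >-> nat}) (i : nat + nat) : {RV P >-> nat} :=
  match i with inl v => T v | inr k => Z k end.

Definition limit_variables (R : realType) (r : nat) (theta lambda : nat -> R)
    (d : measure_display) (Om : measurableType d) (P : probability Om R)
    (T Z : nat -> {RV P >-> nat}) : Prop :=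
  [/\ mutually_independent (limit_index r) (limit_family T Z),
      forall v, poisson_law (T v) (theta v),
      poisson_law (Z 1%N) (fine (Z1_rate r theta lambda))
    & forall k, (2 <= k <= r.+1)%N -> poisson_law (Z k) (lambda k)].

Definition limit_sum (R : realType) (r : nat)
    (d : measure_display) (Om : measurableType d) (P : probability Om R)
    (T Z : nat -> {RV P >-> nat}) (w : Om) : \bar R :=
  (\sum_(0 <= v <oo) ('C(T v w, r)%:R)%:E +
   (\sum_(1 <= k < r.+2) (k * Z k w)%N%:R)%:E)%E.

(* Main.v *)
(* Let H be the set of the K vertices of highest degree.  Given the colours of H, the star
   count is, up to errors that vanish as n and then K tend to infinity, the sum over h in H of
   C(number of neighbours of h coloured like h, r), plus the sum over k of k times the number
   of monochromatic (r+1)-sets that avoid H and have k dominating vertices.  These counts are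
   sums of dissociated indicators of small probability, so by the Chen-Stein method they are
   jointly close to independent Poisson variables of rates deg(h)/c and lambda_k, except that
   the sets spanned by the stars centred in H are missing; almost all of these have one
   dominating vertex and there are about C(deg h, r) of them for each h, hence the correction
   theta_h^r / r! to lambda_1.  This gives the pointwise limit of the generating functions,
   thus of the point probabilities, and uniform moment bounds yield convergence in
   distribution and of all moments.

   Conversely, convergence in distribution gives tightness, and Chebyshev's inequality, applied
   to the neighbours coloured like a given vertex and to the star count, turns tightness into
   bounds on the maximal degree over c and on the mean star count.  Along an ultrafilter all
   the limits in the hypotheses then exist, and the first part identifies the limit law. *)
Require Import Defs.
From HB Require Import structures.
From mathcomp Require Import all_boot all_order all_algebra.
From mathcomp Require Import all_classical all_reals all_analysis.
From mathcomp Require Import measurable_realfun.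
From mathcomp Require Import perm ring lra zify.
Import Order.TTheory GRing.Theory Num.Theory.
Import numFieldNormedType.Exports.
Set Implicit Arguments.
Unset Strict Implicit.
Unset Printing Implicit Defensive.
Local Open Scope ring_scope.

(** * Averages over colourings *)

(** Stars that share a centre of degree comparable to [c] are strongly dependent, so the star count
    itself has no Poisson limit; freezing the colours of H removes exactly these centres. What
    remains has degree at most [E * c] with [E] close to theta_K, and overlapping pairs of stars
    cost a multiple of [exp E - 1 + E * exp E]. The limiting rate of the sets with one dominating
    vertex, being nonnegative, bounds the sum of the theta_v^r; hence theta_K tends to 0, and the
    error vanishes when K grows after n.

    Generating functions on ]0, 1[ determine point probabilities without a continuity theorem, but
    mass could still escape, and the limit is an infinite sum. The moment bounds give total mass 1,
    hence almost sure finiteness. For fixed n every estimate concerns a finite average over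
    colourings. The converse also has to construct the limit variables; all of them are extracted
    from one uniform variable by repeated inverse transform sampling. *)

Section average.
Context {R : realType} {V C : finType}.
Implicit Types (f g : {ffun V -> C} -> R) (x y a : {ffun V -> C}).

Definition avg f : R := (\sum_x f x) / #|{ffun V -> C}|%:R.

Definition merge (S : {set V}) a x : {ffun V -> C} :=
  [ffun v => if v \in S then a v else x v].

Definition depends_on (T : Type) (S : {set V}) (f : {ffun V -> C} -> T) :=
  forall x y, {in S, x =1 y} -> f x = f y.

Lemma eq_avg f g : f =1 g -> avg f = avg g.
Proof. by move=> fg; rewrite /avg; congr (_ / _); apply: eq_bigr. Qed.

Lemma avgD f g : avg (fun x => f x + g x) = avg f + avg g.
Proof. by rewrite /avg big_split mulrDl. Qed.

Lemma avgN f : avg (fun x => - f x) = - avg f.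
Proof. by rewrite /avg sumrN mulNr. Qed.

Lemma avgB f g : avg (fun x => f x - g x) = avg f - avg g.
Proof. by rewrite avgD avgN. Qed.

Lemma avgZ (k : R) f : avg (fun x => k * f x) = k * avg f.
Proof. by rewrite /avg -mulr_sumr mulrA. Qed.

Lemma avgZr (k : R) f : avg (fun x => f x * k) = avg f * k.
Proof. by rewrite /avg -mulr_suml mulrAC. Qed.

Lemma avg_sum (I : Type) (s : seq I) (P : pred I) (F : I -> {ffun V -> C} -> R) :
  avg (fun x => \sum_(i <- s | P i) F i x) = \sum_(i <- s | P i) avg (F i).
Proof. by rewrite /avg exchange_big mulr_suml. Qed.

Lemma le_avg f g : (forall x, f x <= g x) -> avg f <= avg g.
Proof. by move=> fg; rewrite /avg ler_wpM2r ?invr_ge0 ?ler0n// ler_sum. Qed.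

Lemma avg_ge0 f : (forall x, 0 <= f x) -> 0 <= avg f.
Proof. by move=> f0; rewrite mulr_ge0 ?invr_ge0 ?ler0n// sumr_ge0. Qed.

Lemma ler_norm_avg f : `|avg f| <= avg (fun x => `|f x|).
Proof.
rewrite /avg normrM [X in _ * X]ger0_norm ?invr_ge0 ?ler0n//.
by rewrite ler_wpM2r ?invr_ge0 ?ler0n// ler_norm_sum.
Qed.

Lemma merge_in (S : {set V}) a x : {in S, merge S a x =1 a}.
Proof. by move=> v vS; rewrite ffunE vS. Qed.

Lemma merge_out (S : {set V}) a x : {in ~: S, merge S a x =1 x}.
Proof. by move=> v; rewrite inE ffunE => /negPf ->. Qed.

Hypothesis C_gt0 : (0 < #|C|)%N.

Lemma card_coloring_gt0 : (0 < #|{ffun V -> C}|)%N.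
Proof. by rewrite card_ffun expn_gt0 C_gt0. Qed.

Lemma avg_cst (k : R) : avg (fun=> k) = k.
Proof.
rewrite /avg sumr_const /=. rewrite -[k *+ _]mulr_natr -mulrA divff ?mulr1// pnatr_eq0 -lt0n.
exact: card_coloring_gt0.
Qed.

(** Exchanging the colours on [S] between [a] and [x] is an involution of pairs of colourings, so
    merging two independent uniform colourings gives a uniform one. This serves as conditioning on
    the colours of [S]. *)
Lemma avg_merge (S : {set V}) f : avg f = avg (fun a => avg (fun x => f (merge S a x))).
Proof.
pose c : R := #|{ffun V -> C}|%:R.
have c0 : c != 0 by rewrite pnatr_eq0 -lt0n card_coloring_gt0.
pose h (p : {ffun V -> C} * {ffun V -> C}) := (merge S p.1 p.2, merge S p.2 p.1).
have hK : involutive h.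
  by move=> [a x]; rewrite /h /=; congr (_, _); apply/ffunP => v; rewrite !ffunE /=; case: (v \in S).
have E : \sum_a \sum_x f (merge S a x) = c * \sum_x f x.
  rewrite pair_bigA /= (reindex_inj (inv_inj hK)) /=.
  rewrite (eq_bigr (fun p => f p.1)); last first.
    by move=> p _; congr f; exact: (congr1 fst (hK p)).
  rewrite -(pair_bigA _ (fun a _ => f a)) /=.
  by rewrite mulr_sumr; apply: eq_bigr => a _; rewrite sumr_const mulr_natl.
by rewrite /avg -mulr_suml E [c * _]mulrC mulfK.
Qed.

Lemma avg_indep (S : {set V}) f g : depends_on S f -> depends_on (~: S) g ->
  avg (fun x => f x * g x) = avg f * avg g.
Proof.
move=> fS gS; rewrite (avg_merge S) -avgZr; apply: eq_avg => a.
rewrite -avgZ; apply: eq_avg => x.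
by rewrite (fS _ _ (merge_in a x)) (gS _ _ (merge_out a x)).
Qed.

(** The indicator is a product of functions of single colours, so the sum over colourings factors
    vertex by vertex. *)
Lemma avg_agree (D : {set V}) (b : V -> C) :
  avg (fun x => [forall u in D, x u == b u]%:R) = #|C|%:R ^- #|D|.
Proof.
pose F u (y : C) : R := if u \in D then (y == b u)%:R else 1.
have E x : [forall u in D, x u == b u]%:R = \prod_u F u (x u).
  case: forall_inP => [Db|nDb].
    by rewrite big1// => u _; rewrite /F; case: ifPn => // /Db ->.
  have [/existsP[u /andP[uD ub]]|/existsPn nn] :=
    boolP [exists u, (u \in D) && (x u != b u)].
    by rewrite (bigD1 u)//= {1}/F uD (negPf ub) mul0r.
  case: nDb => u uD; apply: contraT => ub.
  by have := nn u; rewrite uD ub.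
rewrite /avg (eq_bigr _ (fun x _ => E x)) -(bigA_distr_bigA F).
have c0 : #|C|%:R != 0 :> R by rewrite pnatr_eq0 -lt0n.
rewrite card_ffun natrX -(prodr_const V) -prodf_div -exprVn -prodr_const.
rewrite [RHS]big_mkcond /=; apply: eq_bigr => u _; rewrite /F; case: ifP => uD.
  by rewrite (bigD1 (b u))//= eqxx big1 ?addr0 ?mul1r// => y /negPf ->.
by rewrite sumr_const divff.
Qed.

Definition mono (W : {set V}) x := [forall u in W, forall v in W, x u == x v].

Lemma monoP (W : {set V}) x : reflect {in W &, forall u v, x u = x v} (mono W x).
Proof.
apply: (iffP forall_inP) => [h u v uW vW|h u uW].
  by apply/eqP; exact: (forall_inP (h u uW)).
by apply/forall_inP => v vW; apply/eqP/h.
Qed.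

Lemma mono_center (W : {set V}) v x : v \in W ->
  mono W x = [forall u in W :\ v, x u == x v].
Proof.
move=> vW; apply/monoP/forall_inP => [h u|h].
  by rewrite !inE => /andP[_ uW]; apply/eqP/h.
have h' u : u \in W -> x u = x v.
  by have [-> //|uv uW] := eqVneq u v; apply/eqP/h; rewrite !inE uv.
by move=> u w /h' -> /h' ->.
Qed.

Lemma depends_mono (W : {set V}) : depends_on W (mono W).
Proof.
move=> x y xy; apply/monoP/monoP => h u v uW vW.
  by rewrite -!xy//; exact: h.
by rewrite !xy//; exact: h.
Qed.

(** The colour of [v] is free, and each of the other [#|W|.-1] vertices must match it. *)
Lemma avg_mono (W : {set V}) v : v \in W ->
  avg (fun x => (mono W x)%:R) = #|C|%:R ^- #|W|.-1.
Proof.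
move=> vW; rewrite (avg_merge [set v]).
rewrite -[RHS]avg_cst; apply: eq_avg => a.
rewrite (cardsD1 v) vW /= -(avg_agree _ (fun=> a v)).
apply: eq_avg => x; rewrite (mono_center _ vW) ffunE set11.
congr (_%:R); congr nat_of_bool; apply: eq_forallb_in => u.
by rewrite !inE ffunE inE => /andP[/negPf ->].
Qed.

(** Only an upper bound: the vertices of [W] outside [U] must take the colour of [u], while those
    inside [U] have prescribed colours that may already disagree. *)
Lemma avg_mono_merge (U W : {set V}) a u : u \in W :&: U ->
  avg (fun x => (mono W (merge U a x))%:R) <= #|C|%:R ^- #|W :\: U|.
Proof.
move=> /setIP[uW uU]; rewrite -(avg_agree _ (fun=> a u)); apply: le_avg => x.
case: monoP => // h; rewrite (_ : [forall _ in _, _])//.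
apply/forall_inP => w; rewrite inE => /andP[wU wW].
have := h w u wW uW; rewrite !ffunE uU (negPf wU) => ->//.
Qed.

End average.
Arguments merge {V C}.

(** * Poisson means and Stein's equation *)

Section absolutely_convergent_series.
Context {R : realType}.
Implicit Types (u v : nat -> R).

Definition rsum u : R := limn (series u).

Lemma cvg_series_le u v : (forall n, `|u n| <= v n) -> cvgn (series v) ->
  cvgn (series (fun n => `|u n|)).
Proof.
move=> uv; apply: series_le_cvg => // n.
exact: le_trans (uv n).
Qed.

Lemma cvg_series_dom u v : (forall n, `|u n| <= v n) -> cvgn (series v) ->
  cvgn (series u).
Proof. by move=> uv cv; apply: normed_cvg; exact: cvg_series_le cv. Qed.

Lemma rsum_norm_le u v : (forall n, `|u n| <= v n) -> cvgn (series v) ->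
  `|rsum u| <= rsum v.
Proof.
move=> uv cv; have cu := cvg_series_le uv cv.
apply: (le_trans (lim_series_norm cu)).
exact: lim_series_le.
Qed.

Lemma series_recl u n : series u n.+1 = u 0%N + series (fun i => u i.+1) n.
Proof. by rewrite /series /= big_nat_recl. Qed.

Lemma cvg_series_recl u : cvgn (series (fun i => u i.+1)) -> cvgn (series u).
Proof.
move=> cu; apply/cvg_ex; exists (u 0%N + rsum (fun i => u i.+1)).
rewrite -cvg_shiftS /=; under eq_fun do rewrite series_recl.
by apply: cvgD; [exact: cvg_cst|exact: cu].
Qed.

Lemma rsum_recl u : cvgn (series (fun i => u i.+1)) ->
  rsum u = u 0%N + rsum (fun i => u i.+1).
Proof.
move=> cu; apply: cvg_lim => //.
rewrite -cvg_shiftS /=; under eq_fun do rewrite series_recl.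
by apply: cvgD; [exact: cvg_cst|exact: cu].
Qed.

Lemma rsumZ (k : R) u : cvgn (series u) -> rsum (fun i => k * u i) = k * rsum u.
Proof. exact: lim_seriesZ. Qed.

Lemma rsumB u v : cvgn (series u) -> cvgn (series v) ->
  rsum (fun i => u i - v i) = rsum u - rsum v.
Proof. exact: lim_seriesB. Qed.

Lemma rsum_exp_coeff (l : R) : rsum (exp_coeff l) = expR l.
Proof. by rewrite expRE /rsum exp_coeffE. Qed.

End absolutely_convergent_series.

Section poisson_mean.
Context {R : realType}.
Implicit Types (l : R) (f : nat -> R).

(* The mean of [f] under the Poisson law of parameter [l >= 0]; as [0 ^+ 0 = 1],
   rate [0] gives [f 0]. *)
Definition pmean l f : R := rsum (fun j => f j * exp_coeff l j) * expR (- l).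

Lemma norm_mul_exp_coeff_le f (M l : R) : 0 <= l -> (forall n, `|f n| <= M) ->
  forall n, `|f n * exp_coeff l n| <= M * exp_coeff l n.
Proof.
move=> l0 fM n; rewrite normrM [X in _ * X]ger0_norm ?exp_coeff_ge0//.
by rewrite ler_wpM2r ?exp_coeff_ge0.
Qed.

Lemma cvg_scaled_exp_coeff (M l : R) : cvgn (series (fun n => M * exp_coeff l n)).
Proof. by apply: is_cvg_seriesZ; exact: is_cvg_series_exp_coeff. Qed.

Lemma cvg_poisson_series f (M l : R) : 0 <= l -> (forall n, `|f n| <= M) ->
  cvgn (series (fun j => f j * exp_coeff l j)).
Proof.
move=> l0 fM; apply: cvg_series_dom (norm_mul_exp_coeff_le l0 fM) _.
exact: cvg_scaled_exp_coeff.
Qed.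

Lemma pmean_norm_le f (M l : R) : 0 <= l -> (forall n, `|f n| <= M) ->
  `|pmean l f| <= M.
Proof.
move=> l0 fM; rewrite /pmean normrM [X in _ * X]ger0_norm ?expR_ge0//.
rewrite expRN ler_pdivrMr ?expR_gt0//.
apply: le_trans (rsum_norm_le (norm_mul_exp_coeff_le l0 fM) _) _.
  exact: cvg_scaled_exp_coeff.
rewrite rsumZ ?rsum_exp_coeff//; exact: is_cvg_series_exp_coeff.
Qed.

Lemma pmean0 f : pmean 0 f = f 0%N.
Proof.
rewrite /pmean oppr0 expR0 mulr1 rsum_recl.
  rewrite /exp_coeff /= fact0 expr0 divr1 mulr1 -[RHS]addr0; congr (_ + _).
  rewrite /rsum (_ : series _ = fun=> 0) ?lim_cst//.
  by apply/funext => n; rewrite /series /= big1// => i _; rewrite exprS !mul0r mulr0.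
rewrite (_ : series _ = fun=> 0); first exact: is_cvg_cst.
by apply/funext => n; rewrite /series /= big1// => i _; rewrite /exp_coeff/= exprS !mul0r mulr0.
Qed.

(* With [h := f - pmean l f], the function
   [g m = - (m-1)! * \sum_i h (m + i) * l ^ i / (m + i)!] solves Stein's equation;
   [(m-1)! / (m + i)! <= 1 / i!] gives the bound. *)
Lemma stein_poisson l f : 0 <= l -> (forall n, `|f n| <= 1) ->
  exists g : nat -> R, (forall m, `|g m| <= 2 * expR l) /\
    forall m, l * g m.+1 - m%:R * g m = f m - pmean l f.
Proof.
move=> l0 f1.
pose h j := f j - pmean l f.
have h2 j : `|h j| <= 2.
  by rewrite (le_trans (ler_normB _ _))// (natrD _ 1 1) lerD// pmean_norm_le.
pose t m i := h (m + i)%N * (m.-1`!%:R * l ^+ i / (m + i)`!%:R).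
have tle m i : (0 < m)%N -> `|t m i| <= 2 * exp_coeff l i.
  move=> m0; rewrite /t normrM ler_pM//.
  rewrite ger0_norm ?divr_ge0 ?mulr_ge0 ?exprn_ge0 ?ler0n//.
  rewrite /exp_coeff /= mulrAC mulrC ler_wpM2l ?exprn_ge0//.
  rewrite ler_pdivrMr ?ltr0n ?fact_gt0// mulrC ler_pdivlMr ?ltr0n ?fact_gt0//.
  rewrite -natrM ler_nat.
  have -> : (m + i = m.-1 + i.+1)%N by rewrite addnS -addSn prednK.
  have bg : (0 < 'C(m.-1 + i, i))%N by rewrite bin_gt0 leq_addl.
  have := bin_fact (leq_addl m.-1 i); rewrite addnK => E.
  rewrite addnS factS -E mulnC; rewrite -[X in (X <= _)%N]mul1n leq_mul//.
  by rewrite -[X in (X <= _)%N]mul1n leq_mul.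
pose s m := rsum (t m).
have ct m : (0 < m)%N -> cvgn (series (t m)).
  by move=> m0; apply: cvg_series_dom (tle m ^~ m0) _; exact: cvg_scaled_exp_coeff.
(* In the equation [g 0] is multiplied by 0, so any bounded value will do there. *)
exists (fun m => if (0 < m)%N then - s m else 0); split.
  move=> m; case: ifPn => [m0|_]; last by rewrite normr0 mulr_ge0 ?expR_ge0.
  rewrite normrN; apply: le_trans (rsum_norm_le (tle m ^~ m0) _) _.
    exact: cvg_scaled_exp_coeff.
  by rewrite rsumZ ?rsum_exp_coeff//; exact: is_cvg_series_exp_coeff.
move=> m /=; rewrite -/(h m).
have ls : l * s m.+1 = rsum (fun i => l * t m.+1 i) by rewrite rsumZ//; exact: ct.
case: m ls => [|m] ls /=.
  (* At [m = 0] the equation splits the first term off the series of [h j * exp_coeff l j], whose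
     sum vanishes because [h] is centred. *)
  rewrite mul0r subr0 mulrN ls.
  have E : (fun i => l * t 1%N i) = (fun i => h i.+1 * exp_coeff l i.+1).
    apply/funext => i; rewrite /t /exp_coeff /= add1n fact0 mul1r exprS.
    by rewrite mulrCA !mulrA.
  have ch : cvgn (series (fun i => h i * exp_coeff l i)).
    exact: cvg_poisson_series h2.
  have := @rsum_recl _ (fun i => h i * exp_coeff l i).
  rewrite -E => H.
  have {H} H : rsum (fun i => h i * exp_coeff l i) = h 0%N * exp_coeff l 0%N + rsum (fun i => l * t 1%N i).
    apply: H; apply: (cvg_series_dom (v := (fun i => l * (2 * exp_coeff l i)))).
      by move=> i; rewrite normrM ger0_norm// ler_wpM2l// tle.
    by apply: is_cvg_seriesZ; exact: cvg_scaled_exp_coeff.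
  move: H; have -> : rsum (fun i => h i * exp_coeff l i) = 0.
    under eq_fun do rewrite mulrBl.
    rewrite rsumB; last exact: cvg_scaled_exp_coeff.
      rewrite rsumZ; last exact: is_cvg_series_exp_coeff.
      rewrite rsum_exp_coeff /pmean -mulrA -expRD addNr expR0 mulr1 subrr//.
    exact: cvg_poisson_series f1.
  move/esym/eqP; rewrite addrC addr_eq0 => /eqP ->.
  by rewrite opprK /exp_coeff /= fact0 divr1 mulr1.
rewrite !mulrN opprK addrC ls.
have E i : m.+1%:R * t m.+1 i.+1 = l * t m.+2 i.
  by rewrite /t /= (_ : (m.+1 + i.+1 = m.+2 + i)%N) ?addnS// (factS m) natrM exprS; ring.
have -> : (fun i => l * t m.+2 i) = (fun i => m.+1%:R * t m.+1 i.+1).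
  by apply/funext => i; rewrite E.
have cS : cvgn (series (fun i => t m.+1 i.+1)).
  apply: (cvg_series_dom (v := (fun i => 2 * exp_coeff l i.+1))).

    by move=> i; exact: tle.
  have := @cvg_scaled_exp_coeff 2 l; move=> /cvg_ex[b hb].
  apply/cvg_ex; exists (b - 2 * exp_coeff l 0%N).
  have -> : series (fun i => 2 * exp_coeff l i.+1) =
     (fun n => series (fun n => 2 * exp_coeff l n) n.+1 - 2 * exp_coeff l 0%N).
    by apply/funext => n; rewrite series_recl addrC addKr.
  by apply: cvgB; [rewrite cvg_shiftS|exact: cvg_cst].
rewrite rsumZ// /s (rsum_recl cS) mulrDr addrK /t addn0 /=.
rewrite expr0 mulr1 mulrCA factS natrM invfM.
rewrite [m`!%:R * _]mulrCA divff ?mulr1 ?pnatr_eq0 -?lt0n ?fact_gt0//.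
by rewrite divff ?mulr1// pnatr_eq0.
Qed.

(** [l1 ^+ n.+1 - l2 ^+ n.+1] is [l1 - l2] times a sum of [n.+1] monomials, each at most [L ^+ n];
    divided by the factorial of [n.+1], these bounds form the exponential series of [L]. *)
Lemma pmean_lipschitz f (L l1 l2 : R) : (forall n, `|f n| <= 1) ->
  0 <= l1 <= L -> 0 <= l2 <= L ->
  `|rsum (fun j => f j * exp_coeff l1 j) - rsum (fun j => f j * exp_coeff l2 j)|
    <= `|l1 - l2| * expR L.
Proof.
move=> f1 /andP[a0 aL] /andP[b0 bL].
rewrite -rsumB; [|exact: cvg_poisson_series f1..].
pose v n := if n is j.+1 then `|l1 - l2| * exp_coeff L j else 0.
have pw n : `|l1 ^+ n.+1 - l2 ^+ n.+1| <= `|l1 - l2| * (n.+1%:R * L ^+ n).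
  rewrite subrXX normrM ler_wpM2l//.
  apply: le_trans (ler_norm_sum _ _ _) _.
  rewrite -[X in _ <= X%:R * _]card_ord mulr_natl -sumr_const ler_sum// => i _.
  rewrite ger0_norm ?mulr_ge0 ?exprn_ge0//=.
  have -> : L ^+ n = L ^+ (n - i) * L ^+ i.
    by rewrite -exprD subnK// -ltnS.
  by rewrite ler_pM ?exprn_ge0// lerXn2r// nnegrE (le_trans a0).
have L0 : 0 <= L := le_trans a0 aL.
have vE : cvgn (series (fun i => v i.+1)) by exact: cvg_scaled_exp_coeff.
apply: le_trans (rsum_norm_le (v := v) _ _) _.
- case=> [|n] /=; first by rewrite /exp_coeff /= !expr0 subrr normr0.
  rewrite -mulrBr normrM -[X in _ <= X]mul1r ler_pM//.
  rewrite /exp_coeff /= -mulrBl normrM [X in _ * X]ger0_norm ?invr_ge0 ?ler0n//.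
  rewrite ler_pdivrMr ?ltr0n ?fact_gt0// (le_trans (pw n))//.
  rewrite -mulrA ler_wpM2l// (_ : _ / _ * _ = n.+1%:R * L ^+ n)// factS natrM.
  by field; rewrite pnatr_eq0 -lt0n fact_gt0.
- exact: cvg_series_recl.
- rewrite (rsum_recl vE) add0r rsumZ ?rsum_exp_coeff//.
  exact: is_cvg_series_exp_coeff.
Qed.

Lemma cvg_pmean (T : Type) (F : set_system T) (FF : ProperFilter F) f (ln : T -> R) l :
  (forall n, `|f n| <= 1) -> (forall n, 0 <= ln n) -> 0 <= l ->
  (ln n @[n --> F] --> l)%classic -> (pmean (ln n) f @[n --> F] --> pmean l f)%classic.
Proof.
move=> f1 ln0 l0 cl; apply: cvgM; last first.
  by apply: (cvg_comp (fun n => - ln n) expR (cvgN cl)); exact: continuous_expR.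
apply/cvgrPdist_le => e e0.
have E0 : 0 < e / expR (l + 1) by rewrite divr_gt0 ?expR_gt0.
near=> n.
have h1 : `|l - ln n| <= 1 by near: n; move/cvgrPdist_le : cl; exact.
have h2 : `|l - ln n| <= e / expR (l + 1) by near: n; move/cvgrPdist_le : cl; exact.
apply: le_trans (pmean_lipschitz (L := l + 1) f1 _ _) _.
- by rewrite l0 lerDl ler01.
- rewrite ln0 /= -lerBlDl; apply: le_trans h1.
  by rewrite distrC ler_norm.
- by rewrite -ler_pdivlMr ?expR_gt0.
Unshelve. all: by end_near.
Qed.

End poisson_mean.

(** * Poisson approximation of dissociated counts *)

Section dissociated_poisson.
Context {R : realType} {V C : finType} {A I : finType}.
Variables (S : A -> {set V}) (J : A -> {ffun V -> C} -> bool) (lab : A -> I).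

(** The dependency neighbourhood of the Chen-Stein method: indicators that are not linked depend on
    disjoint sets of vertices. *)
Definition linked a b := (a == b) || ~~ [disjoint S a & S b].

Definition count_lab i x : nat := \sum_(a | lab a == i) J a x.

Definition far_count a i x : nat :=
  \sum_(b | (lab b == i) && ~~ linked a b) J b x.

Definition prob a : R := avg (fun x => (J a x)%:R).

Definition rate i : R := \sum_(a | lab a == i) prob a.

(* The two error sums of the Arratia-Goldstein-Gordon bound, localized at [a]. *)
Definition link_error a : R :=
  \sum_(b | linked a b) prob a * prob b +
  \sum_(b | linked a b && (b != a)) avg (fun x => (J a x && J b x)%:R).

Lemma prob_ge0 a : 0 <= prob a.
Proof. by apply: avg_ge0 => x; rewrite ler0n. Qed.

Lemma rate_ge0 i : 0 <= rate i.
Proof. by apply: sumr_ge0 => a _; exact: prob_ge0. Qed.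

Lemma count_lab_far a i x : (forall b, linked a b -> J b x = false) ->
  count_lab i x = far_count a i x.
Proof.
move=> h; rewrite /count_lab (bigID (linked a)) /= big1 ?add0n//.
by move=> b /andP[_ /h ->].
Qed.

Lemma count_lab_far1 a i x : J a x ->
  (forall b, linked a b && (b != a) -> J b x = false) ->
  count_lab i x = ((lab a == i) + far_count a i x)%N.
Proof.
move=> Ja h; rewrite /count_lab (bigID (linked a)) /=; congr (_ + _)%N.
have aa : linked a a by rewrite /linked eqxx.
have [ai|ai] := boolP (lab a == i).
  rewrite (bigD1 a) ?ai ?aa//= Ja big1// => b /andP[/andP[_ ab] ba].
  by rewrite h ?ab.
rewrite big1// => b /andP[bi ab]; rewrite h// ab /=.
by apply: contraNneq ai => <-.
Qed.

Lemma norm_prod_le1 (T : Type) (s : seq T) (F : T -> R) :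
  (forall j, `|F j| <= 1) -> `|\prod_(j <- s) F j| <= 1.
Proof.
move=> F1; elim/big_ind: _ => [|x y hx hy|i _]; rewrite ?normr1//.
by rewrite normrM mulr_ile1.
Qed.

(** Here [n] counts bad events. Without any of them the two quantities agree, and as soon as one
    occurs the crude bound [2 * G] suffices. *)
Lemma norm_diff_le_count (u v G : R) (n : nat) :
  `|u| <= G -> `|v| <= G -> (n = 0%N -> u = v) -> `|u - v| <= 2 * G * n%:R.
Proof.
move=> uG vG; case: n => [->//|n _]; first by rewrite subrr normr0 mulr0.
rewrite (le_trans (ler_normB _ _))//.
have G0 : 0 <= G by exact: le_trans (normr_ge0 u) uG.
apply: (@le_trans _ _ (2 * G * 1)); first by rewrite mulr1 mulr_natl mulr2n lerD.
by rewrite ler_wpM2l ?mulr_ge0// ler1n.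
Qed.

Hypothesis C_gt0 : (0 < #|C|)%N.
Hypothesis JS : forall a, depends_on (S a) (J a).
Variable f : I -> nat -> R.
Hypothesis f1 : forall i n, `|f i n| <= 1.

Lemma depends_far_count a i : depends_on (~: S a) (far_count a i).
Proof.
move=> x y xy; apply: eq_bigr => b /andP[_]; rewrite negb_or negbK => /andP[_ ab].
congr nat_of_bool; apply: (JS (a := b)) => v vb; apply: xy.
by rewrite inE; apply: contraTN vb => va; rewrite (disjointFr ab va).
Qed.

(* One step of the Chen-Stein method, with the remaining counts frozen in a bounded factor. *)
Lemma poisson_replace_count i (s : seq I) (L : R) : i \notin s -> rate i <= L ->
  `|avg (fun x => f i (count_lab i x) * \prod_(j <- s) f j (count_lab j x)) -
    pmean (rate i) (f i) * avg (fun x => \prod_(j <- s) f j (count_lab j x))|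
  <= 4 * expR L * \sum_(a | lab a == i) link_error a.
Proof.
move=> si iL; set l := rate i; set Y := fun x => \prod_(j <- s) f j (count_lab j x).
have [g [gb gE]] := stein_poisson (rate_ge0 i) (f1 i).
set G := 2 * expR (rate i) in gb.
have G0 : 0 <= G by rewrite mulr_ge0 ?expR_ge0.
pose N := count_lab i.
have Y1 x : `|Y x| <= 1 by apply: norm_prod_le1.
(* Stein's equation turns [f i N - pmean] into [l * g (N + 1) - N * g N]; then [l] and [N] are split
   into the contributions of the single [a]. *)
have -> : avg (fun x => f i (count_lab i x) * Y x) - pmean l (f i) * avg Y =
    \sum_(a | lab a == i) (prob a * avg (fun x => g (N x).+1 * Y x) -
                           avg (fun x => (J a x)%:R * (g (N x) * Y x))).
  rewrite -avgZ -avgB sumrB -mulr_suml -/(rate i) -avg_sum -avgZ -avgB.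
  apply: eq_avg => x; rewrite -mulrBl -gE mulrBl mulrA; congr (_ - _).
  by rewrite -mulr_suml -natr_sum mulrA.
apply: le_trans (ler_norm_sum _ _ _) _; rewrite mulr_sumr ler_sum// => a /eqP ai.
(* Both terms are compared with [far], which ignores every indicator linked to [a] and is therefore
   independent of [J a]. *)
pose far x := g (far_count a i x).+1 * \prod_(j <- s) f j (far_count a j x).
have farG x : `|far x| <= G.
  by rewrite /far normrM -[G]mulr1 ler_pM// norm_prod_le1.
have gYG m x : `|g m * Y x| <= G.
  by rewrite normrM -[G]mulr1 ler_pM.
have E : avg (fun x => (J a x)%:R * far x) = prob a * avg far.
  apply: (avg_indep C_gt0 (S := S a)) => x y xy; first by rewrite (JS xy).
  rewrite /far (depends_far_count i xy); congr (_ * _).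
  by apply: eq_bigr => j _; rewrite (depends_far_count j xy).
have -> : prob a * avg (fun x => g (N x).+1 * Y x) - avg (fun x => (J a x)%:R * (g (N x) * Y x)) =
  prob a * avg (fun x => g (N x).+1 * Y x - far x) +
  avg (fun x => (J a x)%:R * (far x - g (N x) * Y x)).
  have -> : avg (fun x => (J a x)%:R * (far x - g (N x) * Y x)) =
      avg (fun x => (J a x)%:R * far x) - avg (fun x => (J a x)%:R * (g (N x) * Y x)).
    by rewrite -avgB; apply: eq_avg => x; rewrite mulrBr.
  by rewrite avgB E mulrBr addrA subrK.
apply: le_trans (ler_normD _ _) _.
have -> : 4 * expR L * link_error a =
   2 * (2 * expR L) * (\sum_(b | linked a b) prob a * prob b) + 2 * (2 * expR L) *
   (\sum_(b | linked a b && (b != a)) avg (fun x => (J a x && J b x)%:R)).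
  by rewrite -mulrDr -/(link_error a) mulrA -natrM.
have GL : G <= 2 * expR L by rewrite ler_wpM2l// ler_expR.
apply: lerD.
  rewrite normrM ger0_norm ?prob_ge0//.
  apply: (@le_trans _ _ (prob a * (2 * G * \sum_(b | linked a b) prob b))); last first.
    rewrite mulrCA -mulr_sumr ler_wpM2r ?mulr_ge0 ?sumr_ge0 ?prob_ge0//.
      by move=> b _; exact: prob_ge0.
    by rewrite ler_wpM2l.
  rewrite ler_wpM2l ?prob_ge0// (le_trans (ler_norm_avg _))//.
  rewrite -avg_sum -avgZ; apply: le_avg => x.
  rewrite -natr_sum; apply: norm_diff_le_count => // /eqP.
  rewrite sum_nat_eq0 => /forall_inP h.
  have h' b : linked a b -> J b x = false by move=> /h; rewrite eqb0 => /negbTE.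
  rewrite /far /Y /N (count_lab_far i h'); congr (_ * _).
  by apply: eq_bigr => j _; rewrite (count_lab_far j h').
apply: (@le_trans _ _ (2 * G * \sum_(b | linked a b && (b != a)) avg (fun x => (J a x && J b x)%:R))); last first.
  apply: ler_wpM2r; last by apply: ler_wpM2l.
  by apply: sumr_ge0 => b _; apply: avg_ge0 => x; rewrite ler0n.
rewrite (le_trans (ler_norm_avg _))// -avg_sum -avgZ; apply: le_avg => x.
rewrite -natr_sum; case Ja : (J a x); last by rewrite mul0r normr0 !mulr_ge0.
rewrite mul1r; apply: norm_diff_le_count => // /eqP.
rewrite sum_nat_eq0 => /forall_inP h.
have h' b : linked a b && (b != a) -> J b x = false.
  by move=> /h; rewrite eqb0 => /negbTE.
rewrite /far /Y /N (count_lab_far1 _ Ja h') ai eqxx add1n; congr (_ * _).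
(* The label of [a] is [i], which does not occur in [s], so the other counts do not see [a]. *)
apply: eq_big_seq => j js; rewrite (count_lab_far1 _ Ja h') ai.
by case: eqP js si => [<- ->|].
Qed.

(** The counts are replaced one label at a time. Earlier errors are multiplied by a Poisson mean of
    modulus at most 1, so the errors of the single steps simply add up. *)
Lemma dissociated_poisson (L : R) : (forall i, rate i <= L) ->
  `|avg (fun x => \prod_i f i (count_lab i x)) - \prod_i pmean (rate i) (f i)|
  <= 4 * expR L * \sum_a link_error a.
Proof.
move=> rL.
have H (s : seq I) : uniq s ->
  `|avg (fun x => \prod_(i <- s) f i (count_lab i x)) - \prod_(i <- s) pmean (rate i) (f i)|
  <= 4 * expR L * \sum_(i <- s) \sum_(a | lab a == i) link_error a.
  elim: s => [_|i s IH /= /andP[si us]].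
    rewrite !big_nil mulr0 (@eq_avg _ _ _ _ (fun=> 1)) ?avg_cst ?subrr ?normr0//.
    by move=> x; rewrite big_nil.
  rewrite (@eq_avg _ _ _ _ (fun x => f i (count_lab i x) * \prod_(j <- s) f j (count_lab j x))); last first.
    by move=> x; rewrite big_cons.
  rewrite !big_cons mulrDr.
  have := poisson_replace_count si (rL i); have := IH us.
  set X := avg _; set Y := avg _; set P := \prod_(_ <- _) _; set p := pmean _ _.
  move=> h1 h2; rewrite -(subrKA (p * X)) (le_trans (ler_normD _ _))// lerD//.
  rewrite -mulrBr normrM -[leRHS]mul1r ler_pM// pmean_norm_le ?rate_ge0//.
apply: le_trans (H _ (index_enum_uniq I)) _.
rewrite ler_wpM2l ?mulr_ge0 ?expR_ge0//.
by rewrite (partition_big lab xpredT).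
Qed.

End dissociated_poisson.

(** * Stars in a graph *)

Section stars.
Context {V : finType}.
Implicit Types (e : rel V) (r : nat) (U W A : {set V}) (p : V * {set V}).

Definition nbr e v : {set V} := [set u | e v u].

Definition stars e r : {set V * {set V}} :=
  [set p : V * {set V} | (p.2 \subset nbr e p.1) && (#|p.2| == r)].

Definition body p : {set V} := p.1 |: p.2.

Definition dominating e W : {set V} := [set v in W | W :\ v \subset nbr e v].

(** For [k >= 1] these sets correspond to the induced copies of the graphs in [star_class r k]; see
    [sum_Nind_star_class]. *)
Definition star_sets e r k : {set {set V}} :=
  [set W : {set V} | (#|W| == r.+1) && (#|dominating e W| == k)].

Definition mono_count (C : finType) e r (x : {ffun V -> C}) : nat :=
  \sum_(p in stars e r) mono (body p) x.

Lemma starsP e r p : reflect (p.2 \subset nbr e p.1 /\ #|p.2| = r) (p \in stars e r).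
Proof. by rewrite inE; apply: (iffP andP) => -[? /eqP]. Qed.

Lemma sum_stars (T : nmodType) e r (F : V -> {set V} -> T) :
  \sum_(p in stars e r) F p.1 p.2 =
  \sum_v \sum_(A : {set V} | (A \subset nbr e v) && (#|A| == r)) F v A.
Proof.
rewrite pair_big_dep /=; apply: eq_big => [[v A]|[v A] _] //=.
by rewrite inE.
Qed.

Lemma card_stars e r : #|stars e r| = (\sum_v 'C(#|nbr e v|, r))%N.
Proof.
rewrite -sum1_card (sum_stars e r (fun _ _ => 1%N)); apply: eq_bigr => v _.
by rewrite -cards_draws -sum1_card; apply: eq_bigl => A; rewrite inE.
Qed.

Lemma mono_countE (C : finType) e r (x : {ffun V -> C}) :
  mono_count e r x = (\sum_v 'C(#|[set u in nbr e v | x u == x v]|, r))%N.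
Proof.
rewrite /mono_count /body (sum_stars e r (fun v A => mono (v |: A) x : nat)).
apply: eq_bigr => v _; rewrite -cards_draws -sum1_card.
rewrite [LHS]big_mkcond [RHS]big_mkcond /=; apply: eq_bigr => A _; rewrite inE.
have -> : (A \subset [set u in nbr e v | x u == x v]) =
   (A \subset nbr e v) && [forall u in A, x u == x v].
  apply/fintype.subsetP/andP => [h|[/fintype.subsetP h1 /forall_inP h2] u uA].
    split; first by apply/fintype.subsetP => u /h; rewrite inE => /andP[].
    by apply/forall_inP => u /h; rewrite inE => /andP[].
  by rewrite inE h1// h2.
have -> : mono (v |: A) x = [forall u in A, x u == x v].
  rewrite (@mono_center _ _ _ v) ?setU11//; apply/forall_inP/forall_inP => h u.
    have [-> //|uv uA] := eqVneq u v; apply: h.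
    by rewrite !inE uv uA orbT.
  by rewrite !inE => /andP[/negPf ->] /= uA; apply: h.
by case: (A \subset _); case: (#|A| == r); case: [forall _ in _, _].
Qed.

Section irreflexive.
Variable e : rel V.
Hypothesis eirr : irreflexive e.

Lemma card_body r p : p \in stars e r -> #|body p| = r.+1.
Proof.
move=> /starsP[sub <-]; rewrite /body cardsU1.
suff -> : p.1 \notin p.2 by [].
by apply/negP => /(fintype.subsetP sub); rewrite inE eirr.
Qed.

Lemma body_center p r : p \in stars e r -> body p :\ p.1 = p.2.
Proof.
move=> /starsP[sub _]; apply: setU1K.
by apply/negP => /(fintype.subsetP sub); rewrite inE eirr.
Qed.

Lemma dominating_body r p : p \in stars e r -> p.1 \in dominating e (body p).
Proof.
move=> ps; rewrite inE setU11 (body_center ps).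
by case/starsP : ps.
Qed.

Lemma star_of_dominating r W v : #|W| = r.+1 -> v \in dominating e W ->
  (v, W :\ v) \in stars e r /\ body (v, W :\ v) = W.
Proof.
rewrite inE => cW /andP[vW sub]; split; last by rewrite /body /= finset.setD1K.
apply/starsP; split => //=.
by move: cW; rewrite (cardsD1 v) vW add1n => -[].
Qed.

(* A star is determined by its vertex set [W] and a dominating vertex of [W]. *)
Lemma sum_stars_body (T : nmodType) r (F : {set V} -> T) :
  \sum_(p in stars e r) F (body p) =
  \sum_(W : {set V} | #|W| == r.+1) F W *+ #|dominating e W|.
Proof.
rewrite (partition_big body (fun W => #|W| == r.+1)) /=; last first.
  by move=> p ps; rewrite (card_body ps).
apply: eq_bigr => W /eqP cW.
rewrite -sumr_const (reindex_onto (fun v => (v, W :\ v)) fst) /=; last first.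
  by move=> p /andP[ps /eqP <-]; rewrite (body_center ps); case: p ps.
have E v : ((v, W :\ v) \in stars e r) && (body (v, W :\ v) == W) =
           (v \in dominating e W).
  apply/andP/idP => [[vs /eqP E]|vd].
    by have := dominating_body vs; rewrite E.
  by have [-> ->] := star_of_dominating cW vd.
apply: eq_big => v; first by rewrite E eqxx andbT.
by rewrite E eqxx andbT => /(star_of_dominating cW)[_ ->].
Qed.

Lemma mono_count_sets (C : finType) r (x : {ffun V -> C}) :
  mono_count e r x =
  (\sum_(W : {set V} | #|W| == r.+1) #|dominating e W| * mono W x)%N.
Proof.
rewrite /mono_count (sum_stars_body r (fun W => mono W x : nat)).
by apply: eq_bigr => W _; rewrite mulnC; elim: #|_| => [|n IH]; rewrite ?muln0// mulrS IH mulnS.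
Qed.

Lemma card_stars_sets r : #|stars e r| =
  (\sum_(W : {set V} | #|W| == r.+1) #|dominating e W|)%N.
Proof.
rewrite -sum1_card (sum_stars_body r (fun W => 1%N)); apply: eq_bigr => W _.
by elim: #|_| => [|n IH]; rewrite // mulrS IH.
Qed.

End irreflexive.
End stars.

(** * Conditional means and moments of the star count *)

Section star_moments.
Context {R : realType} {V C : finType}.
Variable e : rel V.
Hypothesis esym : symmetric e.
Hypothesis eirr : irreflexive e.
Hypothesis C_gt0 : (0 < #|C|)%N.
Let c : R := #|C|%:R.
Implicit Types (r q : nat) (U A W : {set V}) (B : R).

Let c_gt0 : 0 < c. Proof. by rewrite ltr0n. Qed.
Let c_neq0 : c != 0. Proof. by rewrite gt_eqF. Qed.

(** Each vertex of [N] is in [A] or not, which gives a factor [1 + 1] inside [U] and [1 + t]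
    outside; the value 0 of [F] off [N] discards the sets that are not contained in [N]. *)
Lemma sum_subset_weight (t : R) (N U : {set V}) :
  \sum_(A : {set V} | A \subset N) t ^+ #|A :\: U| =
  2 ^+ #|N :&: U| * (1 + t) ^+ #|N :\: U|.
Proof.
pose F u : R := if u \in N then (if u \in U then 1 else t) else 0.
transitivity (\sum_(A : {set V}) \prod_u (if u \in A then F u else 1)).
  rewrite big_mkcond; apply: eq_bigr => A _; case: ifPn => [/fintype.subsetP AN|].
    rewrite -prodr_const big_mkcond /=; apply: eq_bigr => u _; rewrite inE /F.
    by case: ifPn => [/andP[/negPf -> uA]|]; [rewrite uA AN|
       case: (boolP (u \in A)) => uA; rewrite ?andbT ?negbK => uU; rewrite ?(AN _ uA) ?uU].
  move=> /subsetPn[u uA uN]; rewrite (bigD1 u)//= uA /F.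
  by rewrite (negPf uN) mul0r.
rewrite -bigA_distr /= -!prodr_const [X in _ = X * _]big_mkcond /=.
rewrite [X in _ = _ * X]big_mkcond -big_split /=; apply: eq_bigr => u _.
rewrite !inE /F; case: (u \in N); case: (u \in U) => //=; rewrite ?mulr1 ?mul1r ?add0r//.
by rewrite addrC.
Qed.

Lemma pow1Dc_le_expR B d : d%:R <= B * c -> (1 + c^-1) ^+ d <= expR B.
Proof.
move=> dB; apply: (@le_trans _ _ (expR c^-1 ^+ d)).
  apply: lerXn2r; rewrite ?nnegrE ?expR_ge0 ?expR_ge1Dx//.
  by rewrite addr_ge0// invr_ge0 ltW.
by rewrite -expRM_natl ler_expR ler_pdivrMr.
Qed.

(** Bounds the expected number of stars that straddle a set of [q] vertices of given colours when
    degrees are at most [B * c]. It tends to 0 with [B], which is why high degrees are pruned. *)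
Definition overlap_bound q B : R := q%:R * 2 ^+ q * (expR B - 1 + B * expR B).

(* [expR B] bounds [(1 + 1/c) ^ deg], the total weight of the leaf sets at a vertex,
   and [2 ^ q] counts the leaf sets inside a given set of [q] vertices. *)
Definition cond_bound q B : R := q%:R * 2 ^+ q * (expR B + B * expR B).

Variable B : R.
Hypothesis B_ge0 : 0 <= B.
Hypothesis degB : forall v, #|nbr e v|%:R <= B * c.

Lemma sum_weight_le U q v : (#|U| <= q)%N ->
  \sum_(A : {set V} | A \subset nbr e v) c^-1 ^+ #|A :\: U| <= 2 ^+ q * expR B.
Proof.
move=> Uq; rewrite sum_subset_weight ler_pM//.
- by rewrite exprn_ge0// addr_ge0// invr_ge0 ltW.
- rewrite ler_eXn2l ?ltr1n// (leq_trans _ Uq)//.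
  by rewrite subset_leq_card ?finset.subsetIr.
- apply: pow1Dc_le_expR; apply: le_trans (degB v).
  by rewrite ler_nat subset_leq_card ?finset.subsetDl.
Qed.

Lemma sum_weight_out_le U q v : (#|U| <= q)%N ->
  \sum_(A : {set V} | (A \subset nbr e v) && ~~ (A \subset U)) c^-1 ^+ #|A :\: U|
  <= 2 ^+ q * (expR B - 1).
Proof.
move=> Uq.
have := sum_subset_weight c^-1 (nbr e v) U.
rewrite (bigID (fun A => A \subset U)) /=.
have -> : \sum_(A : {set V} | (A \subset nbr e v) && (A \subset U)) c^-1 ^+ #|A :\: U| =
    2 ^+ #|nbr e v :&: U|.
  rewrite -natrX -card_powerset -sumr_const; apply: eq_big => A.
    by rewrite inE finset.subsetI.
  by move=> /andP[_ AU]; have /eqP -> : #|A :\: U| == 0%N by rewrite cards_eq0 finset.setD_eq0.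
move=> /(canRL (addKr _)) ->.
rewrite addrC -[X in _ - X]mulr1 -mulrBr ler_pM//.
- by rewrite subr_ge0 exprn_ege1// lerDl invr_ge0 ltW.
- rewrite ler_eXn2l ?ltr1n// (leq_trans _ Uq)//.
  by rewrite subset_leq_card ?finset.subsetIr.
- rewrite lerD2r; apply: pow1Dc_le_expR; apply: le_trans (degB v).
  by rewrite ler_nat subset_leq_card ?finset.subsetDl.
Qed.

(** A star centred in [U] has one of at most [q] centres and a leaf outside, whence [expR B - 1]. A
    star centred outside has its centre among the at most [q * (B * c)] neighbours of [U], and the
    colour of this centre gives a factor [c^-1], whence [B * expR B]. *)
Lemma sum_overlap_le r U q : (#|U| <= q)%N ->
  \sum_(p in stars e r | ~~ [disjoint body p & U] && ~~ (body p \subset U))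
     c^-1 ^+ #|body p :\: U| <= overlap_bound q B.
Proof.
move=> Uq.
pose F v A : R := if ~~ [disjoint body (v, A) & U] && ~~ (body (v, A) \subset U)
  then c^-1 ^+ #|body (v, A) :\: U| else 0.
have -> : \sum_(p in stars e r | ~~ [disjoint body p & U] && ~~ (body p \subset U))
     c^-1 ^+ #|body p :\: U| = \sum_(p in stars e r) F p.1 p.2.
  by rewrite big_mkcondr; apply: eq_bigr => -[].
rewrite sum_stars.
pose a : R := 2 ^+ q * (expR B - 1); pose b : R := c^-1 * (2 ^+ q * expR B).
have eB : 0 <= expR B - 1 by rewrite subr_ge0 -expR0 ler_expR.
have a0 : 0 <= a by rewrite mulr_ge0 ?exprn_ge0.
have b0 : 0 <= b by rewrite !mulr_ge0 ?invr_ge0 ?exprn_ge0 ?expR_ge0 ?ltW.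
apply: (@le_trans _ _ (\sum_v ((v \in U)%:R * a + [exists u in U, e v u]%:R * b))).
  apply: ler_sum => v _; have vN A : A \subset nbr e v -> v \notin A.
    by move=> /fintype.subsetP AN; apply/negP => /AN; rewrite inE eirr.
  have [vU|vU] := boolP (v \in U).
    rewrite mul1r -[leLHS]addr0; apply: lerD; last by rewrite mulr_ge0.
    apply: le_trans (sum_weight_out_le v Uq).
    rewrite big_mkcond [leRHS]big_mkcond; apply: ler_sum => A _ /=.
    have w0 : 0 <= c^-1 ^+ #|A :\: U| by rewrite exprn_ge0 ?invr_ge0 ?ltW.
    have -> : F v A = if ~~ (A \subset U) then c^-1 ^+ #|A :\: U| else 0.
      rewrite /F /body /= finset.subUset finset.sub1set vU /=.
      have -> /= : ~~ [disjoint v |: A & U].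
        by apply/pred0Pn; exists v; rewrite /= setU11.
      by rewrite finset.setDUl (_ : [set v] :\: U = finset.set0) ?finset.set0U//; apply/eqP; rewrite finset.setD_eq0 finset.sub1set.
    by case: (A \subset nbr e v); case: (A \subset U); case: (#|A| == r) => //=.
  rewrite mul0r add0r; have [/existsP[u /andP[uU vu]]|nex] := boolP [exists u in U, e v u]; last first.
    rewrite big1 ?mul0r// => A /andP[/fintype.subsetP AN _]; rewrite /F.
    have -> : [disjoint body (v, A) & U]; last by [].
    rewrite disjoint_subset; apply/fintype.subsetP => w; rewrite !inE => /orP[/eqP ->//|/AN].
    rewrite inE => vw; apply: contra nex => wU; apply/existsP; exists w.
    by rewrite wU.
  rewrite mul1r /b; apply: (le_trans _ (ler_wpM2l _ (sum_weight_le v Uq))); last first.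
    by rewrite invr_ge0 ltW.
  rewrite mulr_sumr big_mkcond [leRHS]big_mkcond; apply: ler_sum => A _ /=.
  have w0 : 0 <= c^-1 * c^-1 ^+ #|A :\: U| by rewrite mulr_ge0 ?exprn_ge0 ?invr_ge0 ?ltW.
  case: (boolP (A \subset nbr e v)) => //= AN; case: (#|A| == r) => //.
  rewrite /F; case: ifP => // _; rewrite /body /= finset.setDUl.
  have -> : [set v] :\: U = [set v].
    by apply/setP => w; rewrite !inE andbC; case: eqP => // ->.
  by rewrite cardsU1 !inE (negPf (vN _ AN)) andbF /= exprS.
rewrite big_split /= -!mulr_suml /overlap_bound.
have -> : q%:R * 2 ^+ q * (expR B - 1 + B * expR B) =
   q%:R * a + q%:R * (B * c) * b.
  by rewrite /a /b; field.
apply: lerD; first by rewrite ler_wpM2r// -natr_sum -big_mkcond /= sum1_card ler_nat.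
rewrite ler_wpM2r//.
apply: (@le_trans _ _ (\sum_(u in U) #|nbr e u|%:R)).
  rewrite -!natr_sum ler_nat.
  under [X in (_ <= X)%N]eq_bigr do rewrite -sum1_card big_mkcond /=.
  rewrite exchange_big /=; apply: leq_sum => v _.
  case: existsP => [[u /andP[uU vu]]|//].
  by rewrite (bigD1 u)//= inE esym vu.
apply: (@le_trans _ _ (\sum_(u in U) B * c)); first by apply: ler_sum.
by rewrite sumr_const -[_ *+ #|_|]mulr_natl ler_wpM2r ?ler_nat// mulr_ge0// ltW.
Qed.

Lemma card_stars_inside r U q : (#|U| <= q)%N ->
  (#|[set p in stars e r | body p \subset U]| <= q * 2 ^ q)%N.
Proof.
move=> Uq; apply: (@leq_trans #|finset.setX U (powerset U)|).
  apply/subset_leq_card/fintype.subsetP => -[v A]; rewrite !inE /= => /andP[_].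
  by rewrite /body /= finset.subUset finset.sub1set.
by rewrite cardsX card_powerset leq_mul// leq_pexp2l.
Qed.

Definition star_mean r : R := #|stars e r|%:R / c ^+ r.

Lemma avg_mono_body r p : p \in stars e r ->
  avg (fun x : {ffun V -> C} => (mono (body p) x)%:R) = c^-1 ^+ r.
Proof.
move=> ps; rewrite (avg_mono C_gt0 (v := p.1)) ?setU11//.
by rewrite (card_body eirr ps) exprVn.
Qed.

Lemma avg_mono_count r :
  avg (fun x : {ffun V -> C} => (mono_count e r x)%:R) = star_mean r.
Proof.
under eq_avg do rewrite natr_sum.
rewrite avg_sum (eq_bigr _ (fun p ps => avg_mono_body ps)) sumr_const.
by rewrite /star_mean exprVn mulr_natl.
Qed.

(** Stars disjoint from [U] contribute at most the unconditional mean, straddling ones at most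
    [overlap_bound], and those inside [U], possibly all monochromatic, at most their number
    [q * 2 ^ q]. *)
Lemma avg_merge_mono_count r U q (a : {ffun V -> C}) : (#|U| <= q)%N ->
  avg (fun x => (mono_count e r (merge U a x))%:R) <= star_mean r + cond_bound q B.
Proof.
move=> Uq; under eq_avg do rewrite natr_sum.
rewrite avg_sum (bigID (fun p => [disjoint body p & U])) /=.
apply: lerD.
  apply: (@le_trans _ _ (\sum_(p in stars e r) c^-1 ^+ r)); last first.
    by rewrite sumr_const exprVn -mulr_natl.
  rewrite big_mkcondr; apply: ler_sum => p ps; case: ifP => [dU|_]; last first.
    by rewrite exprn_ge0// invr_ge0 ltW.
  rewrite -(avg_mono_body ps); apply: le_avg => x.
  rewrite (depends_mono (y := x))// => v vp; apply: merge_out.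
  by rewrite inE (disjointFr dU).
rewrite (bigID (fun p => body p \subset U)) /= addrC.
have -> : cond_bound q B = overlap_bound q B + (q * 2 ^ q)%N%:R.
  by rewrite /cond_bound /overlap_bound natrM natrX; ring.
apply: lerD.
  apply: le_trans (sum_overlap_le r Uq).
  under eq_bigl do rewrite -andbA.
  apply: ler_sum => p /and3P[ps nd _].
  have [u ub] : exists u, u \in body p :&: U.
    have /pred0Pn[u] := nd; rewrite /= => /andP[h1 h2].
    by exists u; rewrite inE h1.
  by rewrite exprVn; exact: avg_mono_merge ub.
apply: (@le_trans _ _ (\sum_(p in [set p in stars e r | body p \subset U]) 1)).
  rewrite [leRHS]big_mkcond [leLHS]big_mkcond /=; apply: ler_sum => p _.
  have -> : (p \in [set p in stars e r | body p \subset U]) =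
    (p \in stars e r) && (body p \subset U) by exact: finset.in_set.
  case: (p \in stars e r); case: (body p \subset U); case: [disjoint _ & _] => //=.
  rewrite -[leRHS](@avg_cst _ V _ C_gt0); apply: le_avg => x.
  by rewrite lern1 leq_b1.
by rewrite sumr_const ler_nat card_stars_inside.
Qed.

Lemma cond_bound_ge0 q : 0 <= cond_bound q B.
Proof. by rewrite !mulr_ge0 ?addr_ge0 ?mulr_ge0 ?exprn_ge0 ?expR_ge0. Qed.

Lemma star_mean_ge0 r : 0 <= star_mean r.
Proof. by rewrite divr_ge0 ?ler0n// exprn_ge0 ?ler0n. Qed.

(** One factor of the power is expanded into stars. The indicator of each star joins [f] and
    enlarges the set of fixed vertices by its [r.+1] vertices; hence [q + i * r.+1] after [i]
    expansions. *)
Lemma avg_indicator_moment r m q U (f : {ffun V -> C} -> R) :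
  (forall x, 0 <= f x) -> depends_on U f -> (#|U| <= q)%N ->
  avg (fun x => f x * (mono_count e r x)%:R ^+ m) <=
  avg f * \prod_(i < m) (star_mean r + cond_bound (q + i * r.+1) B).
Proof.
elim: m q U f => [|m IH] q U f f0 fU Uq.
  by rewrite big_ord0 mulr1 (@eq_avg _ _ _ _ f)// => x; rewrite expr0 mulr1.
set P : R := \prod_(i < m) (star_mean r + cond_bound (q + r.+1 + i * r.+1) B).
have P0 : 0 <= P by apply: prodr_ge0 => i _; rewrite addr_ge0 ?star_mean_ge0 ?cond_bound_ge0.
have E : \prod_(i < m.+1) (star_mean r + cond_bound (q + i * r.+1) B) =
    (star_mean r + cond_bound q B) * P.
  rewrite big_ord_recl mul0n addn0; congr (_ * _); apply: eq_bigr => i _.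
  by rewrite /= mulSn addnA.
rewrite E mulrA.
apply: (@le_trans _ _ (avg (fun x => f x * (mono_count e r x)%:R) * P)); last first.
  rewrite ler_wpM2r// (avg_merge C_gt0 U) -avgZr; apply: le_avg => a.
  apply: (@le_trans _ _ (f a * avg (fun x => (mono_count e r (merge U a x))%:R))).
    rewrite -avgZ; apply: le_avg => x.
    by rewrite (fU _ _ (merge_in a x)).
  by rewrite ler_wpM2l// avg_merge_mono_count.
have -> : avg (fun x => f x * (mono_count e r x)%:R ^+ m.+1) =
   \sum_(p in stars e r) avg (fun x => (f x * (mono (body p) x)%:R) * (mono_count e r x)%:R ^+ m).
  rewrite -avg_sum; apply: eq_avg => x.
  by rewrite -mulr_suml -mulr_sumr exprS mulrA -natr_sum.
have -> : avg (fun x => f x * (mono_count e r x)%:R) =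
   \sum_(p in stars e r) avg (fun x => f x * (mono (body p) x)%:R).
  by rewrite -avg_sum; apply: eq_avg => x; rewrite -mulr_sumr -natr_sum.
rewrite mulr_suml; apply: ler_sum => p ps.
apply: (IH (q + r.+1)%N (U :|: body p)).
- by move=> x; rewrite mulr_ge0.
- move=> x y xy; rewrite (fU x y) ?(depends_mono (x := x) (y := y))// => v vU;
  by apply: xy; rewrite inE vU ?orbT.
- rewrite (leq_trans (leq_card_setU _ _))// leq_add//.
  by rewrite (card_body eirr ps).
Qed.

Lemma avg_mono_count_moment r m :
  avg (fun x : {ffun V -> C} => (mono_count e r x)%:R ^+ m) <=
  \prod_(i < m) (star_mean r + cond_bound (i * r.+1) B).
Proof.
have := @avg_indicator_moment r m 0 finset.set0 (fun=> 1) (fun=> ler01) _ _.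
rewrite avg_cst// mul1r cards0 => H; apply: le_trans (H _ _) => //.
by apply: le_avg => x; rewrite mul1r.
Qed.

Lemma avg_mono_count_sqr r :
  avg (fun x : {ffun V -> C} => (mono_count e r x)%:R ^+ 2) <=
  star_mean r * (star_mean r + cond_bound r.+1 B).
Proof.
apply: le_trans (avg_mono_count_moment r 2) _.
by rewrite big_ord_recr big_ord1 /= mul0n mul1n /cond_bound !mul0r addr0.
Qed.

End star_moments.

(** * Deleting the edges at the vertices of high degree *)

Section pruning.
Context {V : finType}.
Variables (e : rel V) (H : {set V}) (r : nat).
Hypothesis esym : symmetric e.
Hypothesis eirr : irreflexive e.
Hypothesis r_gt0 : (0 < r)%N.
Implicit Types (W A : {set V}) (p : V * {set V}).

(** The vertices of [H] stay, isolated, so that the vertex type and the colourings are unchanged. *)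
Definition prune : rel V := fun u v => [&& e u v, u \notin H & v \notin H].

Lemma prune_sym : symmetric prune.
Proof. by move=> u v; rewrite /prune esym [(u \notin H) && _]andbC. Qed.

Lemma prune_irr : irreflexive prune.
Proof. by move=> u; rewrite /prune eirr. Qed.

Lemma nbr_prune_sub v : nbr prune v \subset nbr e v.
Proof. by apply/fintype.subsetP => u; rewrite !inE => /and3P[]. Qed.

Lemma stars_prune p :
  (p \in stars prune r) = (p \in stars e r) && [disjoint body p & H].
Proof.
apply/idP/andP => [/starsP[/fintype.subsetP sub cp]|[/starsP[/fintype.subsetP sub cp] dH]].
  split.
    apply/starsP; split => //; apply/fintype.subsetP => u /sub.
    by rewrite !inE => /and3P[].
  (* Since [r > 0] there is a leaf, and the edge to it shows that the centre avoids [H]. *)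
  have [u up] : exists u, u \in p.2.
    by apply/set0Pn; rewrite -card_gt0 cp.
  rewrite disjoint_subset; apply/fintype.subsetP => w; rewrite !inE => /orP[/eqP ->|/sub].
    by have := sub _ up; rewrite !inE => /and3P[].
  by rewrite !inE => /and3P[].
apply/starsP; split => //; apply/fintype.subsetP => u up.
have := sub _ up; rewrite !inE /prune => -> /=.
by rewrite (disjointFr dH (setU11 _ _)) (disjointFr dH) // inE up orbT.
Qed.

Lemma dominating_prune W : #|W| = r.+1 ->
  dominating prune W = if [disjoint W & H] then dominating e W else finset.set0.
Proof.
move=> cW; apply/setP => v; apply/idP/idP => [vd|].
  have [vs E] := star_of_dominating cW vd.
  move: vs; rewrite stars_prune E => /andP[vs ->].
  by have := dominating_body eirr vs; rewrite E.
case: ifPn => [dW vd|]; last by rewrite inE.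
have [vs E] := star_of_dominating cW vd.
have : (v, W :\ v) \in stars prune r by rewrite stars_prune vs E.
by move=> /(dominating_body prune_irr); rewrite E.
Qed.

Lemma star_sets_prune k : (0 < k)%N ->
  star_sets prune r k = [set W in star_sets e r k | [disjoint W & H]].
Proof.
move=> k0; apply/setP => W; rewrite !inE.
case: eqP => //= cW; rewrite (dominating_prune cW); case: ifP => _; rewrite ?andbT//.
by rewrite cards0 andbF; case: k k0.
Qed.

Definition touching : {set V * {set V}} :=
  [set p in stars e r | ~~ [disjoint p.2 & H]].

(** Given [h] in both [W] and [H], one of the at least two dominating vertices differs from [h]; the
    star of [W] centred there has [h] as a leaf. *)
Lemma card_star_sets_meet k : (1 < k)%N ->
  (#|[set W in star_sets e r k | ~~ [disjoint W & H]]| <= #|touching|)%N.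
Proof.
move=> k1; apply: leq_trans (leq_imset_card body _).
apply/subset_leq_card/fintype.subsetP => W; rewrite !inE -andbA.
move=> /and3P[/eqP cW /eqP ck /pred0Pn[h /= /andP[hW hH]]].
have [v] : exists v, v \in dominating e W :\ h.
  apply/set0Pn; rewrite -card_gt0; have := cardsD1 h (dominating e W).
  by rewrite ck => E; rewrite -(ltn_add2l (h \in dominating e W)) addn0 -E (leq_ltn_trans _ k1)// leq_b1.
rewrite in_setD1 => /andP[vh vd].
have [vs E] := star_of_dominating cW vd.
apply/imsetP; exists (v, W :\ v) => //; rewrite inE vs /=.
by apply/pred0Pn; exists h; rewrite /= in_setD1 eq_sym vh hW.
Qed.

(** The only star on such a set is centred in [H] or has a leaf there. *)
Lemma card_star_sets1_meet_le :
  (#|[set W in star_sets e r 1 | ~~ [disjoint W & H]]| <=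
    #|[set p in stars e r | p.1 \in H]| + #|touching|)%N.
Proof.
apply: leq_trans (leq_card_setU _ _); apply: leq_trans (leq_imset_card body _).
apply/subset_leq_card/fintype.subsetP => W; rewrite !inE -andbA.
move=> /and3P[/eqP cW /eqP ck /pred0Pn[h /= /andP[hW hH]]].
have [v vd] : exists v, v \in dominating e W.
  by apply/set0Pn; rewrite -card_gt0 ck.
have [vs E] := star_of_dominating cW vd.
apply/imsetP; exists (v, W :\ v) => //; move: vs; rewrite !finset.in_set => -> /=.
case: (boolP (v \in H)) => //= vH; apply/pred0Pn; exists h.
apply/andP; split => //=; rewrite in_setD1 hW andbT.
by apply: contraNneq vH => <-.
Qed.

(** If the set of the star has no other dominating vertex, the star is recovered from that set.
    Otherwise a second dominating vertex centres a star with the old centre as a leaf in [H], that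
    is, a touching star; each touching body leaves [r.+1] choices for the original centre. *)
Lemma card_stars_centered_le :
  (#|[set p in stars e r | p.1 \in H]| <=
   #|[set W in star_sets e r 1 | ~~ [disjoint W & H]]| + r.+1 * #|touching|)%N.
Proof.
set SH := [set p in stars e r | p.1 \in H].
pose one p := #|dominating e (body p)| == 1%N.
have -> : #|SH| = (#|[set p in SH | one p]| + #|[set p in SH | ~~ one p]|)%N.
  rewrite -cardsUI [X in (_ + X)%N](_ : _ = 0%N) ?addn0; last first.
    by apply/eqP; rewrite cards_eq0; apply/eqP/setP => p; rewrite !finset.in_set; case: (one p); rewrite ?andbF.
  by congr (#|pred_of_set _|); apply/setP => p; rewrite !finset.in_set; case: (one p); rewrite ?andbT ?andbF ?orbF.
apply: leq_add.
  rewrite -(card_in_imset (f := body)).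
    apply/subset_leq_card/fintype.subsetP => _ /imsetP[p + ->].
    rewrite !finset.in_set => /andP[/andP[ps' pH] p1].
    have ps : p \in stars e r by rewrite finset.in_set.
    rewrite (card_body eirr ps) eqxx /=.
    by rewrite -/(one p) p1 /=; apply/pred0Pn; exists p.1; rewrite /= setU11.
  move=> p q; rewrite !finset.in_set => /andP[/andP[ps' _] p1] /andP[/andP[qs' _] _] E.
  have ps : p \in stars e r by rewrite finset.in_set.
  have qs : q \in stars e r by rewrite finset.in_set.
  have /cards1P[v dv] := p1.
  have := dominating_body eirr ps; rewrite dv inE => /eqP pv.
  have := dominating_body eirr qs; rewrite -E dv inE => /eqP qv.
  have h1 := body_center eirr ps; have h2 := body_center eirr qs.
  by case: p q pv qv E h1 h2 {ps qs ps' qs' p1 dv} => [v1 A1] [v2 A2] /= -> -> -> -> ->.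
pose g p : V * {set V} := (p.1, body p).
have gi : {in [set p in SH | ~~ one p] &, injective g}.
  move=> p q; rewrite !finset.in_set => /andP[/andP[ps' _] _] /andP[/andP[qs' _] _] [E1 E2].
  have ps : p \in stars e r by rewrite finset.in_set.
  have qs : q \in stars e r by rewrite finset.in_set.
  have h1 := body_center eirr ps; have h2 := body_center eirr qs.
  by case: p q E1 E2 h1 h2 {ps qs ps' qs'} => [v1 A1] [v2 A2] /= -> -> -> ->.
rewrite -(card_in_imset gi).
apply: (@leq_trans (\sum_(W in body @: touching) #|W|)%N); last first.
  apply: (@leq_trans (\sum_(W in body @: touching) r.+1)%N).
    apply: leq_sum => _ /imsetP[p + ->]; rewrite !finset.in_set => /andP[ps' _].
    have ps : p \in stars e r by rewrite finset.in_set.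
    by rewrite (card_body eirr ps).
  by rewrite sum_nat_const mulnC leq_mul2l leq_imset_card.
have -> : (\sum_(W in body @: touching) #|W| =
   #|[set q : V * {set V} | (q.2 \in body @: touching) && (q.1 \in q.2)]|)%N.
  rewrite -sum1_card (eq_bigl (fun q : V * {set V} => (q.2 \in body @: touching) && (q.1 \in q.2))); last by move=> q; rewrite finset.in_set.
  rewrite (eq_bigl (fun q : V * {set V} => true && ((q.2 \in body @: touching) && (q.1 \in q.2))))//.
  rewrite -(pair_big_dep xpredT (fun v W => (W \in body @: touching) && (v \in W)) (fun _ _ => 1%N)) /=.
  rewrite (exchange_big_dep (fun W => W \in body @: touching)) /=; last by move=> v W _ /andP[].
  apply: eq_bigr => W WT; rewrite -sum1_card; apply: eq_bigl => v.
  by rewrite WT.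
apply/subset_leq_card/fintype.subsetP => _ /imsetP[p + ->].
move=> pp; rewrite finset.in_set; apply/andP; split; last by rewrite /g /= setU11.
move: pp; rewrite !finset.in_set /g /= => /andP[/andP[ps' pH] p1].
have ps : p \in stars e r by rewrite finset.in_set.
have pd := dominating_body eirr ps.
have [v] : exists v, v \in dominating e (body p) :\ p.1.
  apply/set0Pn; rewrite -card_gt0; have := cardsD1 p.1 (dominating e (body p)).
  by move: p1; rewrite /one pd => + E; rewrite E; case: #|_ :\ _|.
rewrite in_setD1 => /andP[vh vd].
have [vs E] := star_of_dominating (card_body eirr ps) vd.
apply/imsetP; exists (v, body p :\ v) => //; move: vs; rewrite !finset.in_set => -> /=.
by apply/pred0Pn; exists p.1; rewrite /= in_setD1 eq_sym vh setU11.
Qed.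

Lemma card_stars_centered :
  #|[set p in stars e r | p.1 \in H]| = (\sum_(v in H) 'C(#|nbr e v|, r))%N.
Proof.
rewrite -sum1_card (eq_bigl (fun p => (p \in stars e r) && (p.1 \in H))); last by move=> p; rewrite finset.in_set.
rewrite big_mkcondr /= (sum_stars e r (fun v _ => if v \in H then 1 else 0)%N).
rewrite [RHS]big_mkcond; apply: eq_bigr => v _; case: ifP => _; last by rewrite big1.
by rewrite -cards_draws -sum1_card; apply: eq_bigl => A; rewrite inE.
Qed.

(** Choose the leaf [h] in [H], then the centre [v] among its neighbours, then the other [r.-1]
    leaves. *)
Lemma card_touching_le :
  (#|touching| <= \sum_(h in H) \sum_(v in nbr e h) 'C(#|nbr e v|.-1, r.-1))%N.
Proof.
rewrite -sum1_card (eq_bigl (fun p => (p \in stars e r) && ~~ [disjoint p.2 & H])); last by move=> p; rewrite finset.in_set.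
rewrite big_mkcondr /= (sum_stars e r (fun _ A => if ~~ [disjoint A & H] then 1 else 0)%N).
under [X in (_ <= X)%N]eq_bigr do rewrite big_mkcond /=.
rewrite exchange_big /=; apply: leq_sum => v _.
apply: (@leq_trans (\sum_(A : {set V} | (A \subset nbr e v) && (#|A| == r)) \sum_(h in H) (h \in A))%N).
  apply: leq_sum => A _; case: ifP => // /pred0Pn[h /= /andP[hA hH]].
  by rewrite (bigD1 h)//= hA.
rewrite exchange_big /=; apply: leq_sum => h _; rewrite inE esym.
case: ifPn => vh; last first.
  rewrite big1// => A /andP[/fintype.subsetP AN _]; apply/eqP; rewrite eqb0.
  by apply/negP => /AN; rewrite inE (negPf vh).
have -> : (#|nbr e v|.-1 = #|nbr e v :\ h|)%N.
  by rewrite (cardsD1 h (nbr e v)) inE vh.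
rewrite -cards_draws -big_mkcondr /= sum1_card.
rewrite -(card_in_imset (f := fun A : {set V} => A :\ h)).
  apply/subset_leq_card/fintype.subsetP => _ /imsetP[A + ->].
  rewrite -topredE /= => /andP[/andP[AN /eqP cA] hA].
  rewrite inE finset.setSD//= ; move: cA; rewrite (cardsD1 h) hA add1n => <-.
  by [].
move=> A A'; rewrite -!topredE /= => /andP[_ hA] /andP[_ hA'] E.
by rewrite -(finset.setD1K hA) E finset.setD1K.
Qed.

End pruning.

(** * The elementary events for a frozen colouring of [H], and their dependence errors *)

Section star_events.
Context {R : realType} {V C : finType}.
Variables (e : rel V) (H : {set V}) (r : nat) (a : {ffun V -> C}).
Hypothesis esym : symmetric e.
Hypothesis eirr : irreflexive e.
Hypothesis r_gt0 : (0 < r)%N.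
Hypothesis C_gt0 : (0 < #|C|)%N.
Hypothesis a_inj : {in H &, injective a}.
Let c : R := #|C|%:R.
Let e' := prune e H.
Implicit Types (W : {set V}) (x : {ffun V -> C}).

Let c_gt0 : 0 < c. Proof. by rewrite ltr0n. Qed.
Let c_neq0 : c != 0. Proof. by rewrite gt_eqF. Qed.
Let ci_ge0 : 0 <= c^-1. Proof. by rewrite invr_ge0 ltW. Qed.
Let ci_le1 : c^-1 <= 1. Proof. by rewrite invf_le1 ?ler1n. Qed.

(* Elementary events: [inl (v, u)] says that the neighbour [u] of the high-degree
   vertex [v] receives the colour [a v]; [inr W] says that [W], which spans a star
   of the pruned graph, is monochromatic. *)
Definition event : finType := ((V * V) + {set V})%type.

Definition ev_set (t : event) : {set V} :=
  match t with inl p => [set p.2] | inr W => W end.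

Definition star_body W := (#|W| == r.+1) && (0 < #|dominating e' W|)%N.

Definition ev_valid (t : event) : bool :=
  match t with inl p => (p.1 \in H) && e p.1 p.2 | inr W => star_body W end.

Definition happens (t : event) x : bool :=
  ev_valid t &&
  match t with inl p => x p.2 == a p.1 | inr W => mono W x end.

(** A valid body has between 1 and [r.+1] dominating vertices, so [inord] keeps its number and the
    label [inr 0] receives invalid events only. *)
Definition ev_lab (t : event) : (V + 'I_r.+2)%type :=
  match t with inl p => inl p.1 | inr W => inr (inord #|dominating e' W|) end.

Definition ev_weight (t : event) : R :=
  match t with inl _ => c^-1 | inr _ => c^-1 ^+ r end.

Lemma depends_happens t : depends_on (ev_set t) (happens t).
Proof.
case: t => [[v u]|W] x y xy; rewrite /happens /=; congr (_ && _).
  by rewrite xy ?finset.in_set1 /=.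
exact: depends_mono.
Qed.

Lemma star_body_neq0 W : star_body W -> exists v, v \in W.
Proof. by move=> /andP[/eqP cW _]; apply/set0Pn; rewrite -card_gt0 cW. Qed.

Lemma avg_color (b : C) (u : V) : avg (fun x : {ffun V -> C} => (x u == b)%:R) = c^-1 :> R.
Proof.
rewrite -[RHS]expr1 exprVn -(cards1 u) -(avg_agree C_gt0 _ (fun=> b)).
apply: eq_avg => x; congr (nat_of_bool _)%:R; apply/idP/forall_inP => [h w|].
  by rewrite inE => /eqP ->.
by apply; rewrite inE.
Qed.

Lemma prob_happens t : prob happens t = (ev_valid t)%:R * ev_weight t.
Proof.
rewrite /prob /happens; case: (boolP (ev_valid t)) => vt /=; last first.
  by rewrite avg_cst// mul0r.
rewrite mul1r; case: t vt => [[v u]|W] /= vt; first exact: avg_color.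
have [v vW] := star_body_neq0 vt.
by rewrite (avg_mono C_gt0 vW) exprVn; case/andP : vt => /eqP ->.
Qed.

(** Bounds the expected number of other monochromatic bodies meeting [W], given the colours on
    [W]. *)
Definition near_bodies W : R :=
  \sum_(W' : {set V} | [&& star_body W', W' != W & ~~ [disjoint W' & W]])
     c^-1 ^+ #|W' :\: W|.

(** A body other than [W] has the same size, hence is not contained in [W]; it carries at least one
    star, so the bound for straddling stars applies. *)
Lemma near_bodies_le (E : R) W : star_body W -> 0 <= E ->
  (forall v, #|nbr e' v|%:R <= E * c) -> near_bodies W <= overlap_bound r.+1 E.
Proof.
move=> bW E0 dE.
have cW : #|W| = r.+1 by case/andP : bW => /eqP.
have Wr : (#|W| <= r.+1)%N by rewrite cW.
have := sum_overlap_le (prune_sym H esym) (prune_irr H eirr) C_gt0 E0 dE r Wr.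
apply: le_trans; rewrite big_mkcondr /=.
pose F W' : R := if ~~ [disjoint W' & W] && ~~ (W' \subset W) then c^-1 ^+ #|W' :\: W| else 0.
rewrite (sum_stars_body (prune_irr H eirr) r F) /near_bodies.
rewrite big_mkcond [leRHS]big_mkcond /=; apply: ler_sum => W' _.
have w0 : 0 <= c^-1 ^+ #|W' :\: W| by rewrite exprn_ge0.
have F0 : 0 <= F W' by rewrite /F; case: ifP.
rewrite /star_body; case: eqP => //= cW'; case: ltnP => //= d0; last by rewrite mulrn_wge0.
case: ifP => [/andP[ne nd]|_]; last by rewrite mulrn_wge0.
have -> : c^-1 ^+ #|W' :\: W| = F W'.
  rewrite /F nd /= (_ : ~~ _)//; apply: contra ne => sub.
  by rewrite eqEcard sub cW cW' leqnn.
by rewrite -mulr_natl ler_peMl// ler1n.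
Qed.

Lemma big_event (F : event -> R) (P : pred event) :
  \sum_(t | P t) F t =
  \sum_(p : V * V | P (inl p)) F (inl p) + \sum_(W : {set V} | P (inr W)) F (inr W).
Proof. by rewrite big_sumType. Qed.

Lemma avg_color_mono (b : C) (u : V) W : star_body W -> u \in W ->
  avg (fun x : {ffun V -> C} => ((x u == b) && mono W x)%:R) <= c^-1 * c^-1 ^+ r.
Proof.
move=> bW uW; rewrite -[X in _ <= X * _](avg_color b u) -avgZr (avg_merge C_gt0 [set u]).
apply: le_avg => y.
case E : (y u == b); last first.
  rewrite mul0r -(avg_cst C_gt0 0 (V := V)); apply: le_avg => x.
  by rewrite ffunE inE eqxx E.
have uu : u \in W :&: [set u] by rewrite !inE uW eqxx.
rewrite mul1r; apply: (le_trans _ (le_trans (avg_mono_merge C_gt0 y uu) _)).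
  by apply: le_avg => x; rewrite ler_nat; case: (mono _ _); rewrite ?andbF// leq_b1.
case/andP : bW => /eqP cW _; move: cW; rewrite (cardsD1 u) uW add1n => -[->].
by rewrite exprVn.
Qed.

Lemma avg_mono_mono W W' : star_body W -> star_body W' -> ~~ [disjoint W' & W] ->
  avg (fun x : {ffun V -> C} => (mono W x && mono W' x)%:R) <=
  c^-1 ^+ r * c^-1 ^+ #|W' :\: W|.
Proof.
move=> bW bW' /pred0Pn[u /= /andP[uW' uW]].
have uu : u \in W' :&: W by rewrite inE uW' uW.
have -> : c^-1 ^+ r = avg (fun x : {ffun V -> C} => (mono W x)%:R).
  by have := prob_happens (inr W); rewrite /prob /happens /= bW /= mul1r.
rewrite -avgZr (avg_merge C_gt0 W); apply: le_avg => y.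
case E : (mono W y); last first.
  rewrite mul0r -(avg_cst C_gt0 0 (V := V)); apply: le_avg => x.
  by rewrite (depends_mono (x := merge W y x) (y := y)) ?E//; exact: merge_in.
rewrite mul1r exprVn; apply: (le_trans _ (avg_mono_merge C_gt0 y uu)).
by apply: le_avg => x; rewrite ler_nat; case: (mono W' _); rewrite ?andbF// leq_b1.
Qed.

Lemma link_error_invalid t : ~~ ev_valid t -> link_error ev_set happens t = 0 :> R.
Proof.
move=> vt; rewrite /link_error.
rewrite big1 ?add0r; last by move=> b _; rewrite prob_happens (negPf vt) !mul0r.
rewrite big1// => b _; rewrite (eq_avg (g := fun=> 0)) ?avg_cst// => x.
by rewrite /happens (negPf vt).
Qed.

Lemma sum_neighbors_pairs (W : {set V}) :
  \sum_(p : V * V | p.2 \in W) ((p.1 \in H) && e p.1 p.2)%:R * c^-1 <=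
  #|H|%:R * #|W|%:R * c^-1 :> R.
Proof.
rewrite -mulr_suml ler_wpM2r// -natrM -natr_sum ler_nat -cardsX -sum1_card big_mkcond.
rewrite [X in (_ <= X)%N]big_mkcond; apply: leq_sum => -[v u] _.
by rewrite inE /=; case: (v \in H); case: (u \in W); case: (e v u).
Qed.

Lemma link_error_color v u : v \in H -> e v u ->
  link_error ev_set happens (inl (v, u)) <=
  c^-1 * (#|H|%:R * c^-1 + 2 * \sum_(W : {set V} | star_body W && (u \in W)) c^-1 ^+ r) :> R.
Proof.
move=> vH vu; rewrite /link_error.
have wr0 : 0 <= c^-1 ^+ r by rewrite exprn_ge0.
have lu t : linked ev_set (inl (v, u)) t -> u \in ev_set t.
  case/orP => [/eqP <-|]; first by rewrite inE.
  by case/pred0Pn => w; rewrite /= inE => /andP[/eqP ->].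
rewrite mulrDr [2 * _]mulr_natl mulr2n mulrDr addrA; apply: lerD.
  rewrite -mulr_sumr prob_happens /= vH vu mul1r -mulrDr ler_wpM2l//.
  rewrite big_event; apply: lerD.
    apply: (@le_trans _ _ (\sum_(p : V * V | p.2 \in [set u]) ((p.1 \in H) && e p.1 p.2)%:R * c^-1)).
      rewrite big_mkcond [leRHS]big_mkcond; apply: ler_sum => p _.
      rewrite prob_happens /=; case: ifP => [/lu /=|_].
        by rewrite !inE eq_sym => ->.
      by case: ifP => // _; rewrite mulr_ge0.
    by rewrite (le_trans (sum_neighbors_pairs _))// cards1 mulr1.
  rewrite big_mkcond [leRHS]big_mkcond; apply: ler_sum => W _.
  rewrite prob_happens /=; case: ifP => [/lu /= ->|_].
    by case: (star_body W); rewrite ?mul1r ?mul0r.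
  by case: ifP.
(* A colour event linked to [(v, u)] sits at the same vertex [u]. Two distinct ones require
   different colours of [u], because [a] is injective on [H], so they never occur together. *)
rewrite big_event big1 ?add0r; last first.
  move=> [v' u'] /andP[/lu /= uu' ne]; rewrite inE in uu'; move/eqP in uu'; subst u'.
  rewrite (eq_avg (g := fun=> 0)) ?avg_cst// => x.
  rewrite /happens /= vH vu /=; case: eqP => //= xv; case: andP => //= -[/andP[v'H _] /eqP xv'].
  case/negP : ne; apply/eqP; congr (inl (_, _)).
  by apply: a_inj; rewrite // -xv -xv'.
rewrite mulr_sumr big_mkcond [leRHS]big_mkcond; apply: ler_sum => W _.
case: ifP => [/andP[/lu /= uW _]|_]; last by case: ifP => // _; rewrite mulr_ge0.
rewrite uW andbT; case bW : (star_body W).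
  apply: le_trans (avg_color_mono (a v) bW uW); apply: le_avg => x.
  by rewrite /happens /= vH vu bW.
rewrite (eq_avg (g := fun=> 0)) ?avg_cst// => x.
by rewrite /happens /= bW andbF.
Qed.

(** The first term comes from the colour events at the vertices of [W], and [K] from the other
    bodies; both occur in the two sums of [link_error], hence the factors 2. The single [c^-1] comes
    from pairing [W] with itself. *)
Lemma link_error_body (K : R) W : star_body W -> near_bodies W <= K ->
  link_error ev_set happens (inr W) <=
  c^-1 ^+ r * (2 * (#|H|%:R * r.+1%:R * c^-1) + c^-1 + 2 * K) :> R.
Proof.
move=> bW WK; rewrite /link_error.
have cW : #|W| = r.+1 by case/andP : bW => /eqP.
have wr0 : 0 <= c^-1 ^+ r by rewrite exprn_ge0.
have wr1 : c^-1 ^+ r <= c^-1.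
  by rewrite -[leRHS]expr1 ler_wiXn2l.
have lu p : linked ev_set (inr W) (inl p) -> p.2 \in W.
  case/orP => // /pred0Pn[w /= /andP[wW]].
  by rewrite inE => /eqP <-.
have lW W' : star_body W' -> linked ev_set (inr W) (inr W') -> W' != W -> ~~ [disjoint W' & W].
  by move=> _ /orP[/eqP[->]|]; rewrite ?eqxx// disjoint_sym.
have P1 : \sum_(p | linked ev_set (inr W) (inl p)) ((p.1 \in H) && e p.1 p.2)%:R * c^-1 <=
    #|H|%:R * r.+1%:R * c^-1.
  rewrite -cW; apply: le_trans (sum_neighbors_pairs W).
  rewrite big_mkcond [leRHS]big_mkcond; apply: ler_sum => p _.
  case: ifP => [/lu ->//|_].
  by case: ifP => // _; rewrite mulr_ge0.
have -> : c^-1 ^+ r * (2 * (#|H|%:R * r.+1%:R * c^-1) + c^-1 + 2 * K) =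
   c^-1 ^+ r * (#|H|%:R * r.+1%:R * c^-1 + (c^-1 + K)) +
   c^-1 ^+ r * (#|H|%:R * r.+1%:R * c^-1 + K) by ring.
apply: lerD.
  rewrite -mulr_sumr prob_happens /= bW mul1r ler_wpM2l// big_event.
  apply: lerD; first by under eq_bigr do rewrite prob_happens /=.
  rewrite (bigD1 W) /=; last by rewrite /linked eqxx.
  rewrite prob_happens /= bW mul1r; apply: lerD => //; apply: le_trans WK.
  rewrite big_mkcond /near_bodies [leRHS]big_mkcond; apply: ler_sum => W' _.
  rewrite prob_happens /=; have w0 : 0 <= c^-1 ^+ #|W' :\: W| by rewrite exprn_ge0.
  case bW' : (star_body W') => /=; last by rewrite mul0r; case: ifP.
  case: ifP => [/andP[/(lW _ bW') h ne]|_]; last by case: ifP.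
  rewrite ne h // mul1r; apply: ler_wiXn2l => //.
  have /pred0Pn[u /= /andP[uW' uW]] := h ne.
  have cW' : #|W'| = r.+1 by case/andP : bW' => /eqP.
  rewrite -ltnS -cW' [X in (_ < X)%N](cardsD1 u) uW' add1n ltnS.
  apply/subset_leq_card/fintype.subsetP => w; rewrite !inE => /andP[wW ->].
  by rewrite andbT; apply: contraNneq wW => ->.
rewrite big_event mulrDr; apply: lerD.
  apply: (le_trans _ (ler_wpM2l wr0 P1)).
  rewrite mulr_sumr big_mkcond [leRHS]big_mkcond; apply: ler_sum => -[v u] _.
  rewrite andbT; case: ifP => // /lu /= uW.
  case vv : ((v \in H) && e v u); last first.
    rewrite mul0r mulr0 (eq_avg (g := fun=> 0)) ?avg_cst// => x.
    by rewrite /happens /= vv andbF.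
  rewrite mul1r mulrC; apply: le_trans (avg_color_mono (a v) bW uW).
  by apply: le_avg => x; rewrite /happens /= vv bW /= andbC.
apply: (le_trans _ (ler_wpM2l wr0 WK)).
rewrite /near_bodies mulr_sumr big_mkcond [leRHS]big_mkcond; apply: ler_sum => W' _.
have w0 : 0 <= c^-1 ^+ r * c^-1 ^+ #|W' :\: W| by rewrite mulr_ge0 ?exprn_ge0.
case bW' : (star_body W') => /=; last first.
  case: ifP => // _; rewrite (eq_avg (g := fun=> 0)) ?avg_cst// => x.
  by rewrite /happens /= bW' andbF.
have -> : (inr W' != inr W :> event) = (W' != W) by [].
case: ifP => [/andP[/(lW _ bW') h ne]|_]; last by case: ifP.
rewrite ne h //; apply: le_trans (avg_mono_mono bW bW' (h ne)).
by apply: le_avg => x; rewrite /happens /= bW bW'.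
Qed.

Lemma card_star_body_le : (#|[set W | star_body W]| <= #|stars e r|)%N.
Proof.
apply: (@leq_trans #|stars e' r|); last first.
  apply/subset_leq_card/fintype.subsetP => p.
  by rewrite stars_prune// => /andP[].
rewrite (card_stars_sets (prune_irr H eirr)) -sum1_card big_mkcond [X in (_ <= X)%N]big_mkcond.
by apply: leq_sum => W _; rewrite inE /star_body; case: ifP => // /andP[->].
Qed.

(** The part with the factor [c^-1] vanishes in the limit. The last term is small only because [E]
    bounds the degrees after pruning; the cruder [B] serves for the vertices of [H]. *)
Lemma sum_link_error_le (B E : R) : 0 <= E ->
  (forall v, #|nbr e v|%:R <= B * c) -> (forall v, #|nbr e' v|%:R <= E * c) ->
  \sum_t link_error ev_set happens t <=
  c^-1 * (#|H|%:R ^+ 2 * B + (4 * #|H|%:R * r.+1%:R + 1) * star_mean (C := C) e r) +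
  2 * star_mean (C := C) e r * overlap_bound r.+1 E :> R.
Proof.
move=> E0 dB dE; set mu := star_mean (C := C) e r; set K := overlap_bound r.+1 E.
have wr0 : 0 <= c^-1 ^+ r by rewrite exprn_ge0.
have K0 : 0 <= K.
  rewrite !mulr_ge0 ?exprn_ge0// addr_ge0 ?mulr_ge0 ?expR_ge0//.
  by rewrite subr_ge0 -expR0 ler_expR.
have muW : \sum_(W : {set V} | star_body W) c^-1 ^+ r <= mu.
  rewrite (eq_bigl (fun W => W \in [set W | star_body W])); last by move=> W; rewrite inE.
  rewrite sumr_const -[_ *+ #|_|]mulr_natl /mu /star_mean exprVn; apply: ler_wpM2r.
    by rewrite invr_ge0 exprn_ge0// ltW.
  by rewrite ler_nat card_star_body_le.
rewrite big_event.
have h1 : \sum_(p : V * V) link_error ev_set happens (inl p) <=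
   c^-1 * (#|H|%:R ^+ 2 * B) + c^-1 * (2 * #|H|%:R * r.+1%:R) * mu :> R.
  apply: (@le_trans _ _ (\sum_(v in H) \sum_(u in nbr e v) (c^-1 * (#|H|%:R * c^-1)) +
      \sum_(v in H) \sum_u c^-1 * (2 * \sum_(W : {set V} | star_body W && (u \in W)) c^-1 ^+ r))).
    rewrite -big_split /= -(pair_bigA _ (fun v u => link_error ev_set happens (inl (v, u)))) /=.
    rewrite [leRHS]big_mkcond; apply: ler_sum => v _; case: ifP => vH; last first.
      by rewrite big1// => u _; rewrite link_error_invalid//= vH.
    rewrite [X in _ <= X + _]big_mkcond -big_split; apply: ler_sum => u _ /=; rewrite inE.
    have s0 : 0 <= c^-1 * (2 * \sum_(W : {set V} | star_body W && (u \in W)) c^-1 ^+ r).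
      by rewrite !mulr_ge0// sumr_ge0.
    case: ifP => vu; last by rewrite link_error_invalid ?add0r//= vu andbF.
    by rewrite -mulrDr link_error_color.
  apply: lerD.
    apply: (@le_trans _ _ (\sum_(v in H) (B * c * (c^-1 * (#|H|%:R * c^-1))))).
      apply: ler_sum => v _; rewrite sumr_const -[_ *+ #|_|]mulr_natl.
      by rewrite ler_wpM2r// !mulr_ge0.
    rewrite sumr_const -[_ *+ #|_|]mulr_natl le_eqVlt; apply/orP; left; apply/eqP.
    by field.
  rewrite sumr_const -[_ *+ #|_|]mulr_natl.
  have -> : c^-1 * (2 * #|H|%:R * r.+1%:R) * mu = #|H|%:R * (c^-1 * (2 * (r.+1%:R * mu))) by ring.
  rewrite ler_wpM2l// -!mulr_sumr !ler_wpM2l//.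
  under eq_bigr do rewrite big_mkcondr /=.
  rewrite exchange_big /=; apply: (le_trans _ (ler_wpM2l _ muW)) => //.
  rewrite mulr_sumr; apply: ler_sum => W /andP[/eqP cW _].
  by rewrite -big_mkcond sumr_const cW mulr_natl.
have h2 : \sum_(W : {set V}) link_error ev_set happens (inr W) <=
   mu * (2 * (#|H|%:R * r.+1%:R * c^-1) + c^-1 + 2 * K) :> R.
  apply: (@le_trans _ _ (\sum_(W : {set V} | star_body W) c^-1 ^+ r *
      (2 * (#|H|%:R * r.+1%:R * c^-1) + c^-1 + 2 * K))).
    rewrite [leRHS]big_mkcond; apply: ler_sum => W _; case: ifPn => bW.
      by apply: link_error_body => //; exact: near_bodies_le.
    by rewrite link_error_invalid.
  rewrite -mulr_suml; apply: ler_wpM2r => //.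
  have k0 : 0 <= 2 * K by rewrite mulr_ge0.
  have h0 : 0 <= 2 * (#|H|%:R * r.+1%:R * c^-1) by rewrite mulr_ge0// mulr_ge0// mulr_ge0.
  exact: addr_ge0 (addr_ge0 h0 ci_ge0) k0.
apply: le_trans (lerD h1 h2) _.
by rewrite le_eqVlt; apply/orP; left; apply/eqP; ring.
Qed.

End star_events.

(** * Comparison of the generating function with a product of Poisson ones *)

Section star_pgf.
Context {R : realType} {V C : finType}.
Variables (e : rel V) (H : {set V}) (r : nat) (z : R).
Hypothesis esym : symmetric e.
Hypothesis eirr : irreflexive e.
Hypothesis r_gt0 : (0 < r)%N.
Hypothesis C_gt0 : (0 < #|C|)%N.
Hypothesis z01 : 0 <= z <= 1.
Let c : R := #|C|%:R.
Let e' := prune e H.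
Implicit Types (W : {set V}) (a x : {ffun V -> C}).

Let c_gt0 : 0 < c. Proof. by rewrite ltr0n. Qed.
Let ci_ge0 : 0 <= c^-1. Proof. by rewrite invr_ge0 ltW. Qed.

(* The star count when [H] is coloured by [a] and the (negligible) stars with a leaf
   in [H] are discarded. *)
Definition surrogate a x : nat :=
  (\sum_(v in H) 'C(#|[set u in nbr e v | x u == a v]|, r) + mono_count e' r x)%N.

Definition pgf_factor (i : V + 'I_r.+2) (m : nat) : R :=
  match i with inl _ => z ^+ 'C(m, r) | inr k => z ^+ (k * m) end.

Lemma pow_z01 n : 0 <= z ^+ n <= 1.
Proof. by case/andP: z01 => z0 z1; rewrite exprn_ge0// exprn_ile1. Qed.

Lemma norm_pow_sub m n : `|z ^+ m - z ^+ n| <= 1.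
Proof.
have := pow_z01 m; have := pow_z01 n; move: (z ^+ m) (z ^+ n) => s t.
by move=> /andP[? ?] /andP[? ?]; rewrite ler_norml; lra.
Qed.

Lemma pgf_factor_le1 i m : `|pgf_factor i m| <= 1.
Proof.
case: i => [v|k] /=; rewrite ger0_norm; try by case/andP: (pow_z01 'C(m, r)).
  by case/andP: (pow_z01 (k * m)).
by case/andP: (pow_z01 (k * m)).
Qed.

Lemma leq_dominating W : (#|dominating e' W| <= #|W|)%N.
Proof. by apply/subset_leq_card/fintype.subsetP => v; rewrite inE => /andP[]. Qed.

Lemma prod_pgf_factor a x :
  \prod_i pgf_factor i (count_lab (happens e H r a) (ev_lab e H r) i x) =
  z ^+ surrogate a x.
Proof.
rewrite big_sumType /= /surrogate exprD; congr (_ * _).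
  rewrite -prodrXr [RHS]big_mkcond /=; apply: eq_bigr => v _.
  rewrite /count_lab big_sumType /= [X in (_ + X)%N]big_pred0 // addn0.
  rewrite (eq_bigl (fun p : V * V => p.1 == v)); last by move=> p; rewrite /= -[in RHS](inj_eq (@inl_inj V 'I_r.+2)).
  rewrite (eq_bigr (fun p : V * V => ((v \in H) && (e v p.2) && (x p.2 == a v) : nat))); last first.
    by move=> [v' u] /= /eqP ->.
  rewrite (eq_bigl (fun p : V * V => (p.1 == v) && true)); last by move=> p; rewrite andbT.
  rewrite -(pair_big (fun v' => v' == v) xpredT (fun _ u => ((v \in H) && (e v u) && (x u == a v) : nat))) /=.
  rewrite big_pred1_eq; case: ifP => vH /=; last by rewrite big1 ?bin_small.
  congr (_ ^+ 'C(_, _)); rewrite -sum1_card [RHS]big_mkcond; apply: eq_bigr => u _.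
  by rewrite !inE; case: (e v u); case: (x u == a v).
rewrite prodrXr; congr (_ ^+ _).
rewrite (mono_count_sets (prune_irr H eirr)).
rewrite (partition_big (fun W => inord #|dominating e' W| : 'I_r.+2) xpredT) //=.
apply: eq_bigr => k _; rewrite /count_lab big_sumType /= [X in (X + _)%N]big_pred0 // add0n.
rewrite big_distrr /= big_mkcond [RHS]big_mkcond /=; apply: eq_bigr => W _.
rewrite -[inr _ == inr k](inj_eq (@inr_inj V 'I_r.+2)) || idtac.
have -> : (inr (inord #|dominating e' W|) == inr k :> V + 'I_r.+2) = (inord #|dominating e' W| == k) by [].
rewrite /happens /= /star_body; case: eqP => [kW|_]; rewrite ?andbF//= andbT.
case: eqP => //= cW; last by rewrite muln0.
have -> : (k : nat) = #|dominating e' W|.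
  by rewrite -kW inordK// ltnS -cW leq_dominating.
by case: posnP => [->|] //=; rewrite mul0n.
Qed.

Lemma rate_color a v : rate (happens e H r a) (ev_lab e H r) (inl v) =
  if v \in H then #|nbr e v|%:R / c else 0 :> R.
Proof.
rewrite /rate big_sumType /= [X in _ + X]big_pred0 // addr0.
rewrite (eq_bigr (fun p : V * V => ((v \in H) && (e v p.2))%:R / c)); last first.
  by move=> [v' u] /= /eqP[->]; rewrite prob_happens.

rewrite (eq_bigl (fun p : V * V => (p.1 == v) && true)); last first.
  by move=> p; rewrite andbT.
rewrite -(pair_big (fun v' => v' == v) xpredT (fun _ u => ((v \in H) && (e v u))%:R / c)) /=.
rewrite big_pred1_eq -mulr_suml -natr_sum; case: ifP => vH /=; last by rewrite big1 ?mul0r.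
congr (_%:R / c); rewrite -sum1_card [RHS]big_mkcond; apply: eq_bigr => u _.
by rewrite inE; case: (e v u).
Qed.

Lemma rate_body a (k : 'I_r.+2) : rate (happens e H r a) (ev_lab e H r) (inr k) =
  if (0 < k)%N then #|star_sets e' r k|%:R / c ^+ r else 0 :> R.
Proof.
rewrite /rate big_sumType /= [X in X + _]big_pred0 // add0r.
rewrite (eq_bigr (fun W => (star_body e H r W)%:R * c^-1 ^+ r)); last first.
  by move=> W _; rewrite prob_happens.
rewrite -mulr_suml -natr_sum.
have -> : (\sum_(W : {set V} | inr (inord #|dominating e' W|) == inr k :> V + 'I_r.+2) star_body e H r W =
   if (0 < k)%N then #|star_sets e' r k| else 0)%N; last by case: ifP; rewrite ?mul0r// exprVn.
transitivity (\sum_(W : {set V} | (#|W| == r.+1) && (#|dominating e' W| == k)) (0 < k))%N.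
  rewrite [LHS]big_mkcond [RHS]big_mkcond; apply: eq_bigr => W _.
  rewrite /star_body; case: (#|W| =P r.+1) => [cW|_] /=; last by case: ifP.
  have -> : (inr (inord #|dominating e' W|) == inr k :> V + 'I_r.+2) = (#|dominating e' W| == k).
    have -> : (inr (inord #|dominating e' W|) == inr k :> V + 'I_r.+2) = (inord #|dominating e' W| == k) by [].
    by rewrite -val_eqE /= inordK// ltnS -cW leq_dominating.
  by case: eqP => // ->.
case: ifP => k0; last by rewrite big1.
by rewrite -sum1_card; apply: eq_bigl => W; rewrite inE.
Qed.

(** The colours [a] of [H] do not occur here, so the estimate conditional on [a] can be averaged
    over [a]. *)
Definition pgf_approx : R :=
  \prod_(v in H) pmean (#|nbr e v|%:R / c) (fun m => z ^+ 'C(m, r)) *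
  \prod_(1 <= k < r.+2) pmean (#|star_sets e' r k|%:R / c ^+ r) (fun m => z ^+ (k * m)).

Lemma prod_pmean_factor a :
  \prod_i pmean (rate (happens e H r a) (ev_lab e H r) i) (pgf_factor i) = pgf_approx.
Proof.
rewrite big_sumType /= /pgf_approx; congr (_ * _).
  rewrite [RHS]big_mkcond; apply: eq_bigr => v _; rewrite rate_color.
  by case: ifP => // _; rewrite pmean0 /= bin_small.
rewrite big_ord_recl rate_body /= pmean0 /= mul0n expr0 mul1r.
rewrite big_add1 big_mkord; apply: eq_bigr => k _.
by rewrite rate_body /= /bump leq0n add1n.
Qed.

(** [surrogate] reads the unmerged colours [x] on [H] too; this is harmless unless one of them hits
    a colour that [a] uses on [H]. *)
Definition bad_colors a x : nat := \sum_(u in H) \sum_(v in H) (x u == a v).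

Definition bad_stars a x : nat := \sum_(p in touching e H r) mono (body p) (merge H a x).

Lemma mono_count_surrogate a x : {in H &, injective a} ->
  bad_colors a x = 0%N -> bad_stars a x = 0%N ->
  mono_count e r (merge H a x) = surrogate a x.
Proof.
move=> a_inj /eqP; rewrite sum_nat_eq0 => /forall_inP b1.
have {b1} b1 u v : u \in H -> v \in H -> (x u == a v) = false.
  by move=> /b1; rewrite sum_nat_eq0 => /forall_inP b /b; rewrite eqb0 => /negbTE.
move=> /eqP; rewrite sum_nat_eq0 => /forall_inP b2.
have {b2} b2 p : p \in touching e H r -> mono (body p) (merge H a x) = false.
  by move=> /b2; rewrite eqb0 => /negbTE.
rewrite /mono_count (bigID (fun p => p.1 \in H)) /= /surrogate; congr (_ + _)%N.
  rewrite big_mkcondr /= /body.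
  rewrite (sum_stars e r (fun v A => if v \in H then mono (v |: A) (merge H a x) : nat else 0%N)).
  rewrite [RHS]big_mkcond; apply: eq_bigr => v _; case: ifP => vH; last by rewrite big1.
  rewrite -cards_draws -sum1_card [LHS]big_mkcond [RHS]big_mkcond /=.
  apply: eq_bigr => A _; rewrite inE.
  have -> : mono (v |: A) (merge H a x) = [forall u in A :\ v, merge H a x u == a v].
    rewrite (@mono_center _ _ _ v) ?setU11//; apply: eq_forallb => u.
    by rewrite !inE /= [merge H a x v]ffunE vH; case: (u == v).
  case: (boolP (A \subset nbr e v)) => [/fintype.subsetP AN|AN] /=; last first.
    suff -> : (A \subset [set u in nbr e v | x u == a v]) = false by [].
    apply: contraNF AN => /fintype.subsetP h; apply/fintype.subsetP => u /h.
    by rewrite inE => /andP[].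
  have vA : v \notin A by apply/negP => /AN; rewrite inE eirr.
  case: eqP => [cA|_]; last by rewrite andbF.
  rewrite andbT; congr (nat_of_bool _).
  apply/forall_inP/fintype.subsetP => h u.
    move=> uA; have uv : u != v by apply: contraNneq vA => <-.
    have := h u; rewrite !inE uv uA ffunE => /(_ isT).
    have := AN u uA; rewrite inE => vu; rewrite vu /=.
    case: ifP => // uH /eqP auv; case/negP : uv; apply/eqP; exact: a_inj.
  rewrite !inE => /andP[uv uA]; rewrite ffunE; case: ifP => uH.
    by have := h u uA; rewrite !inE b1// andbF.
  by have := h u uA; rewrite !inE => /andP[].
rewrite [LHS]big_mkcond [RHS]big_mkcond; apply: eq_bigr => p _.
rewrite stars_prune //; case: (boolP (p \in stars e r)) => //= ps.
case: (boolP [disjoint body p & H]) => [dH|dH].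
  rewrite (disjointFr dH) ?setU11//=; congr (nat_of_bool _).
  apply: depends_mono => v vp; apply: merge_out.
  by rewrite inE (disjointFr dH).
case: ifP => // pH; rewrite b2// finset.in_set; move: ps; rewrite finset.in_set => -> /=.
apply: contra dH; rewrite !disjoint_subset => /fintype.subsetP h; apply/fintype.subsetP => w.
by rewrite !inE => /orP[/eqP ->//|/h].
Qed.

Lemma avg_bad_colors : avg (fun a => avg (fun x => (bad_colors a x)%:R)) =
  #|H|%:R ^+ 2 * c^-1 :> R.
Proof.
rewrite -[RHS](avg_cst C_gt0 (V := V)); apply: eq_avg => a.
under eq_avg do rewrite natr_sum.
rewrite avg_sum (eq_bigr (fun _ => #|H|%:R * c^-1)) ?sumr_const.
  by rewrite -[_ *+ #|_|]mulr_natl mulrA.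
move=> u _; under eq_avg do rewrite natr_sum.
rewrite avg_sum (eq_bigr (fun _ => c^-1)) ?sumr_const ?mulr_natl// => v _.
exact: avg_color.
Qed.

Lemma avg_bad_stars : avg (fun a => avg (fun x => (bad_stars a x)%:R)) =
  #|touching e H r|%:R / c ^+ r :> R.
Proof.
rewrite -(avg_merge C_gt0 H (fun x => (\sum_(p in touching e H r) mono (body p) x)%N%:R)).
under eq_avg do rewrite natr_sum.
rewrite avg_sum (eq_bigr (fun _ => c^-1 ^+ r)) ?sumr_const ?exprVn ?mulr_natl// => p.
by rewrite finset.in_set => /andP[ps _]; rewrite -exprVn; apply: avg_mono_body.
Qed.

Definition clashes a : nat := \sum_(u in H) \sum_(v in H | v != u) (a u == a v).

Lemma avg_clashes : avg (fun a => (clashes a)%:R) <= #|H|%:R ^+ 2 * c^-1 :> R.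
Proof.
under eq_avg do rewrite natr_sum.
rewrite avg_sum; apply: (@le_trans _ _ (\sum_(u in H) #|H|%:R * c^-1)); last first.
  by rewrite sumr_const -[_ *+ #|_|]mulr_natl mulrA.
apply: ler_sum => u _; under eq_avg do rewrite natr_sum.
rewrite avg_sum; apply: (@le_trans _ _ (\sum_(v in H) c^-1)); last by rewrite sumr_const mulr_natl.
rewrite big_mkcondr; apply: ler_sum => v _; case: ifP => // vu.
rewrite (avg_merge C_gt0 [set v]) -[leRHS](avg_cst C_gt0 (V := V)); apply: le_avg => b.
rewrite -(avg_color C_gt0 (b v) u); apply: le_avg => x.
rewrite !ffunE !inE eqxx; rewrite eq_sym in vu.
by rewrite (negPf vu).
Qed.

Lemma clashes0 a : clashes a = 0%N -> {in H &, injective a}.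
Proof.
move=> /eqP; rewrite sum_nat_eq0 => /forall_inP h u v uH vH auv.
apply/eqP; apply: contraT => uv.
have := h u uH; rewrite sum_nat_eq0 => /forall_inP /(_ v).
by rewrite vH eq_sym uv auv eqxx => /(_ isT).
Qed.

Lemma norm_pgf_approx : `|pgf_approx| <= 1.
Proof.
rewrite /pgf_approx normrM mulr_ile1//.
  rewrite -big_filter; apply: norm_prod_le1 => v; apply: pmean_norm_le.
    by rewrite mulr_ge0.
  by move=> n; exact: (pgf_factor_le1 (inl v)).
apply: norm_prod_le1 => k; apply: pmean_norm_le.
  by rewrite divr_ge0// exprn_ge0// ltW.
by move=> n; rewrite ger0_norm; case/andP: (pow_z01 (k * n)).
Qed.

Definition link_bound (B E : R) : R :=
  c^-1 * (#|H|%:R ^+ 2 * B + (4 * #|H|%:R * r.+1%:R + 1) * star_mean (C := C) e r) +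
  2 * star_mean (C := C) e r * overlap_bound r.+1 E.

Lemma avg_surrogate (B E L : R) a : {in H &, injective a} -> 0 <= E ->
  (forall v, #|nbr e v|%:R <= B * c) -> (forall v, #|nbr e' v|%:R <= E * c) ->
  0 <= L -> B <= L -> star_mean (C := C) e r <= L ->
  `|avg (fun x => z ^+ surrogate a x) - pgf_approx| <= 4 * expR L * link_bound B E.
Proof.
move=> a_inj E0 dB dE L0 BL mL.
rewrite -(prod_pmean_factor a) -(eq_avg (prod_pgf_factor a)).
apply: (le_trans (dissociated_poisson C_gt0 (@depends_happens _ _ e H r a) pgf_factor_le1 (L := L) _)).
  case=> [v|k]; rewrite ?rate_color ?rate_body; case: ifP => // h.
    by rewrite ler_pdivrMr// (le_trans (dB v))// ler_wpM2r// ltW.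
  apply: le_trans mL; rewrite /star_mean; apply: ler_wpM2r; first by rewrite invr_ge0 exprn_ge0// ltW.
  rewrite ler_nat (leq_trans _ (card_star_body_le H eirr r_gt0))//.
  apply/subset_leq_card/fintype.subsetP => W; rewrite !inE /star_body => /andP[-> /eqP ->].
  by rewrite h.
rewrite ler_wpM2l ?mulr_ge0 ?expR_ge0//.
exact: sum_link_error_le.
Qed.

(** The 3 is 2 + 1: a clash in [a] costs the trivial bound 2, a bad colour costs 1. The second
    summand pays for the monochromatic stars with a leaf in [H]. *)
Lemma pgf_bound (B E L : R) : 0 <= B -> 0 <= E ->
  (forall v, #|nbr e v|%:R <= B * c) -> (forall v, #|nbr e' v|%:R <= E * c) ->
  B <= L -> star_mean (C := C) e r <= L ->
  `|avg (fun x : {ffun V -> C} => z ^+ mono_count e r x) - pgf_approx| <=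
  3 * #|H|%:R ^+ 2 * c^-1 + #|touching e H r|%:R / c ^+ r +
  4 * expR L * link_bound B E.
Proof.
move=> B0 E0 dB dE BL mL; have L0 : 0 <= L by exact: le_trans BL.
set K := 4 * expR L * link_bound B E.
have mu0 : 0 <= star_mean (C := C) e r :> R by exact: star_mean_ge0.
have K0 : 0 <= K.
  rewrite mulr_ge0 ?mulr_ge0 ?expR_ge0// addr_ge0 ?mulr_ge0//.
  - by rewrite addr_ge0 ?mulr_ge0 ?exprn_ge0 ?addr_ge0 ?mulr_ge0.
  - by rewrite addr_ge0 ?mulr_ge0 ?expR_ge0// subr_ge0 -expR0 ler_expR.
rewrite (avg_merge C_gt0 H) -[pgf_approx](avg_cst C_gt0 (V := V)) -avgB.
apply: le_trans (ler_norm_avg _) _.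
apply: (@le_trans _ _ (avg (fun a => 2 * (clashes a)%:R + avg (fun x => (bad_colors a x)%:R) +
    avg (fun x => (bad_stars a x)%:R) + K))); last first.
  rewrite !avgD avgZ avg_bad_colors avg_bad_stars avg_cst// lerD2r lerD2r.
  have -> : 3 * #|H|%:R ^+ 2 * c^-1 = 2 * (#|H|%:R ^+ 2 * c^-1) + #|H|%:R ^+ 2 * c^-1 by ring.
  by rewrite lerD2r ler_wpM2l// avg_clashes.
apply: le_avg => a.
have bc0 : 0 <= avg (fun x => (bad_colors a x)%:R) :> R by apply: avg_ge0 => x.
have bs0 : 0 <= avg (fun x => (bad_stars a x)%:R) :> R by apply: avg_ge0 => x.
have zn n : `|z ^+ n| <= 1 by rewrite ger0_norm; case/andP: (pow_z01 n).
have [cl0|cl0] := posnP (clashes a); last first.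
  rewrite -!addrA -[leLHS]addr0 lerD//; last by rewrite !addr_ge0.
  apply: (@le_trans _ _ (2 * 1)); last by rewrite ler_wpM2l// ler1n.
  rewrite mulr1 (le_trans (ler_normB _ _))// (natrD _ 1 1) lerD ?norm_pgf_approx//.
  rewrite (le_trans (ler_norm_avg _))// -[leRHS](avg_cst C_gt0 (V := V)).
  by apply: le_avg => x.
rewrite cl0 mulr0 add0r; have a_inj := clashes0 cl0.
rewrite -(subrKA (avg (fun x => z ^+ surrogate a x))) (le_trans (ler_normD _ _))// lerD//; last first.
  exact: avg_surrogate.
rewrite -avgB -avgD (le_trans (ler_norm_avg _))//; apply: le_avg => x.
have [b1|b1] := posnP (bad_colors a x); last first.
  apply: (@le_trans _ _ 1); last by rewrite -natrD ler1n ltn_addr.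
  exact: norm_pow_sub.
have [b2|b2] := posnP (bad_stars a x); last first.
  apply: (@le_trans _ _ 1); last by rewrite -natrD ler1n ltn_addl.
  exact: norm_pow_sub.
by rewrite mono_count_surrogate// subrr normr0 addr_ge0.
Qed.

End star_pgf.

(** * Vertices ranked by degree *)

Section degree_ranking.
Context {V : finType}.
Variable e : rel V.

Definition ranked_degree (i : nat) : nat :=
  nth 0%N (sort geq [seq #|nbr e u| | u <- enum V]) i.

Definition ranking : seq V :=
  sort (fun u v => #|nbr e v| <= #|nbr e u|)%N (enum V).

Definition top_vertices (K : nat) : {set V} := [set v in take K ranking].

Lemma map_ranking : [seq #|nbr e u| | u <- ranking] = sort geq [seq #|nbr e u| | u <- enum V].
Proof. by rewrite /ranking sort_map. Qed.

Lemma geq_total : total geq.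
Proof. by move=> m n; exact: leq_total. Qed.

Lemma geq_trans : transitive geq.
Proof. by move=> m n p /= mn np; exact: leq_trans mn. Qed.

Lemma ranked_degree_homo i j : (i <= j)%N -> (ranked_degree j <= ranked_degree i)%N.
Proof.
move=> ij; rewrite /ranked_degree; set s := sort _ _.
have [sj|js] := leqP (size s) j; first by rewrite nth_default.
have ss : sorted geq s by exact: sort_sorted geq_total _.
by apply: (sorted_leq_nth geq_trans (fun n => leqnn n) 0%N ss) => //; rewrite inE// (leq_ltn_trans ij).
Qed.

Lemma mem_ranking v : v \in ranking.
Proof. by rewrite mem_sort mem_enum. Qed.

Lemma uniq_ranking : uniq ranking.
Proof. by rewrite sort_uniq enum_uniq. Qed.

Lemma ranked_degreeE v i : (i < size ranking)%N ->
  ranked_degree i = #|nbr e (nth v ranking i)|.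
Proof. by move=> ir; rewrite /ranked_degree -map_ranking (nth_map v). Qed.

Lemma card_top_vertices K : (#|top_vertices K| <= K)%N.
Proof.
rewrite cardsE (leq_trans (card_size _))// size_take.
by case: ltnP.
Qed.

Lemma degree_out_top K v : v \notin top_vertices K -> (#|nbr e v| <= ranked_degree K)%N.
Proof.
rewrite inE => vK; have vr := mem_ranking v; rewrite -index_mem in vr.
have iK : (K <= index v ranking)%N.
  rewrite leqNgt; apply: contra vK => iK.
  rewrite -{1}(nth_index v (mem_ranking v)) -(nth_take _ iK); apply: mem_nth.
  by rewrite size_take; case: ifP.
rewrite -{1}(nth_index v (mem_ranking v)) -ranked_degreeE//.
exact: ranked_degree_homo.
Qed.

Lemma degree_le_ranked0 v : (#|nbr e v| <= ranked_degree 0)%N.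
Proof. by apply: degree_out_top; rewrite inE take0. Qed.

(** When the graph has fewer than [K] vertices, the extra indices have ranked degree 0 and
    contribute the neutral element [f 0]. *)
Lemma big_top_vertices (T : Type) (idx : T) (op : Monoid.com_law idx) (f : nat -> T) K :
  f 0%N = idx ->
  \big[op/idx]_(v in top_vertices K) f #|nbr e v| =
  \big[op/idx]_(0 <= i < K) f (ranked_degree i).
Proof.
move=> f0.
transitivity (\big[op/idx]_(v <- take K ranking) f #|nbr e v|).
  rewrite [RHS]big_uniq ?take_uniq ?uniq_ranking//=.
  by apply: eq_bigl => v; rewrite inE.
rewrite -(big_map (fun v => #|nbr e v|) xpredT f) map_take map_ranking.
rewrite (big_nth 0%N) size_take -/ranked_degree.
set s := sort _ _; have nE i : (i < K)%N -> nth 0%N (take K s) i = ranked_degree i.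
  by move=> iK; rewrite nth_take.
case: ltnP => sK; first by apply: eq_big_nat => i /andP[_ iK]; rewrite nE.
rewrite [RHS](big_cat_nat (n := size s))//= [X in op _ X]big_nat_cond [X in op _ X]big1.
  by rewrite Monoid.mulm1; apply: eq_big_nat => i /andP[_ iK]; rewrite nE// (leq_trans iK).
by move=> i /andP[/andP[si _] _]; rewrite /ranked_degree nth_default.
Qed.

Lemma card_stars_star_sets r : irreflexive e ->
  #|stars e r| = (\sum_(1 <= k < r.+2) k * #|star_sets e r k|)%N.
Proof.
move=> eirr; rewrite (card_stars_sets eirr).
rewrite (partition_big (fun W => inord #|dominating e W| : 'I_r.+2) xpredT)//=.
rewrite big_ord_recl big1 ?add0n; last first.
  move=> W /andP[/eqP cW /eqP]/(congr1 (@nat_of_ord _)); rewrite inordK//.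
  by rewrite ltnS -cW; apply/subset_leq_card/fintype.subsetP => v; rewrite inE => /andP[].
rewrite big_add1 big_mkord; apply: eq_bigr => k _; rewrite mulnC -sum_nat_const.
apply: eq_big => W; last first.
  move=> /andP[/eqP cW /eqP]/(congr1 (@nat_of_ord _)); rewrite inordK.
    by rewrite /= /bump leq0n add1n.
  by rewrite ltnS -cW; apply/subset_leq_card/fintype.subsetP => v; rewrite inE => /andP[].
rewrite inE; case: eqP => //= cW; rewrite -val_eqE /= inordK ?/bump ?leq0n ?add1n//.
by rewrite ltnS -cW; apply/subset_leq_card/fintype.subsetP => v; rewrite inE => /andP[].
Qed.

End degree_ranking.

(** * Few stars have a leaf of high degree *)

Section touching_stars.
Context {R : realType} {V C : finType}.
Variables (e : rel V) (H : {set V}) (r : nat).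
Hypothesis esym : symmetric e.
Hypothesis r_gt1 : (1 < r)%N.
Hypothesis C_gt0 : (0 < #|C|)%N.
Let c : R := #|C|%:R.

Let c_gt0 : 0 < c. Proof. by rewrite ltr0n. Qed.

(** For [d <= D] use the power bound; for [d > D] use that ['C(d.-1, r.-1)] is [r / d] times
    ['C(d, r)]. *)
Lemma bin_pred_le (D : R) (d : nat) : 0 < D ->
  ('C(d.-1, r.-1)%:R : R) <= D ^+ r.-1 + r%:R / D * 'C(d, r)%:R.
Proof.
move=> D0; have [dD|Dd] := leP d%:R D.
  rewrite -[leLHS]addr0; apply: lerD; last first.
    by apply: mulr_ge0 => //; rewrite divr_ge0// ltW.
  apply: (@le_trans _ _ (d%:R ^+ r.-1)); last by apply: lerXn2r; rewrite ?nnegrE// ltW.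
  rewrite -natrX ler_nat.
  have h : ('C(d.-1, r.-1) <= d.-1 ^ r.-1)%N.
    apply: (@leq_trans (d.-1 ^_ r.-1)); first by rewrite -bin_ffact leq_pmulr// fact_gt0.
    rewrite ffact_prod -[X in (_ <= _ ^ X)%N]card_ord -prod_nat_const.
    by apply: leq_prod => i _; exact: leq_subr.
  by rewrite (leq_trans h)// leq_exp2r ?leq_pred// -subn1 subn_gt0.
rewrite -[leLHS]add0r; apply: lerD; first by rewrite exprn_ge0// ltW.
have d0 : (0 < d)%N by rewrite -(ltr_nat R) (lt_trans D0).
have := mul_bin_diag d r.-1; rewrite !prednK ?(ltnW r_gt1)// => E.
rewrite mulrAC ler_pdivlMr// -natrM -E mulnC natrM ler_wpM2l// ltW//.
Qed.

(** Centres are split at degree [D * c]. Those below give [B * D], small with [D] because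
    [r.-1 >= 1]; those above are charged to the total number of stars and gain a factor [c^-1]. *)
Lemma card_touching_bound (B D : R) : 0 < D -> D <= 1 ->
  (forall v, #|nbr e v|%:R <= B * c) ->
  #|touching e H r|%:R / c ^+ r <=
  #|H|%:R * (B * D + r%:R * star_mean (C := C) e r / D * c^-1).
Proof.
move=> D0 D1 dB; have cr0 : 0 < c ^+ r by rewrite exprn_gt0.
rewrite ler_pdivrMr//.
have := card_touching_le H r esym; rewrite -(ler_nat R) => /le_trans; apply.
rewrite natr_sum -[leRHS]mulrA [leRHS]mulr_natl -sumr_const; apply: ler_sum => h _.
rewrite natr_sum; have Dc0 : 0 < D * c by rewrite mulr_gt0.
apply: (@le_trans _ _ (\sum_(v in nbr e h) (D * c) ^+ r.-1 + r%:R / (D * c) * \sum_v 'C(#|nbr e v|, r)%:R)).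
  rewrite mulr_sumr [X in _ + X](bigID (mem (nbr e h))) /= addrA -big_split /=.
  rewrite -[leLHS]addr0; apply: lerD.
    by apply: ler_sum => v _; exact: bin_pred_le.
  by apply: sumr_ge0 => v _; apply: mulr_ge0 => //; rewrite divr_ge0// ltW.
rewrite -natr_sum -card_stars sumr_const -[_ *+ #|_|]mulr_natl.
have E : c ^+ r = c ^+ r.-1 * c by rewrite -exprSr prednK// ltnW.
apply: (@le_trans _ _ (B * c * (D * c ^+ r.-1) + r%:R / (D * c) * #|stars e r|%:R)).
  rewrite lerD2r; apply: ler_pM => //; first by rewrite exprn_ge0// ltW.
  rewrite exprMn ler_wpM2r ?exprn_ge0 ?(ltW c_gt0)//.
  rewrite -[leRHS]expr1; apply: ler_wiXn2l; rewrite ?(ltW D0)// -subn1 subn_gt0//.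
rewrite le_eqVlt; apply/orP; left; apply/eqP; rewrite /star_mean -/c E.
by field; rewrite !gt_eqF// exprn_gt0.
Qed.

End touching_stars.

(** * Limits of generating functions and moments *)

(* Limits are taken along an arbitrary proper filter: the converse uses an ultrafilter
   where one would otherwise extract a subsequence. *)
Section star_limits.
Local Open Scope classical_set_scope.
Context {R : realType} {F : set_system nat} {FF : ProperFilter F}.
Variables (V C : nat -> finType) (e : forall n, rel (V n)) (r : nat).
Variables (theta lambda : nat -> R).
Arguments e : clear implicits.
Hypothesis esym : forall n, symmetric (e n).
Hypothesis eirr : forall n, irreflexive (e n).
Hypothesis r_gt1 : (1 < r)%N.
Hypothesis C_gt0 : forall n, (0 < #|C n|)%N.
Let c n : R := #|C n|%:R.
Hypothesis c_inv : (c n)^-1 @[n --> F] --> (0 : R).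
Hypothesis sets_cvg : forall k, (1 <= k <= r.+1)%N ->
  #|star_sets (e n) r k|%:R / c n ^+ r @[n --> F] --> lambda k.
Hypothesis degrees_cvg : forall v,
  (ranked_degree (e n) v)%:R / c n @[n --> F] --> theta v.

Let c_gt0 n : 0 < c n. Proof. by rewrite ltr0n. Qed.
Let c_ge0 n : 0 <= c n. Proof. exact: ltW. Qed.
Let ci_ge0 n : 0 <= (c n)^-1. Proof. by rewrite invr_ge0. Qed.
Let r_gt0 : (0 < r)%N. Proof. exact: ltnW. Qed.

Lemma cvg_ge_all (u v : nat -> R) (l l' : R) : u n @[n --> F] --> l -> v n @[n --> F] --> l' ->
  (forall n, u n <= v n) -> l <= l'.
Proof. by move=> ul vl uv; apply: (ler_cvg_to ul vl); apply: nearW. Qed.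

Lemma cvg_prod (I : Type) (s : seq I) (P : pred I) (f : I -> nat -> R) (l : I -> R) :
  (forall i, P i -> f i n @[n --> F] --> l i) ->
  \prod_(i <- s | P i) f i n @[n --> F] --> \prod_(i <- s | P i) l i.
Proof. by move=> fl; apply: cvg_big => //; exact: mul_continuous. Qed.

Lemma cvg_prod_nat a b (f : nat -> nat -> R) (l : nat -> R) :
  (forall i, (a <= i < b)%N -> f i n @[n --> F] --> l i) ->
  \prod_(a <= i < b) f i n @[n --> F] --> \prod_(a <= i < b) l i.
Proof.
move=> fl; rewrite [X in _ --> X]big_nat_cond.
rewrite (_ : (fun n => _) = (fun n => \prod_(a <= i < b | (a <= i < b)%N && true) f i n)).
  by apply: cvg_prod => i /andP[/fl].
by apply/funext => n; rewrite big_nat_cond.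
Qed.

Lemma cvg_sum_nat a b (f : nat -> nat -> R) (l : nat -> R) :
  (forall i, (a <= i < b)%N -> f i n @[n --> F] --> l i) ->
  \sum_(a <= i < b) f i n @[n --> F] --> \sum_(a <= i < b) l i.
Proof.
move=> fl; rewrite [X in _ --> X]big_nat_cond.
rewrite (_ : (fun n => _) = (fun n => \sum_(a <= i < b | (a <= i < b)%N && true) f i n)).
  by apply: cvg_big => [|i /andP[/fl]] //; exact: add_continuous.
by apply/funext => n; rewrite big_nat_cond.
Qed.

Lemma cvg_squeeze0 (u v : nat -> R) : (forall n, 0 <= u n <= v n) ->
  v n @[n --> F] --> (0 : R) -> u n @[n --> F] --> (0 : R).
Proof.
move=> uv v0; apply: (squeeze_cvgr _ (cvg_cst 0) v0).
exact: nearW.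
Qed.

Lemma theta_ge0 v : 0 <= theta v.
Proof.
apply: (cvg_ge_all (cvg_cst (0 : R)) (degrees_cvg (v := v))) => n.
exact: divr_ge0.
Qed.

Lemma theta_nonincr u v : (u <= v)%N -> theta v <= theta u.
Proof.
move=> uv; apply: (cvg_ge_all (degrees_cvg (v := v)) (degrees_cvg (v := u))) => n.
by rewrite ler_wpM2r// ler_nat ranked_degree_homo.
Qed.

Lemma lambda_ge0 k : (1 <= k <= r.+1)%N -> 0 <= lambda k.
Proof.
move=> kr; apply: (cvg_ge_all (cvg_cst (0 : R)) (sets_cvg kr)) => n.
by rewrite divr_ge0// exprn_ge0.
Qed.

(** The binomial is a product of [r] factors [d - i] over the factorial of [r], and each
    [(d - i) / c] has the same limit as [d / c]. *)
Lemma bin_degree_cvg v : 'C(ranked_degree (e n) v, r)%:R / c n ^+ r @[n --> F] -->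
  theta v ^+ r / r`!%:R.
Proof.
have E n : 'C(ranked_degree (e n) v, r)%:R / c n ^+ r =
    (\prod_(i < r) ((ranked_degree (e n) v - i)%N%:R / c n)) / r`!%:R :> R.
  rewrite prodf_div prodr_const card_ord -natr_prod -ffact_prod -bin_ffact natrM.
  by rewrite mulrAC mulfK// pnatr_eq0 -lt0n fact_gt0.
under eq_fun do rewrite E.
apply: cvgM; last exact: cvg_cst.
have -> : theta v ^+ r = \prod_(i < r) theta v by rewrite prodr_const card_ord.
apply: cvg_prod => i _.
pose d n := ranked_degree (e n) v.
have -> : (fun n => (d n - i)%N%:R / c n) =
    (fun n => (d n)%:R / c n - ((d n)%:R / c n - (d n - i)%N%:R / c n)).
  by apply/funext => n; rewrite opprB addrC subrK.
rewrite -[X in _ --> X]subr0; apply: cvgB; first exact: degrees_cvg.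
apply: (cvg_squeeze0 (v := fun n => i%:R * (c n)^-1)).
  move=> n; rewrite -mulrBl -natrB ?leq_subr//; apply/andP; split; first exact: divr_ge0.
  by rewrite ler_wpM2r// ler_nat leq_subCl.
by rewrite -[X in _ --> X](mulr0 i%:R); apply: cvgM => //; exact: cvg_cst.
Qed.

Definition mean_limit : R := \sum_(1 <= k < r.+2) k%:R * lambda k.

Lemma star_mean_cvg : star_mean (C := C n) (e n) r @[n --> F] --> mean_limit.
Proof.
have E n : star_mean (C := C n) (e n) r =
    \sum_(1 <= k < r.+2) k%:R * (#|star_sets (e n) r k|%:R / c n ^+ r) :> R.
  rewrite /star_mean -/(c n) (card_stars_star_sets _ (@eirr n)) natr_sum mulr_suml.
  by apply: eq_bigr => k _; rewrite natrM mulrA.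
under eq_fun do rewrite E.
apply: cvg_sum_nat => k kr; apply: cvgM; first exact: cvg_cst.
exact: sets_cvg.
Qed.

Lemma mean_limit_ge0 : 0 <= mean_limit.
Proof.
apply: (cvg_ge_all (cvg_cst (0 : R)) star_mean_cvg) => n.
by rewrite /star_mean divr_ge0// exprn_ge0.
Qed.

Lemma near_degree_le : \forall n \near F,
  forall v, #|nbr (e n) v|%:R <= (theta 0%N + 1) * c n.
Proof.
have : \forall n \near F, (ranked_degree (e n) 0)%:R / c n <= theta 0%N + 1.
  by apply: (cvgr_le _ (degrees_cvg (v := 0%N))); rewrite ltrDl.
apply: filterS => n; rewrite ler_pdivrMr// => h v; apply: le_trans h.
by rewrite ler_nat degree_le_ranked0.
Qed.

Lemma near_mean_le : \forall n \near F, star_mean (C := C n) (e n) r <= mean_limit + 1.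
Proof. by apply: (cvgr_le _ star_mean_cvg); rewrite ltrDl. Qed.

Section top.
Variable K : nat.
Let H n := top_vertices (e n) K.

Let cardH n : (#|H n|%:R : R) <= K%:R. Proof. by rewrite ler_nat card_top_vertices. Qed.

Lemma touching_cvg : #|touching (e n) (H n) r|%:R / c n ^+ r @[n --> F] --> (0 : R).
Proof.
set B := theta 0%N + 1; set M := mean_limit + 1.
have B0 : 0 <= B by rewrite addr_ge0// theta_ge0.
have M0 : 0 <= M by rewrite addr_ge0// mean_limit_ge0.
apply/cvgr0Pnorm_le => eps eps0.
(* This threshold makes the first term of [card_touching_bound] at most [eps / 2]; the [+ 1] keeps
   the denominator positive when [K = 0]. *)
pose D := Num.min 1 (eps / 2 / (K%:R * B + 1)).
have KB : 0 < K%:R * B + 1 by rewrite ltr_wpDl// mulr_ge0.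
have D0 : 0 < D by rewrite /D lt_min ltr01 !divr_gt0.
have D1 : D <= 1 by rewrite /D ge_min lexx.
have DK : K%:R * (B * D) <= eps / 2.
  apply: (@le_trans _ _ ((K%:R * B + 1) * D)).
    by rewrite mulrA ler_wpM2r ?(ltW D0)// lerDl.
  rewrite mulrC -ler_pdivlMr// /D ge_min lexx orbT//.
have cc : K%:R * (r%:R * M / D) * (c n)^-1 @[n --> F] --> (0 : R).
  by rewrite -[X in _ --> X](mulr0 (K%:R * (r%:R * M / D))); apply: cvgM => //; exact: cvg_cst.
near=> n.
have h1 : forall v, #|nbr (e n) v|%:R <= B * c n by near: n; exact: near_degree_le.
have h2 : star_mean (C := C n) (e n) r <= M by near: n; exact: near_mean_le.
have h3 : K%:R * (r%:R * M / D) * (c n)^-1 <= eps / 2.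
  by near: n; apply: (cvgr_le _ cc); rewrite divr_gt0.
rewrite ger0_norm ?divr_ge0 ?exprn_ge0//.
apply: le_trans (card_touching_bound (H n) (@esym n) r_gt1 (C_gt0 n) D0 D1 h1) _.
have s0 : 0 <= star_mean (C := C n) (e n) r :> R by rewrite /star_mean divr_ge0// exprn_ge0.
apply: (@le_trans _ _ (K%:R * (B * D + r%:R * M / D * (c n)^-1))).
  apply: ler_pM => //.
    by rewrite addr_ge0 ?mulr_ge0 ?invr_ge0 ?(ltW D0).
  by rewrite lerD2l ler_wpM2r// ler_wpM2r ?invr_ge0 ?(ltW D0)// ler_wpM2l.
by rewrite mulrDr [eps]splitr lerD// mulrA.
Unshelve. all: by end_near.
Qed.

Lemma centered_cvg :
  #|[set p in stars (e n) r | p.1 \in H n]%SET|%:R / c n ^+ r @[n --> F] -->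
  \sum_(0 <= i < K) theta i ^+ r / r`!%:R.
Proof.
have E n : #|[set p in stars (e n) r | p.1 \in H n]%SET|%:R / c n ^+ r =
   \sum_(0 <= i < K) 'C(ranked_degree (e n) i, r)%:R / c n ^+ r :> R.
  rewrite card_stars_centered natr_sum mulr_suml.
  rewrite -/(c n) (@big_top_vertices _ _ _ _ _ (fun d => 'C(d, r)%:R / c n ^+ r))//.
  by rewrite bin_small// mul0r.
under eq_fun do rewrite E.
by apply: cvg_sum_nat => i _; exact: bin_degree_cvg.
Qed.

(* Up to o(c^r), the stars centred at the [K] vertices of highest degree span sets with
   a single dominating vertex: this is where the sum over theta leaves the rate of [Z_1]. *)
Definition pruned_rate (k : nat) : R :=
  if k == 1%N then lambda 1%N - \sum_(0 <= i < K) theta i ^+ r / r`!%:R else lambda k.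

Lemma card_pruned n k : (0 < k)%N ->
  #|star_sets (e n) r k|%:R - #|star_sets (prune (e n) (H n)) r k|%:R =
  #|[set W in star_sets (e n) r k | ~~ [disjoint W & H n]]%SET|%:R :> R.
Proof.
move=> k0; rewrite (star_sets_prune (H n) (@eirr n) r_gt0 k0); apply/eqP.
rewrite subr_eq -natrD eqr_nat addnC; apply/eqP.
rewrite -[in LHS](cardsID [set W : {set V n} | [disjoint W & H n]]%SET).
by congr (_ + _)%N; apply: eq_card => W; rewrite !finset.in_set// andbC.
Qed.

(** For [k >= 2] the sets meeting [H] are outnumbered by the touching stars. For [k = 1] their
    number is squeezed between that of the stars centred in [H] minus [r.+1] times, and plus, that
    of the touching stars. *)
Lemma pruned_sets_cvg k : (1 <= k <= r.+1)%N ->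
  #|star_sets (prune (e n) (H n)) r k|%:R / c n ^+ r @[n --> F] --> pruned_rate k.
Proof.
move=> kr; have k0 : (0 < k)%N by case/andP: kr.
pose g n : R := #|[set W in star_sets (e n) r k | ~~ [disjoint W & H n]]%SET|%:R / c n ^+ r.
have -> : (fun n => #|star_sets (prune (e n) (H n)) r k|%:R / c n ^+ r) =
    (fun n => #|star_sets (e n) r k|%:R / c n ^+ r - g n).
  apply/funext => n; rewrite /g -card_pruned// -mulrBl; congr (_ / _).
  by rewrite opprB addrC subrK.
have cr n : 0 <= (c n ^+ r)^-1 by rewrite invr_ge0 exprn_ge0.
rewrite /pruned_rate; case: eqP => [k1|/eqP k1]; last first.
  rewrite -[X in _ --> X]subr0; apply: cvgB; first exact: sets_cvg.
  apply: (cvg_squeeze0 _ touching_cvg) => n; rewrite /g divr_ge0 ?exprn_ge0//=.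
  rewrite ler_wpM2r// ler_nat; apply: card_star_sets_meet => //.
  by rewrite ltn_neqAle eq_sym k1.
subst k; apply: cvgB; first exact: sets_cvg.
pose t n : R := #|touching (e n) (H n) r|%:R / c n ^+ r.
pose s n : R := #|[set p in stars (e n) r | p.1 \in H n]%SET|%:R / c n ^+ r.
apply: (@squeeze_cvgr _ _ _ _ (fun n => s n - r.+1%:R * t n) (fun n => s n + t n)).
- apply: nearW => n; rewrite /s /t /g lerBlDr mulrA -!mulrDl; apply/andP; split.
    rewrite ler_wpM2r// -natrM -natrD ler_nat.
    exact: card_stars_centered_le.
  by rewrite ler_wpM2r// -natrD ler_nat; exact: card_star_sets1_meet_le.
- have h : s n - r.+1%:R * t n @[n --> F] -->
      \sum_(0 <= i < K) theta i ^+ r / r`!%:R - r.+1%:R * 0.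
    apply: cvgB; first exact: centered_cvg.
    by apply: cvgM; [exact: cvg_cst|exact: touching_cvg].
  by rewrite mulr0 subr0 in h.
- by rewrite -[X in _ --> X]addr0; apply: cvgD; [exact: centered_cvg|exact: touching_cvg].
Qed.

Lemma pruned_rate_ge0 k : (1 <= k <= r.+1)%N -> 0 <= pruned_rate k.
Proof.
move=> kr; apply: (cvg_ge_all (cvg_cst (0 : R)) (pruned_sets_cvg kr)) => n.
by rewrite divr_ge0// exprn_ge0.
Qed.

Definition limit_pgf (z : R) : R :=
  (\prod_(0 <= i < K) pmean (theta i) (fun m => z ^+ 'C(m, r))) *
  \prod_(1 <= k < r.+2) pmean (pruned_rate k) (fun m => z ^+ (k * m)).

Lemma pgf_approx_cvg z : 0 <= z <= 1 ->
  pgf_approx (C := C n) (e n) (H n) r z @[n --> F] --> limit_pgf z.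
Proof.
move=> z01; have zn m : `|z ^+ m| <= 1.
  by have /andP[? ?] := pow_z01 z01 m; rewrite ger0_norm.
apply: cvgM.
  have E n : \prod_(v in H n) pmean (#|nbr (e n) v|%:R / c n) (fun m => z ^+ 'C(m, r)) =
      \prod_(0 <= i < K) pmean ((ranked_degree (e n) i)%:R / c n) (fun m => z ^+ 'C(m, r)).
    rewrite -/(c n) (@big_top_vertices _ _ _ _ _ (fun d => pmean (d%:R / c n) (fun m => z ^+ 'C(m, r))))//.
    by rewrite mul0r pmean0 bin_small// expr0.
  under eq_fun do rewrite E.
  apply: cvg_prod_nat => i _; apply: cvg_pmean.
  - by move=> m; exact: zn.
  - by move=> n; rewrite divr_ge0.
  - exact: theta_ge0.
  - exact: degrees_cvg.
apply: cvg_prod_nat => k kr.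
apply: cvg_pmean.
- by move=> m; exact: zn.
- by move=> n; rewrite divr_ge0// exprn_ge0.
- exact: pruned_rate_ge0.
- exact: pruned_sets_cvg.
Qed.

Lemma overlap_bound_cvg (u : nat -> R) (l : R) (G : set_system nat) {GF : ProperFilter G} :
  u n @[n --> G] --> l ->
  overlap_bound r.+1 (u n) @[n --> G] --> overlap_bound r.+1 l.
Proof.
move=> ul; have eul : expR (u n) @[n --> G] --> expR l.
  by apply: (cvg_comp u expR ul); exact: continuous_expR.
apply: cvgM; first exact: cvg_cst.
by apply: cvgD; [apply: cvgB => //; exact: cvg_cst|exact: cvgM].
Qed.

Lemma link_bound_cvg : link_bound (C := C n) (e n) (H n) r (theta 0%N + 1)
    ((ranked_degree (e n) K)%:R / c n) - 2 * mean_limit * overlap_bound r.+1 (theta K)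
  @[n --> F] --> (0 : R).
Proof.
set b := 2 * mean_limit * overlap_bound r.+1 (theta K).
rewrite -[X in _ --> X](subrr b); apply: cvgB; last exact: cvg_cst.
rewrite -[b]add0r; apply: cvgD; last first.
  apply: cvgM; last exact: overlap_bound_cvg.
  by apply: cvgM; [exact: cvg_cst|exact: star_mean_cvg].
set B := theta 0%N + 1; set M := mean_limit + 1.
have B0 : 0 <= B by rewrite addr_ge0// theta_ge0.
pose a : R := K%:R ^+ 2 * B + (4 * K%:R * r.+1%:R + 1) * M.
have a0 : (c n)^-1 * a @[n --> F] --> (0 : R).
  by rewrite -[X in _ --> X](mul0r a); apply: cvgM => //; exact: cvg_cst.
apply: (squeeze_cvgr _ (cvg_cst 0) a0).
near=> n; have h2 : star_mean (C := C n) (e n) r <= M by near: n; exact: near_mean_le.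
have s0 : 0 <= star_mean (C := C n) (e n) r :> R by rewrite /star_mean divr_ge0// exprn_ge0.
have k0 : 0 <= (4 * #|H n|%:R * r.+1%:R + 1 : R) by rewrite addr_ge0// mulr_ge0// mulr_ge0.
apply/andP; split.
  by rewrite mulr_ge0// addr_ge0 ?mulr_ge0 ?exprn_ge0.
rewrite ler_wpM2l// lerD//.
  by rewrite ler_wpM2r// lerXn2r// nnegrE.
by rewrite ler_pM// lerD2r ler_wpM2r// ler_wpM2l.
Unshelve. all: by end_near.
Qed.

(** The error that survives in [n] has the constant 8 = 4 * 2, from the 4 of [dissociated_poisson]
    and the 2 of [link_bound]; it vanishes once [theta K] tends to 0. *)
Lemma near_pgf_limit (z eps : R) : 0 <= z <= 1 -> 0 < eps ->
  let L := theta 0%N + mean_limit + 1 in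
  \forall n \near F,
  `|avg (fun x : {ffun V n -> C n} => z ^+ mono_count (e n) r x) - limit_pgf z| <=
  8 * expR L * mean_limit * overlap_bound r.+1 (theta K) + eps.
Proof.
move=> z01 eps0 L.
set B := theta 0%N + 1; set M := mean_limit + 1.
have B0 : 0 <= B by rewrite addr_ge0// theta_ge0.
have BL : B <= L by rewrite /L /B -addrA lerD2l lerDr mean_limit_ge0.
have ML : M <= L by rewrite /L /M -addrA lerDr theta_ge0.
pose err n := 3 * K%:R ^+ 2 * (c n)^-1 + #|touching (e n) (H n) r|%:R / c n ^+ r +
  4 * expR L * (link_bound (C := C n) (e n) (H n) r B ((ranked_degree (e n) K)%:R / c n) -
     2 * mean_limit * overlap_bound r.+1 (theta K)).
have err0 : err n @[n --> F] --> (0 : R).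
  have -> : 0 = 3 * K%:R ^+ 2 * 0 + 0 + 4 * expR L * 0 :> R by rewrite !mulr0 !addr0.
  apply: cvgD; first apply: cvgD.
  - by apply: cvgM => //; exact: cvg_cst.
  - exact: touching_cvg.
  - by apply: cvgM; [exact: cvg_cst|exact: link_bound_cvg].
near=> n.
have h1 : forall v, #|nbr (e n) v|%:R <= B * c n by near: n; exact: near_degree_le.
have h2 : star_mean (C := C n) (e n) r <= M by near: n; exact: near_mean_le.
have h3 : err n <= eps / 2 by near: n; apply: (cvgr_le _ err0); rewrite divr_gt0.
have h4 : `|limit_pgf z - pgf_approx (C := C n) (e n) (H n) r z| <= eps / 2.
  near: n; have /cvgrPdist_le := pgf_approx_cvg z01; apply.
  by rewrite divr_gt0.
rewrite -(subrKA (pgf_approx (C := C n) (e n) (H n) r z)) (le_trans (ler_normD _ _))//.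
rewrite [eps]splitr addrA; apply: lerD; last by rewrite distrC.
have E0 : 0 <= (ranked_degree (e n) K)%:R / c n by rewrite divr_ge0.
have dE v : #|nbr (prune (e n) (H n)) v|%:R <= (ranked_degree (e n) K)%:R / c n * c n.
  rewrite divfK ?gt_eqF// ler_nat.
  have [vH|vH] := boolP (v \in H n).
    rewrite (_ : nbr _ v = finset.set0) ?cards0//.
    by apply/setP => u; rewrite !inE /prune vH andbF.
  rewrite (leq_trans (subset_leq_card (nbr_prune_sub _ _ _)))//.
  exact: degree_out_top.
apply: le_trans (pgf_bound (@esym n) (@eirr n) r_gt0 (C_gt0 n) z01 B0 E0 h1 dE BL (le_trans h2 ML)) _.
apply: (@le_trans _ _ (err n + 8 * expR L * mean_limit * overlap_bound r.+1 (theta K))); last first.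
  by rewrite [err n + _]addrC lerD2l.
rewrite /err mulrBr -!addrA; apply: lerD.
  by rewrite ler_wpM2r// ler_wpM2l// lerXn2r// nnegrE.
rewrite le_eqVlt; apply/orP; left; apply/eqP; rewrite /c; ring.
Unshelve. all: by end_near.
Qed.

End top.

(** The difference is the pruned rate for [k = 1], a limit of nonnegative ratios. *)
Lemma sum_theta_le K : \sum_(0 <= i < K) theta i ^+ r / r`!%:R <= lambda 1%N.
Proof. by have := @pruned_rate_ge0 K 1%N isT; rewrite /pruned_rate eqxx subr_ge0. Qed.

(** As [theta] is nonincreasing, [theta K > eps] would make each of the first [K] terms of the
    bounded sum at least [eps ^+ r / r!]. *)
Lemma theta_cvg0 : theta K @[K --> \oo] --> (0 : R).
Proof.
apply/cvgr0Pnorm_le => eps eps0; near=> K.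
rewrite ger0_norm ?theta_ge0// leNgt; apply/negP => eK.
have : K%:R * (eps ^+ r / r`!%:R) <= lambda 1%N.
  apply: le_trans (sum_theta_le K).
  have -> : K%:R * (eps ^+ r / r`!%:R) = \sum_(0 <= i < K) eps ^+ r / r`!%:R.
    by rewrite sumr_const_nat subn0 mulr_natl.
  rewrite [leLHS]big_nat [leRHS]big_nat; apply: ler_sum => i /andP[_ iK].
  rewrite ler_wpM2r ?invr_ge0// lerXn2r ?nnegrE ?(ltW eps0) ?theta_ge0//.
  by rewrite (le_trans (ltW eK))// theta_nonincr// ltnW.
have p0 : 0 < eps ^+ r / r`!%:R by rewrite divr_gt0 ?exprn_gt0// ltr0n fact_gt0.
rewrite -ler_pdivlMr// leNgt; apply/negP; rewrite negbK.
near: K; exact: nbhs_infty_gtr.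
Unshelve. all: by end_near.
Qed.

Lemma star_pgf_cvg (z G : R) : 0 <= z <= 1 -> limit_pgf K z @[K --> \oo] --> G ->
  avg (fun x : {ffun V n -> C n} => z ^+ mono_count (e n) r x) @[n --> F] --> G.
Proof.
move=> z01 zG; set L := theta 0%N + mean_limit + 1.
apply/cvgrPdist_le => eps eps0.
have oc : 8 * expR L * mean_limit * overlap_bound r.+1 (theta K) @[K --> \oo] --> (0 : R).
  rewrite -[X in _ --> X](mulr0 (8 * expR L * mean_limit)); apply: cvgM; first exact: cvg_cst.
  have E : overlap_bound r.+1 (0 : R) = 0.
    by rewrite /overlap_bound expR0 subrr mul0r addr0 mulr0.
  have h := overlap_bound_cvg theta_cvg0; rewrite E in h; exact: h.
have e3 : 0 < eps / 3 by rewrite divr_gt0.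
have [K [hK1 hK2]] : exists K, 8 * expR L * mean_limit * overlap_bound r.+1 (theta K) <= eps / 3 /\
    `|G - limit_pgf K z| <= eps / 3.
  have : \forall K \near \oo, 8 * expR L * mean_limit * overlap_bound r.+1 (theta K) <= eps / 3 /\
    `|G - limit_pgf K z| <= eps / 3.
    near=> K; split; near: K; first exact: (cvgr_le _ oc).
    by move/cvgrPdist_le : zG; exact.
  by move=> /filter_ex.
have := near_pgf_limit K z01 e3; apply: filterS => n /= h.
rewrite distrC -(subrKA (limit_pgf K z)) (le_trans (ler_normD _ _))//.
rewrite [leRHS](_ : _ = (eps / 3 + eps / 3) + eps / 3); last by field.
apply: lerD; last by rewrite distrC.
by apply: le_trans h _; rewrite lerD2r.
Unshelve. all: by end_near.
Qed.

Lemma star_moments_bounded (m : nat) : exists M : R, \forall n \near F,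
  avg (fun x : {ffun V n -> C n} => (mono_count (e n) r x)%:R ^+ m) <= M.
Proof.
set B := theta 0%N + 1; set M := mean_limit + 1.
have B0 : 0 <= B by rewrite addr_ge0// theta_ge0.
exists (\prod_(i < m) (M + cond_bound (i * r.+1) B)).
near=> n.
have h1 : forall v, #|nbr (e n) v|%:R <= B * c n by near: n; exact: near_degree_le.
have h2 : star_mean (C := C n) (e n) r <= M by near: n; exact: near_mean_le.
apply: le_trans (avg_mono_count_moment (@esym n) (@eirr n) (C_gt0 n) B0 h1 r m) _.
have s0 : 0 <= star_mean (C := C n) (e n) r :> R by rewrite /star_mean divr_ge0// exprn_ge0.
apply: ler_prod => i _; rewrite lerD2r h2 andbT addr_ge0//.
exact: cond_bound_ge0.
Unshelve. all: by end_near.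
Qed.

End star_limits.

(** * From generating functions to point probabilities and means *)

Section generating_functions.
Local Open Scope classical_set_scope.
Context {R : realType}.

(* [g z = \sum_i q i * z ^+ i], expressed without series; [q] may lose mass at infinity. *)
Definition is_pgf (q : nat -> R) (g : R -> R) := forall j z, 0 < z < 1 ->
  0 <= g z - \sum_(0 <= i < j) q i * z ^+ i <= z ^+ j.

Lemma pgf_coef_cvg (T : Type) (F : set_system T) {FF : ProperFilter F}
    (q : T -> nat -> R) (g : T -> R -> R) (p : nat -> R) (G : R -> R) :
  (forall n, is_pgf (q n) (g n)) -> is_pgf p G ->
  (forall z, 0 < z < 1 -> g n z @[n --> F] --> G z) ->
  forall j, q n j @[n --> F] --> p j.
Proof.
move=> qg pG gG; elim/ltn_ind => j IH.
apply/cvgrPdist_le => eps eps0.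
(* After subtracting the first [j] terms and dividing by [z ^+ j], what remains of either series is
   its coefficient up to an error between 0 and [z]; [2^-1] keeps [z] below 1. *)
pose z := Num.min (eps / 2) 2^-1 : R.
have z01 : 0 < z < 1.
  rewrite lt_min divr_gt0//= invr_gt0 ltr0n/=.
  by apply: (@le_lt_trans _ _ 2^-1); rewrite ?invf_lt1 ?ltr1n// ge_min lexx orbT.
have zj0 : 0 < z ^+ j by rewrite exprn_gt0; case/andP: z01.
have zeps : z <= eps / 2 by rewrite ge_min lexx.
pose h n := (g n z - \sum_(0 <= i < j) q n i * z ^+ i) - (G z - \sum_(0 <= i < j) p i * z ^+ i).
have h0 : h n @[n --> F] --> 0.
  rewrite -[X in _ --> X](subrr (G z - \sum_(0 <= i < j) p i * z ^+ i)).
  apply: cvgB; last exact: cvg_cst.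
  apply: cvgB; first exact: gG.
  rewrite [X in _ --> X]big_nat_cond.
  rewrite (_ : (fun n => _) = (fun n => \sum_(0 <= i < j | (0 <= i < j)%N && true) q n i * z ^+ i)).
    apply: cvg_big => [|i /andP[/andP[_ ij] _]] //; first exact: add_continuous.
    by apply: cvgM; [exact: IH|exact: cvg_cst].
  by apply/funext => n; rewrite big_nat_cond.
near=> n.
have hn : `|h n| <= z ^+ j * (eps / 2).
  by near: n; move/cvgr0Pnorm_le : h0; apply; rewrite mulr_gt0// divr_gt0.
have := qg n j.+1 z z01; have := pG j.+1 z z01.
rewrite !big_nat_recr//= exprSr => /andP[a1 a2] /andP[b1 b2].
rewrite -(ler_pM2l zj0) -[X in X * `|_|]ger0_norm ?(ltW zj0)// -normrM mulrBr.
move: hn; rewrite /h !ler_norml => /andP[c1 c2].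
have zz : z ^+ j * z <= z ^+ j * (eps / 2) by rewrite ler_wpM2l// ltW.
rewrite [eps]splitr mulrDr.
move: a1 a2 b1 b2 c1 c2 zz; rewrite ![_ * z ^+ j]mulrC.
move: (z ^+ j * q n j) (z ^+ j * p j) (z ^+ j * z) (z ^+ j * (eps / 2)) (\sum_(_ <= _ < _) _) (\sum_(_ <= _ < _) _) (g n z) (G z) => x1 x2 x3 x4 x5 x6 x7 x8.
by move=> *; apply/andP; split; lra.
Unshelve. all: by end_near.
Qed.

Section finite_average.
Context {V C : finType}.
Hypothesis C_gt0 : (0 < #|C|)%N.
Variable T : {ffun V -> C} -> nat.

Definition avg_pmf (j : nat) : R := avg (fun x => (T x == j)%:R).

Lemma avg_below (f : nat -> R) (J : nat) :
  avg (fun x => (T x < J)%:R * f (T x)) = \sum_(0 <= j < J) avg_pmf j * f j.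
Proof.
under [RHS]eq_bigr do rewrite /avg_pmf -avgZr.
rewrite -avg_sum; apply: eq_avg => x; rewrite big_mkord.
have [TJ|JT] := ltnP (T x) J.
  rewrite (bigD1 (Ordinal TJ))//= eqxx big1 ?addr0// => i.
  by rewrite -val_eqE /= eq_sym => /negPf ->; rewrite mul0r.
rewrite mul0r big1// => i _; case: eqP => [E|_]; last by rewrite mul0r.
by have := ltn_ord i; rewrite -E ltnNge JT.
Qed.

Lemma avg_is_pgf : is_pgf avg_pmf (fun z => avg (fun x => z ^+ T x)).
Proof.
move=> j z /andP[z0 z1]; rewrite -(avg_below (fun i => z ^+ i)) -avgB.
have E x : z ^+ T x - (T x < j)%:R * z ^+ T x = (j <= T x)%:R * z ^+ T x.
  by case: ltnP => _; rewrite ?mul1r ?mul0r ?subrr ?subr0.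
under eq_avg do rewrite E.
apply/andP; split; first by apply: avg_ge0 => x; rewrite mulr_ge0// exprn_ge0// ltW.
rewrite -[leRHS](avg_cst C_gt0 (V := V)); apply: le_avg => x.
have [jT|_] := leqP j (T x); last by rewrite mul0r exprn_ge0// ltW.
by rewrite mul1r; apply: ler_wiXn2l => //; exact: ltW.
Qed.

End finite_average.

Section limit_of_averages.
Context {F : set_system nat} {FF : ProperFilter F}.
Variables (V C : nat -> finType) (T : forall n, {ffun V n -> C n} -> nat).
Hypothesis C_gt0 : forall n, (0 < #|C n|)%N.
Arguments T : clear implicits.
Variables (p : nat -> R) (g : nat -> R).
Hypothesis p_cvg : forall j, avg_pmf (T n) j @[n --> F] --> p j.
Hypothesis g_ge0 : forall j, 0 <= g j.
Hypothesis gT_bounded : exists M : R, \forall n \near F,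
  avg (fun x => g (T n x) * (T n x)%:R) <= M.

Lemma avg_below_cvg J : avg (fun x => (T n x < J)%:R * g (T n x)) @[n --> F] -->
  \sum_(0 <= j < J) p j * g j.
Proof.
rewrite (_ : (fun n => _) = fun n => \sum_(0 <= j < J) avg_pmf (T n) j * g j); last first.
  by apply/funext => n; rewrite avg_below.
apply: cvg_big => [|j _] //; first exact: add_continuous.
by apply: cvgM => //; exact: cvg_cst.
Qed.

Lemma p_ge0 j : 0 <= p j.
Proof.
apply: (ler_cvg_to (cvg_cst 0) (p_cvg (j := j))); apply: nearW => n.
by apply: avg_ge0 => x.
Qed.

Let tail_le n M J : (0 < J)%N -> avg (fun x => g (T n x) * (T n x)%:R) <= M ->
  avg (fun x => g (T n x)) - avg (fun x => (T n x < J)%:R * g (T n x)) <= M / J%:R.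
Proof.
move=> J0 h; rewrite -avgB ler_pdivlMr ?ltr0n// -avgZr; apply: le_trans h.
apply: le_avg => x; have [TJ|JT] := ltnP (T n x) J.
  by rewrite mul1r subrr mul0r mulr_ge0.
by rewrite mul0r subr0 ler_wpM2l// ler_nat.
Qed.

Let below_le n J : avg (fun x => (T n x < J)%:R * g (T n x)) <= avg (fun x => g (T n x)).
Proof. by apply: le_avg => x; case: ltnP => _; rewrite ?mul1r ?mul0r. Qed.

(** By [gT_bounded] the part of the mean of [g] above the level [J] is at most [M / J] uniformly in
    [n], so nothing escapes to infinity and the limit can be taken term by term. *)
Lemma avg_law_cvg :
  cvgn (series (fun j => p j * g j)) /\
  avg (fun x => g (T n x)) @[n --> F] --> rsum (fun j => p j * g j).
Proof.
have [M hM] := gT_bounded.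
have pg0 j : 0 <= p j * g j by rewrite mulr_ge0// p_ge0.
have S_mono : nondecreasing_seq (series (fun j => p j * g j)).
  by apply/nondecreasing_seqP => n; rewrite seriesSr lerDl.
have S_tail J J' : (0 < J)%N -> series (fun j => p j * g j) J' - series (fun j => p j * g j) J <= M / J%:R.
  move=> J0; rewrite /series /=.
  have h0 : avg (fun x => (T n x < J')%:R * g (T n x)) - avg (fun x => (T n x < J)%:R * g (T n x))
      @[n --> F] --> \sum_(0 <= j < J') p j * g j - \sum_(0 <= j < J) p j * g j.
    by apply: cvgB; exact: avg_below_cvg.
  apply: (ler_cvg_to h0 (cvg_cst (M / J%:R))).
  apply: filterS hM => n /= h; apply: le_trans (tail_le J0 h).
  by rewrite lerD2r.
have S_cvg : cvgn (series (fun j => p j * g j)).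
  apply: nondecreasing_is_cvgn => //.
  exists (M / 1%:R + series (fun j => p j * g j) 1%N) => _ [J' _ <-].
  by rewrite -lerBlDr; exact: S_tail.
split=> //; set S := rsum _.
have S_ge J : series (fun j => p j * g j) J <= S by apply: nondecreasing_cvgn_le.
have S_le J : (0 < J)%N -> S - series (fun j => p j * g j) J <= M / J%:R.
  move=> J0; rewrite lerBlDr; apply: limr_le => //; apply: nearW => J'.
  by rewrite -lerBlDr; exact: S_tail.
apply/cvgrPdist_le => eps eps0.
have [J J0 MJ] : exists2 J, (0 < J)%N & M / J%:R <= eps / 2.
  have : M * harmonic J @[J --> \oo] --> 0.
    by rewrite -[X in _ --> X](mulr0 M); apply: cvgM; [exact: cvg_cst|exact: cvg_harmonic].
  move=> /cvgr_le => /(_ (eps / 2)) H.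
  have /filter_ex[J hJ] : \forall J \near \oo, M * harmonic J <= eps / 2.
    by apply: H; rewrite divr_gt0.
  by exists J.+1.
near=> n.
have h1 : avg (fun x => g (T n x) * (T n x)%:R) <= M by near: n.
have h2 : `|series (fun j => p j * g j) J - avg (fun x => (T n x < J)%:R * g (T n x))| <= eps / 2.
  by near: n; have /cvgrPdist_le := @avg_below_cvg J; apply; rewrite divr_gt0.
have := tail_le J0 h1; have := below_le n J; have := S_ge J; have := S_le J J0.
have H (a b c d m E : R) : - (E / 2) <= c - b <= E / 2 -> m <= E / 2 -> d - c <= m ->
    c <= d -> b <= a -> a - b <= m -> - E <= d - a <= E.
  by move=> /andP[? ?] *; apply/andP; split; lra.
by move: h2 MJ; rewrite !ler_norml; exact: H.
Unshelve. all: by end_near.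
Qed.

End limit_of_averages.
End generating_functions.

(** * The limit law *)

Section independent_naturals.
Local Open Scope classical_set_scope.
Context {R : realType} {d : measure_display} {Om : measurableType d}.
Variable Q : probability Om R.

Implicit Types (X : Om -> nat) (f : nat -> R).

Lemma measurable_nat_preimage X (A : set nat) :
  measurable_fun [set: Om] X -> measurable (X @^-1` A).
Proof. by move=> mX; rewrite -[_ @^-1` _]setTI; apply: mX. Qed.

Lemma measurable_nat_comp X f :
  measurable_fun [set: Om] X -> measurable_fun [set: Om] (fun w => f (X w)).
Proof. by move=> mX; apply: (measurableT_comp (f := f)). Qed.

Lemma measurable_nat_of_real X :
  measurable_fun [set: Om] (fun w => (X w)%:R : R) -> measurable_fun [set: Om] X.
Proof.
move=> mX _ A _; rewrite setTI.
have -> : X @^-1` A = \bigcup_(j in A) (fun w => (X w)%:R : R) @^-1` [set j%:R].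
  apply/seteqP; split=> [w Aw|w [j Aj] /= /eqP]; first by exists (X w).
  by rewrite eqr_nat => /eqP ->.
apply: bigcup_measurable => j _; rewrite -[_ @^-1` _]setTI; apply: mX => //.
Qed.

Lemma integral_nat_partition X f (D : set Om) (Y : Om -> \bar R) :
  measurable_fun [set: Om] X -> measurable D -> measurable_fun [set: Om] Y ->
  (forall w, 0 <= Y w)%E -> (forall j, 0 <= f j) ->
  (\int[Q]_(w in D) ((f (X w))%:E * Y w) =
   \sum_(0 <= j <oo) ((f j)%:E * \int[Q]_(w in D `&` X @^-1` [set j]) Y w))%E.
Proof.
move=> mX mD mY Y0 f0.
have {1}-> : D = \bigcup_j (D `&` X @^-1` [set j]).
  by apply/seteqP; split=> [w Dw|w [j _ []]//]; exists (X w).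
rewrite ge0_integral_bigcup//=.
- apply: eq_eseriesr => j _; rewrite -ge0_integralZl_EFin//.
  + by apply: eq_integral => w; rewrite inE => -[_ /= ->].
  + by apply: measurableI => //; exact: measurable_nat_preimage.
  + exact: measurable_funTS.
- by move=> j; apply: measurableI => //; exact: measurable_nat_preimage.
- apply: measurable_funTS; apply: emeasurable_funM => //.
  by apply/measurable_EFinP; exact: measurable_nat_comp.
- by move=> w _; rewrite mule_ge0// lee_fin.
- by move=> i j _ _ [w [[_ /= <-] [_ /= <-]]].
Qed.

Definition nat_mean X f : \bar R :=
  (\sum_(0 <= j <oo) ((f j)%:E * Q (X @^-1` [set j])))%E.

Lemma integral_nat_mean X f : measurable_fun [set: Om] X -> (forall j, 0 <= f j) ->
  (\int[Q]_w (f (X w))%:E = nat_mean X f)%E.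
Proof.
move=> mX f0.
have h1 : (forall w : Om, 0 <= (cst 1%E w : \bar R))%E by move=> w; rewrite /cst lee_fin.
have H := integral_nat_partition mX measurableT (measurable_cst (1%E : \bar R)) h1 f0.
transitivity (\int[Q]_w ((f (X w))%:E * cst 1%E w))%E.
  by apply: eq_integral => w _; rewrite mule1.
rewrite H; apply: eq_eseriesr => j _; rewrite setTI integral_cst ?mul1e//.
exact: measurable_nat_preimage.
Qed.

Lemma indep_prod_mean (I : choiceType) (D : set I) (X : I -> {RV Q >-> nat})
    (f : I -> nat -> R) (J : seq I) :
  mutually_independent D X -> (forall i j, 0 <= f i j <= 1) -> uniq J -> [set` J] `<=` D ->
  (\int[Q]_w (\prod_(i <- J) f i (X i w))%:E = \prod_(i <- J) nat_mean (X i) (f i))%E.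
Proof.
move=> indep f01.
have f0 i j : 0 <= f i j by case/andP: (f01 i j).
have mX i : measurable_fun [set: Om] (X i) by exact: measurable_funPT.
pose ev (K : seq I) (A : I -> set nat) := \bigcap_(i in [set` K]) (X i @^-1` A i).
have mev K A : measurable (ev K A).
  by apply: fin_bigcap_measurable => // i _; exact: measurable_nat_preimage.
(* Integrating over an event that involves further coordinates lets the induction move one index at
   a time from the product into the event; independence of events is then all that is used. *)
suff H (K : seq I) (A : I -> set nat) : uniq (J ++ K) -> [set` J ++ K] `<=` D ->
  (\int[Q]_(w in ev K A) (\prod_(i <- J) f i (X i w))%:E =
   \prod_(i <- J) nat_mean (X i) (f i) * Q (ev K A))%E.
  move=> uJ JD; have := H [::] (fun=> setT).
  rewrite cats0 => /(_ uJ JD).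
  have -> : ev [::] (fun=> setT) = setT by apply/seteqP; split.
  by rewrite probability_setT mule1.
elim: J K A => [|i J IH] K A /=.
  move=> _ _; rewrite big_nil mul1e; under eq_integral do rewrite big_nil.
  by rewrite integral_cst// mul1e.
move=> /andP[iJK uJK] sub.
under eq_integral do rewrite big_cons EFinM.
rewrite integral_nat_partition//; last 2 first.
- by apply/measurable_EFinP; apply: measurable_prod => j _; exact: measurable_nat_comp.
- by move=> w; rewrite lee_fin prodr_ge0.
have iK : i \notin K by apply: contra iJK; rewrite mem_cat => ->; rewrite orbT.
have iJ : i \notin J by apply: contra iJK; rewrite mem_cat => ->.
pose A' j k := if k == i then [set j] else A k.
have E j : ev K A `&` X i @^-1` [set j] = ev (i :: K) (A' j).
  apply/seteqP; split=> w.
    move=> [h1 h2] k /=; rewrite inE => /orP[/eqP ->|kK]; rewrite /A' ?eqxx//.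
    by case: eqP => [ki|_]; [rewrite -ki kK in iK|exact: h1].
  move=> h; split; last by have := h i; rewrite /A' eqxx; apply; rewrite /= mem_head.
  move=> k /= kK; have := h k; rewrite /= inE kK orbT => /(_ isT); rewrite /A'.
  by case: eqP => // ki; rewrite -ki kK in iK.
have QE j : Q (ev (i :: K) (A' j)) = (Q (X i @^-1` [set j]) * Q (ev K A))%E.
  have subK : [set` i :: K] `<=` D.
    move=> k /=; rewrite inE => kK; apply: sub; rewrite /= inE mem_cat.
    by case/orP: kK => ->; rewrite ?orbT.
  have uK : uniq (i :: K) by rewrite /= iK; move: uJK; rewrite cat_uniq => /and3P[].
  rewrite /ev (indep _ uK subK)// big_cons {1}/A' eqxx; congr (_ * _)%E.
  have subK' : [set` K] `<=` D by move=> k /= kK; apply: subK; rewrite /= inE kK orbT.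
  have uK' : uniq K by case/andP: uK.
  rewrite (indep _ uK' subK')//; apply: eq_big_seq => k kK; rewrite /A'.
  by case: eqP => // ki; rewrite -ki kK in iK.
under eq_eseriesr => j _.
  rewrite E IH; last 2 first.
  - rewrite -(perm_uniq (s1 := i :: J ++ K)) /= ?iJK//.
    by rewrite perm_sym -(cat1s i K) perm_catCA.
  - by move=> k /= kk; apply: sub; rewrite /= inE mem_cat; move: kk; rewrite mem_cat inE => /or3P[] ->; rewrite ?orbT.
  rewrite QE; over.
rewrite big_cons; set P := (\prod_(k <- J) nat_mean (X k) (f k))%E.
(* The induction hypothesis without extra event identifies [P] as the integral of a function with
   values in [0, 1], so it is a real number and the algebra can be done in [R]. *)
have [p [p0 Pp]] : exists p : R, 0 <= p /\ P = p%:E.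
  have sub' : [set` J ++ [::]] `<=` D.
    by move=> k /=; rewrite cats0 => kJ; apply: sub; rewrite /= inE mem_cat kJ orbT.
  have uJ : uniq (J ++ [::]) by rewrite cats0; move: uJK; rewrite cat_uniq => /andP[].
  have := IH [::] (fun=> setT) uJ sub'.
  have -> : ev [::] (fun=> setT) = setT by apply/seteqP; split.
  rewrite probability_setT mule1 -/P => PE.
  have P0 : (0 <= P)%E by rewrite -PE; apply: integral_ge0 => w _; rewrite lee_fin prodr_ge0.
  have P1 : (P <= 1)%E.
    rewrite -PE -(probability_setT Q) -(mul1e (Q setT)) -integral_cst//.
    apply: ge0_le_integral => //.
    - by move=> w _; rewrite lee_fin prodr_ge0.
    - by apply/measurable_EFinP; apply: measurable_prod => j _; exact: measurable_nat_comp.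
    - move=> w _; rewrite lee_fin.
      suff /andP[] : 0 <= \prod_(k <- J) f k (X k w) <= 1 by [].
      elim/big_ind: _ => [|x y /andP[x0 x1] /andP[y0 y1]|k _]; rewrite ?ler01 ?lexx//.
      by rewrite mulr_ge0 ?mulr_ile1.
  have Pf : P \is a fin_num by rewrite ge0_fin_numE// (le_lt_trans P1)// ltry.
  by exists (fine P); rewrite fine_ge0// fineK.
have qf : Q (ev K A) \is a fin_num by rewrite fin_num_measure.
rewrite Pp -(fineK qf); set q := fine (Q (ev K A)).
have q0 : 0 <= q by rewrite /q fine_ge0.
transitivity (\sum_(0 <= j <oo) ((p * q)%:E * ((f i j)%:E * Q (X i @^-1` [set j]))))%E.
  apply: eq_eseriesr => j _; rewrite -(fineK (_ : Q (X i @^-1` [set j]) \is a fin_num)); last first.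
    by rewrite fin_num_measure//; exact: measurable_nat_preimage.
  by rewrite -!EFinM; congr EFin; ring.
rewrite nneseriesZl; last by move=> j _; rewrite mule_ge0// lee_fin.
by rewrite /nat_mean EFinM muleC muleA.
Qed.

Lemma probability_poisson (X : {RV Q >-> nat}) (l : R) (j : nat) : 0 <= l -> poisson_law X l ->
  Q (X @^-1` [set j]) = (exp_coeff l j * expR (- l))%:E.
Proof.
move=> l0 Xl; have := Xl [set j]; rewrite /distribution /pushforward => ->.
rewrite /poisson_prob; case: ifPn => [lp|lp].
  by rewrite esum_set1 ?lee_fin ?poisson_pmf_ge0// /poisson_pmf lp.
have -> : l = 0 by apply/eqP; rewrite eq_le l0 leNgt lp.
rewrite oppr0 expR0 mulr1 diracE /exp_coeff /=; case: j {Xl} => [|j].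
  by rewrite mem_set// fact0 divr1.
by rewrite memNset// exprS !mul0r.
Qed.

Lemma nat_mean_poisson (X : {RV Q >-> nat}) (l : R) f : 0 <= l -> poisson_law X l ->
  (forall j, 0 <= f j <= 1) -> nat_mean X f = (pmean l f)%:E.
Proof.
move=> l0 Xl f01; rewrite /nat_mean.
under eq_eseriesr do rewrite (probability_poisson _ l0 Xl) -EFinM mulrA.
have cv : cvgn (series (fun j => f j * exp_coeff l j)).
  by apply: (cvg_poisson_series (M := 1)) => // j; have /andP[? ?] := f01 j; rewrite ger0_norm.
have H : series (fun j => f j * exp_coeff l j * expR (- l)) @ \oo --> pmean l f.
  rewrite (_ : series _ = fun n => series (fun j => f j * exp_coeff l j) n * expR (- l)).
    by apply: cvgM => //; exact: cvg_cst.
  by apply/funext => n; rewrite /series /= mulr_suml.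
rewrite -(cvg_lim _ H)// -EFin_lim; last by apply/cvg_ex; exists (pmean l f).
by apply/congr_lim/funext => n /=; rewrite sumEFin.
Qed.

Lemma sum_probability_le1 (A : nat -> set Om) n : (forall i, measurable (A i)) ->
  trivIset setT A -> \sum_(0 <= i < n) fine (Q (A i)) <= 1.
Proof.
move=> mA tA; rewrite -lee_fin -sumEFin -(probability_setT Q).
under eq_bigr do rewrite fineK ?fin_num_measure//.
rewrite big_mkord -(measure_bigsetU Q mA tA) le_measure ?inE//.
by apply: bigsetU_measurable => i _; exact: mA.
Qed.

Definition nat_pmf X (j : nat) : R := fine (Q (X @^-1` [set j])).

Lemma nat_mean_is_pgf X : measurable_fun [set: Om] X ->
  is_pgf (nat_pmf X) (fun z => fine (nat_mean X (fun m => z ^+ m))).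
Proof.
move=> mX j z /andP[z0 z1].
have q0 i : 0 <= nat_pmf X i by rewrite /nat_pmf fine_ge0.
have qE i : (nat_pmf X i)%:E = Q (X @^-1` [set i]).
  by rewrite /nat_pmf fineK// fin_num_measure//; exact: measurable_nat_preimage.
have q1 n : \sum_(0 <= i < n) nat_pmf X i <= 1.
  apply: (sum_probability_le1 (A := fun i => X @^-1` [set i])) => [i|].
    exact: measurable_nat_preimage.
  by move=> i k _ _ [w [/= <- <-]].
pose u i := z ^+ i * nat_pmf X i.
have u0 i : 0 <= u i by rewrite mulr_ge0// exprn_ge0// ltW.
have tail n : (j <= n)%N -> 0 <= series u n - \sum_(0 <= i < j) nat_pmf X i * z ^+ i <= z ^+ j.
  move=> jn; have -> : \sum_(0 <= i < j) nat_pmf X i * z ^+ i = series u j.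
    by rewrite /series /=; apply: eq_bigr => i _; rewrite mulrC.
  rewrite sub_series_geq//; apply/andP; split; first by rewrite sumr_ge0.
  apply: (@le_trans _ _ (\sum_(j <= i < n) z ^+ j * nat_pmf X i)).
    rewrite big_nat [leRHS]big_nat; apply: ler_sum => i /andP[ji _].
    by rewrite ler_wpM2r//; apply: ler_wiXn2l => //; exact: ltW.
  rewrite -mulr_sumr -[leRHS]mulr1 ler_wpM2l ?exprn_ge0 ?(ltW z0)//.
  apply: le_trans (q1 n).
  have -> : \sum_(0 <= i < n) nat_pmf X i =
      \sum_(0 <= i < j) nat_pmf X i + \sum_(j <= i < n) nat_pmf X i by rewrite -big_cat_nat.
  by rewrite lerDr sumr_ge0.
have cu : cvgn (series u).
  apply: nondecreasing_is_cvgn; first by apply/nondecreasing_seqP => n; rewrite seriesSr lerDl.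
  exists 1 => _ [n _ <-]; apply: le_trans (q1 n); rewrite /series /=.
  by apply: ler_sum => i _; rewrite /u -[leRHS]mul1r ler_wpM2r// exprn_ile1 ?ltW.
have -> : fine (nat_mean X (fun m => z ^+ m)) = limn (series u).
  rewrite /nat_mean (eq_eseriesr (g := fun i => (u i)%:E)); last first.
    by move=> i _; rewrite -qE -EFinM.
  rewrite (_ : \big[+%E/0%E]_(0 <= i <oo) (u i)%:E = (limn (series u))%:E)//.
  by rewrite -EFin_lim//; apply/congr_lim/funext => n /=; rewrite sumEFin.
apply/andP; split.
  rewrite subr_ge0; apply: limr_ge => //; near=> n.
  have jn : (j <= n)%N by near: n; exact: nbhs_infty_ge.
  by rewrite -subr_ge0; have /andP[] := tail n jn.
rewrite lerBlDr; apply: limr_le => //; near=> n.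
have jn : (j <= n)%N by near: n; exact: nbhs_infty_ge.
by rewrite -lerBlDr; have /andP[] := tail n jn.
Unshelve. all: by end_near.
Qed.

End independent_naturals.

Section limit_law.
Local Open Scope classical_set_scope.
Context {R : realType} {d : measure_display} {Om : measurableType d}.
Context {Q : probability Om R}.
Variables (r : nat) (theta lambda : nat -> R) (T Z : nat -> {RV Q >-> nat}).
Hypothesis LV : limit_variables r theta lambda T Z.
Hypothesis theta_ge0 : forall v, 0 <= theta v.
Hypothesis lambda_ge0 : forall k, (1 <= k <= r.+1)%N -> 0 <= lambda k.
Hypothesis rate1_ge0 : (0 <= Z1_rate r theta lambda)%E.

Definition limit_rate (k : nat) : R :=
  if k == 1%N then fine (Z1_rate r theta lambda) else lambda k.

Lemma limit_rate_ge0 k : (1 <= k <= r.+1)%N -> 0 <= limit_rate k.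
Proof.
by rewrite /limit_rate; case: eqP => [_ _|_ /lambda_ge0 //]; exact: fine_ge0.
Qed.

Lemma Z_poisson k : (1 <= k <= r.+1)%N -> poisson_law (Z k) (limit_rate k).
Proof.
case: LV => _ _ h1 h2 /andP[k1 kr]; rewrite /limit_rate; case: eqP => [->//|/eqP nk].
by apply: h2; rewrite kr andbT ltn_neqAle eq_sym nk.
Qed.

Definition partial_sum (K : nat) (w : Om) : nat :=
  \sum_(0 <= v < K) 'C(T v w, r) + \sum_(1 <= k < r.+2) k * Z k w.

Lemma measurable_partial_sum K : measurable_fun [set: Om] (partial_sum K).
Proof.
apply: (measurable_nat_of_real (R := R)).
rewrite (_ : (fun w => _) = fun w => \sum_(0 <= v < K) 'C(T v w, r)%:R +
    \sum_(1 <= k < r.+2) k%:R * (Z k w)%:R :> R); last first.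
  apply/funext => w; rewrite /partial_sum natrD !natr_sum.
  by congr (_ + _); apply: eq_bigr => k _; rewrite natrM.
apply: measurable_funD.
  apply: measurable_sum => v.
  exact: (measurable_nat_comp (fun m => 'C(m, r)%:R)).
apply: measurable_sum => k; apply: measurable_funM => //.
exact: (measurable_nat_comp (fun m => m%:R)).
Qed.

Definition factor_fun (z : R) (i : nat + nat) (m : nat) : R :=
  match i with inl _ => z ^+ 'C(m, r) | inr k => z ^+ (k * m) end.

Lemma partial_sum_pgf (z : R) K : 0 <= z <= 1 ->
  nat_mean Q (partial_sum K) (fun m => z ^+ m) =
  ((\prod_(0 <= v < K) pmean (theta v) (fun m => z ^+ 'C(m, r))) *
   \prod_(1 <= k < r.+2) pmean (limit_rate k) (fun m => z ^+ (k * m)))%:E.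
Proof.
move=> z01.
have zn n : 0 <= z ^+ n <= 1 by exact: pow_z01.
have f01 i j : 0 <= factor_fun z i j <= 1 by case: i => k; exact: zn.
rewrite -integral_nat_mean; [|exact: measurable_partial_sum|by move=> j; case/andP: (zn j)].
pose J : seq (nat + nat) := [seq inl v | v <- iota 0 K] ++ [seq inr k | k <- iota 1 r.+1].
have uJ : uniq J.
  rewrite cat_uniq !map_inj_uniq ?iota_uniq/= ?andbT//; try by move=> ? ? [].
  apply/(hasPn (s := [seq inr k | k <- iota 1 r.+1])) => _ /mapP[k _ ->].
  by apply/negP => /mapP[].
have JD : [set` J] `<=` limit_index r.
  move=> i /=; rewrite mem_cat => /orP[/mapP[v _ ->]//|/mapP[k + ->]] /=.
  by rewrite mem_iota add1n ltnS.
have indep : mutually_independent (limit_index r) (limit_family T Z) by case: LV.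
have := indep_prod_mean indep f01 uJ JD.
under eq_integral => w _.
  rewrite (_ : \prod_(i <- J) _ = z ^+ partial_sum K w); first over.
  rewrite big_cat !big_map /= /partial_sum exprD -!prodrXr /index_iota.
  by rewrite subn0 subn1 /=; congr (_ * _); apply: eq_bigr.
move=> ->; rewrite big_cat !big_map /= EFinM -!prodEFin /index_iota subn0 subn1 /=.
congr (_ * _)%E.
  apply: eq_bigr => v _.
  by apply: (nat_mean_poisson (theta_ge0 v)) => [|j]; [case: LV|exact: (f01 (inl v))].
apply: (@eq_big_seq _ _ _ _ (iota 1 r.+1)) => k; rewrite mem_iota add1n ltnS => kr.
apply: (nat_mean_poisson (limit_rate_ge0 kr)) => [|j]; first exact: Z_poisson.
exact: (f01 (inr k)).
Qed.

Lemma partial_sum_homo w K K' : (K <= K')%N -> (partial_sum K w <= partial_sum K' w)%N.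
Proof.
move=> KK'; rewrite leq_add2r (big_cat_nat (n := K) (p := K'))//=.
exact: leq_addr.
Qed.

Definition below (i : nat) : set Om := \bigcap_K (partial_sum K @^-1` [set m | (m <= i)%N]).

Lemma measurable_below i : measurable (below i).
Proof.
apply: bigcap_measurable => // K _; apply: measurable_nat_preimage.
exact: measurable_partial_sum.
Qed.

Lemma limit_sum_lim w :
  (partial_sum K w)%:R%:E @[K --> \oo] --> (limit_sum r T Z w : \bar R).
Proof.
rewrite /limit_sum (_ : (fun K => _) = fun K => ((\sum_(0 <= v < K) ('C(T v w, r)%:R)%:E) +
    (\sum_(1 <= k < r.+2) (k * Z k w)%N%:R)%:E)%E); last first.
  by apply/funext => K; rewrite /partial_sum natrD EFinD sumEFin !natr_sum.
apply: cvgeD; [|by apply: is_cvg_nneseries => v _ _; rewrite lee_fin|exact: cvg_cst].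
by rewrite fin_num_adde_defl.
Qed.

Lemma partial_sum_le_limit K w : ((partial_sum K w)%:R%:E <= limit_sum r T Z w)%E.
Proof.
rewrite -(cvg_lim _ (@limit_sum_lim w))//; apply: lime_ge.
  by apply/cvg_ex; exists (limit_sum r T Z w); exact: limit_sum_lim.
exists K => // K' KK'; rewrite lee_fin ler_nat; exact: partial_sum_homo.
Qed.

Lemma limit_sum_le w i : (limit_sum r T Z w <= i%:R%:E)%E <-> below i w.
Proof.
split=> [h K _|h] /=.
  by rewrite -(ler_nat R) -lee_fin; exact: le_trans (partial_sum_le_limit K w) h.
rewrite -(cvg_lim _ (@limit_sum_lim w))//; apply: lime_le.
  by apply/cvg_ex; exists (limit_sum r T Z w); exact: limit_sum_lim.
by apply: nearW => K; rewrite lee_fin ler_nat; exact: h.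
Qed.

(** The partial sums are nondecreasing natural numbers: if all are at most [i.+1] but not all at
    most [i], one of them equals [i.+1], and so does the limit. *)
Lemma limit_sum_eq j :
  [set w | limit_sum r T Z w = (j%:R%:E : \bar R)] =
  below j `\` (if j is i.+1 then below i else set0).
Proof.
apply/seteqP; split=> w /=.
  move=> E; split; first by apply/limit_sum_le; rewrite E.
  case: j E => [_ []|i E /(limit_sum_le w i)]//.
  by rewrite E lee_fin ler_nat ltnn.
move=> [bj nb].
have [K hK] : exists K, partial_sum K w = j.
  case: j bj nb => [|i] bj nb; first by exists 0%N; apply/eqP; rewrite -leqn0; exact: (bj 0%N I).
  apply: contrapT => nex; apply: nb => K _ /=.
  have := bj K I; rewrite /= leq_eqVlt => /orP[/eqP E|//].
  by exfalso; apply: nex; exists K.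
apply/eqP; rewrite eq_le; apply/andP; split; first by apply/limit_sum_le.
by rewrite -hK partial_sum_le_limit.
Qed.

(** At this stage its total mass may be less than 1, since the infinite sum could be [+oo] with
    positive probability; [limit_pmf_sum] excludes it in the situation of interest. *)
Definition limit_pmf (j : nat) : R := fine (Q [set w | limit_sum r T Z w = (j%:R%:E : \bar R)]).

Lemma measurable_limit_sum_eq j : measurable [set w | limit_sum r T Z w = (j%:R%:E : \bar R)].
Proof.
rewrite limit_sum_eq; apply: measurableD; first exact: measurable_below.
by case: j => [|i]; [exact: measurable0|exact: measurable_below].
Qed.

Lemma below_cvg i :
  fine (Q (partial_sum K @^-1` [set m | (m <= i)%N])) @[K --> \oo] --> fine (Q (below i)).
Proof.
apply: fine_cvg; rewrite fineK ?fin_num_measure//; last exact: measurable_below.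
have mF K : measurable (partial_sum K @^-1` [set m | (m <= i)%N]).
  by apply: measurable_nat_preimage; exact: measurable_partial_sum.
apply: (nonincreasing_cvg_mu (F := fun K => partial_sum K @^-1` [set m | (m <= i)%N])) => //.
- by rewrite (le_lt_trans (probability_le1 _ _))// ltry.
- exact: measurable_below.
- move=> m n mn; apply/subsetPset => w /=; apply: leq_trans.
  exact: partial_sum_homo.
Qed.

(** The events [partial_sum K = j] are not monotone in [K], but the events [partial_sum K <= i]
    decrease; continuity of the measure is applied to the latter and differences are taken. *)
Lemma limit_pmf_cvg j : nat_pmf Q (partial_sum K) j @[K --> \oo] --> limit_pmf j.
Proof.
have mF K A : measurable (partial_sum K @^-1` A).
  by apply: measurable_nat_preimage; exact: measurable_partial_sum.
rewrite /limit_pmf limit_sum_eq /nat_pmf.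
case: j => [|i].
  rewrite setD0; suff -> : [set 0%N] = [set m | (m <= 0)%N] by exact: below_cvg.
  by apply/seteqP; split=> m /=; [move=> ->|rewrite leqn0 => /eqP].
rewrite measureD//; last 3 first.
- exact: measurable_below.
- exact: measurable_below.
- by rewrite (le_lt_trans (probability_le1 _ (measurable_below _)))// ltry.
have -> : below i.+1 `&` below i = below i.
  by apply/setIidr => w h K _ /=; rewrite (leq_trans (h K I)).
rewrite fineB ?fin_num_measure//; try exact: measurable_below.
have -> : (fun K => fine (Q (partial_sum K @^-1` [set i.+1]))) =
    (fun K => fine (Q (partial_sum K @^-1` [set m | (m <= i.+1)%N])) -
              fine (Q (partial_sum K @^-1` [set m | (m <= i)%N]))).
  apply/funext => K; rewrite -fineB ?fin_num_measure//; congr fine.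
  have -> : partial_sum K @^-1` [set i.+1] =
      partial_sum K @^-1` [set m | (m <= i.+1)%N] `\` partial_sum K @^-1` [set m | (m <= i)%N].
    apply/seteqP; split=> w /=; first by move=> ->; rewrite ltnn.
    by move=> [h1 /negP h2]; apply/eqP; rewrite eqn_leq h1 ltnNge.
  rewrite measureD//; last by rewrite (le_lt_trans (probability_le1 _ _))// ltry.
  congr (_ - Q _)%E; apply/seteqP; split=> w /=; first by case.
  by move=> h; split=> //; rewrite (leq_trans h).
by apply: cvgB; exact: below_cvg.
Qed.

Definition degree_factor (z : R) : R :=
  limn (fun K => \prod_(0 <= v < K) pmean (theta v) (fun m => z ^+ 'C(m, r))).

Definition limit_gf (z : R) : R :=
  degree_factor z * \prod_(1 <= k < r.+2) pmean (limit_rate k) (fun m => z ^+ (k * m)).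

(** All factors lie in [0, 1], so the partial products decrease. *)
Lemma degree_factor_cvg z : 0 <= z <= 1 ->
  \prod_(0 <= v < K) pmean (theta v) (fun m => z ^+ 'C(m, r)) @[K --> \oo] --> degree_factor z.
Proof.
move=> z01.
have zn n : 0 <= z ^+ n <= 1 by exact: pow_z01.
have p01 v : 0 <= pmean (theta v) (fun m => z ^+ 'C(m, r)) <= 1.
  have fz j : 0 <= z ^+ 'C(j, r) <= 1 by exact: zn.
  have h := nat_mean_poisson (theta_ge0 v) (let: And4 _ h _ _ := LV in h v) fz.
  apply/andP; split.
    rewrite -lee_fin -h; apply: nneseries_ge0 => j _ _; rewrite mule_ge0// lee_fin.
    by case/andP: (fz j).
  apply: le_trans (ler_norm _) _; apply: pmean_norm_le => // n.
  by case/andP: (fz n) => ? ?; rewrite ger0_norm.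
have P0 K : 0 <= \prod_(0 <= v < K) pmean (theta v) (fun m => z ^+ 'C(m, r)).
  by apply: prodr_ge0 => v _; case/andP: (p01 v).
apply: nonincreasing_is_cvgn.
  apply/nonincreasing_seqP => K; rewrite big_nat_recr//= -[leRHS]mulr1 ler_wpM2l//.
  by case/andP: (p01 K).
by exists 0 => _ [K _ <-].
Qed.

Lemma limit_is_pgf : is_pgf limit_pmf limit_gf.
Proof.
move=> j z z01'; have z01 : 0 <= z <= 1 by case/andP: z01' => ? ?; rewrite !ltW.
have h : fine (nat_mean Q (partial_sum K) (fun m => z ^+ m)) -
   \sum_(0 <= i < j) nat_pmf Q (partial_sum K) i * z ^+ i @[K --> \oo] -->
   limit_gf z - \sum_(0 <= i < j) limit_pmf i * z ^+ i.
  apply: cvgB.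
    rewrite (_ : (fun K => _) = fun K => (\prod_(0 <= v < K) pmean (theta v) (fun m => z ^+ 'C(m, r))) *
      \prod_(1 <= k < r.+2) pmean (limit_rate k) (fun m => z ^+ (k * m))); last first.
      by apply/funext => K; rewrite partial_sum_pgf.
    by apply: cvgM; [exact: degree_factor_cvg|exact: cvg_cst].
  apply: cvg_big => [|i _] //; first exact: add_continuous.
  by apply: cvgM; [exact: limit_pmf_cvg|exact: cvg_cst].
have b K := nat_mean_is_pgf Q (measurable_partial_sum K) j z01'.
apply/andP; split.
  by apply: (ler_cvg_to (cvg_cst 0) h); apply: nearW => K; case/andP: (b K).
by apply: (ler_cvg_to h (cvg_cst (z ^+ j))); apply: nearW => K; case/andP: (b K).
Qed.

End limit_law.

(** * Extended real variables concentrated on the natural numbers *)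

Section natural_laws.
Local Open Scope classical_set_scope.
Context {R : realType} {d : measure_display} {Om : measurableType d}.
Variables (Q : probability Om R) (Y : Om -> \bar R) (q : nat -> R).
Hypothesis measurable_Y : measurable_fun [set: Om] Y.
Hypothesis qE : forall j, Q [set w | Y w = j%:R%:E] = (q j)%:E.
Hypothesis q_sum : series q @ \oo --> (1 : R).

(** The default 0 is used only where [Y] is not a natural number, a null event since the masses [q]
    add up to 1. *)
Definition nat_part (w : Om) : nat := xget 0%N [set j | Y w = j%:R%:E].

Lemma nat_partE w j : Y w = j%:R%:E -> nat_part w = j.
Proof.
move=> E; rewrite /nat_part; case: xgetP => [i _ /=|/(_ j) /= []//].
by rewrite E => -[/eqP]; rewrite eqr_nat => /eqP ->.
Qed.

Let D := \bigcup_(j : nat) [set w | Y w = j%:R%:E].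

Let mYj j : measurable [set w | Y w = j%:R%:E].
Proof.
rewrite -[X in measurable X]setTI.
exact: (measurable_Y measurableT (@emeasurable_set1 R j%:R%:E)).
Qed.

Let mD : measurable D. Proof. exact: bigcup_measurable. Qed.

Let QD : Q D = 1%E.
Proof.
rewrite /D measure_bigcup//=; last first.
  by move=> i j _ _ [w [/= -> [/eqP]]]; rewrite eqr_nat => /eqP.
rewrite (eq_eseriesr (g := fun j => (q j)%:E)); last by move=> j _; rewrite qE.
rewrite (_ : 1%E = (limn (series q))%:E); last by rewrite (cvg_lim _ q_sum).
rewrite -EFin_lim; last by apply/cvg_ex; exists 1.
rewrite (eq_eseriesl (Q := xpredT)); last by move=> j; rewrite mem_setT.
by apply/congr_lim/funext => n /=; rewrite sumEFin.
Qed.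

Let QI A : measurable A -> Q A = Q (A `&` D).
Proof.
move=> mA; rewrite [LHS](measureDI Q mA mD).
rewrite -[RHS]add0e; congr (_ + _)%E; apply/eqP; rewrite eq_le measure_ge0 andbT.
have <- : Q (~` D) = 0%E by rewrite probability_setC// QD subee.
by apply: le_measure; rewrite ?inE; [exact: measurableD|exact: measurableC|move=> w []].
Qed.

Lemma ae_natural : {ae Q, forall w, Y w = (nat_part w)%:R%:E}.
Proof.
exists (~` D); split; first exact: measurableC.
  by rewrite probability_setC// QD subee.
move=> w /= h [j _ /= E]; by apply: h; rewrite (nat_partE E) E.
Qed.

Lemma measurable_nat_part : measurable_fun [set: Om] nat_part.
Proof.
move=> _ A _; rewrite setTI.
have -> : nat_part @^-1` A = (\bigcup_(j in A) [set w | Y w = j%:R%:E]) `|`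
    (~` D `&` [set w | A (nat_part w)]).
  apply/seteqP; split=> w /=; last by case=> [[j Aj /= /nat_partE ->]|[_]].
  move=> Aw; have [[j _ /= E]|nD] := pselect (D w); last by right.
  by left; exists j => //; rewrite -(nat_partE E).
apply: measurableU; first exact: bigcup_measurable.
have [A0|nA0] := pselect (A 0%N).
  rewrite (_ : _ `&` _ = ~` D); first exact: measurableC.
  apply/setIidPl => w nD /=; rewrite /nat_part; case: xgetP => // i _ /= E.
  by exfalso; apply: nD; exists i.
rewrite (_ : _ `&` _ = set0)//; rewrite -subset0 => w [nD] /=.
rewrite /nat_part; case: xgetP => // i _ /= E _; apply: nD; by exists i.
Qed.

Lemma nat_part_law j : Q (nat_part @^-1` [set j]) = (q j)%:E.
Proof.
rewrite -qE (QI (mYj j)) (QI (measurable_nat_preimage _ measurable_nat_part)).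
congr (Q _); apply/seteqP; split=> w [/= E Dw]; split=> //.
  by case: (Dw) => i _ /= Ei; rewrite -E (nat_partE Ei).
exact: nat_partE.
Qed.

Lemma natural_integral (h : R -> R) :
  measurable_fun [set: \bar R] (fun y => h (fine y)) -> (forall j : nat, 0 <= h j%:R) ->
  cvgn (series (fun j => q j * h j%:R)) ->
  (\int[Q]_w (h (fine (Y w)))%:E = (rsum (fun j => q j * h j%:R))%:E)%E.
Proof.
move=> mh h0 ch.
transitivity (\int[Q]_w (h (nat_part w)%:R)%:E)%E.
  apply: ae_eq_integral => //.
  - by apply/measurable_EFinP; exact: measurableT_comp mh measurable_Y.
  - apply/measurable_EFinP.
    exact: (measurable_nat_comp (fun m => h m%:R) measurable_nat_part).
  - by apply: filterS ae_natural => w E _; rewrite E.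
rewrite (integral_nat_mean (f := fun m => h m%:R) Q measurable_nat_part h0) /nat_mean.
rewrite /rsum -EFin_lim//; apply/congr_lim/funext => n /=.
by rewrite /series /= -sumEFin; apply: eq_bigr => i _; rewrite nat_part_law -EFinM mulrC.
Qed.

Lemma natural_law A : measurable A ->
  (Q (Y @^-1` A) = \sum_(0 <= j <oo) ((\1_A j%:R%:E : R)%:E * (q j)%:E))%E.
Proof.
move=> mA; have mYA : measurable (Y @^-1` A).
  by rewrite -[X in measurable X]setTI; exact: measurable_Y.
have mN B : measurable (nat_part @^-1` B).
  exact: measurable_nat_preimage measurable_nat_part.
transitivity (Q (nat_part @^-1` [set j | A j%:R%:E])).
  rewrite (QI mYA) (QI (mN _)); congr (Q _).
  by apply/seteqP; split=> w [/= Aw [j Ij /= E]]; move: Aw; rewrite (nat_partE E) E => Aw; split=> //; exists j.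
rewrite -[X in Q X]setIT -integral_indic//.
transitivity (\int[Q]_w ((fun m : nat => (\1_A m%:R%:E : R)) (nat_part w))%:E)%E.
  by apply: eq_integral => w _; rewrite !indicE.
rewrite (integral_nat_mean (f := fun m => \1_A m%:R%:E) Q measurable_nat_part)//.
by apply: eq_eseriesr => j _; rewrite nat_part_law.
Qed.

End natural_laws.

Section first_rate.
Local Open Scope classical_set_scope.
Context {R : realType}.
Variables (r : nat) (theta lambda : nat -> R).
Hypothesis theta_ge0 : forall v, 0 <= theta v.
Hypothesis theta_sum : forall K, \sum_(0 <= i < K) theta i ^+ r / r`!%:R <= lambda 1%N.

Let u i : R := theta i ^+ r / r`!%:R.

Let cvg_u : cvgn (series u).
Proof.
have u0 i : 0 <= u i by rewrite divr_ge0 ?exprn_ge0.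
apply: nondecreasing_is_cvgn; first by apply/nondecreasing_seqP => n; rewrite seriesSr lerDl.
by exists (lambda 1%N) => _ [n _ <-]; exact: theta_sum.
Qed.

Lemma Z1_rateE : Z1_rate r theta lambda = (lambda 1%N - limn (series u))%:E.
Proof.
rewrite /Z1_rate EFinB -nneseriesZl; last by move=> i _; rewrite lee_fin exprn_ge0.
congr (_ - _)%E; rewrite -EFin_lim//; apply/congr_lim/funext => n /=.
by rewrite /series /= -sumEFin; apply: eq_bigr => i _; rewrite -EFinM mulrC.
Qed.

Lemma Z1_rate_ge0 : (0 <= Z1_rate r theta lambda)%E.
Proof.
by rewrite Z1_rateE lee_fin subr_ge0; apply: limr_le => //; apply: nearW => n; exact: theta_sum.
Qed.

Lemma pruned_rate_cvg k : pruned_rate r theta lambda K k @[K --> \oo] --> limit_rate r theta lambda k.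
Proof.
rewrite /pruned_rate /limit_rate; case: eqP => _; last exact: cvg_cst.
by rewrite Z1_rateE; apply: cvgB => //; exact: cvg_cst.
Qed.

End first_rate.

(** * Convergence of the star count along a filter *)

Section star_count_limit.
Local Open Scope classical_set_scope.
Context {R : realType} {F : set_system nat} {FF : ProperFilter F}.
Variables (V C : nat -> finType) (e : forall n, rel (V n)) (r : nat).
Variables (theta lambda : nat -> R).
Arguments e : clear implicits.
Hypothesis esym : forall n, symmetric (e n).
Hypothesis eirr : forall n, irreflexive (e n).
Hypothesis r_gt1 : (1 < r)%N.
Hypothesis C_gt0 : forall n, (0 < #|C n|)%N.
Hypothesis c_inv : (#|C n|%:R)^-1 @[n --> F] --> (0 : R).
Hypothesis sets_cvg : forall k, (1 <= k <= r.+1)%N ->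
  #|star_sets (e n) r k|%:R / #|C n|%:R ^+ r @[n --> F] --> lambda k.
Hypothesis degrees_cvg : forall v,
  (ranked_degree (e n) v)%:R / #|C n|%:R @[n --> F] --> theta v.

Let th0 v : 0 <= theta v. Proof. exact: (theta_ge0 C_gt0 degrees_cvg). Qed.

Let th_sum K : \sum_(0 <= i < K) theta i ^+ r / r`!%:R <= lambda 1%N.
Proof. exact: (sum_theta_le esym eirr r_gt1 C_gt0 c_inv sets_cvg degrees_cvg). Qed.

Lemma star_rate_ge0 : (0 <= Z1_rate r theta lambda)%E.
Proof. exact: (Z1_rate_ge0 th0 th_sum). Qed.

Section limit_variables.
Context {d : measure_display} {Om : measurableType d} {Q : probability Om R}.
Variables (T Z : nat -> {RV Q >-> nat}).
Hypothesis LV : limit_variables r theta lambda T Z.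

Let la0 k : (1 <= k <= r.+1)%N -> 0 <= lambda k.
Proof. exact: (lambda_ge0 C_gt0 sets_cvg). Qed.

Let p := limit_pmf r T Z.

Lemma limit_pgf_cvg z : 0 < z < 1 ->
  limit_pgf r theta lambda K z @[K --> \oo] --> limit_gf r theta lambda z.
Proof.
move=> /andP[z0 z1]; have z01 : 0 <= z <= 1 by rewrite !ltW.
rewrite /limit_pgf /limit_gf; apply: cvgM; first exact: (degree_factor_cvg LV th0 z01).
apply: (cvg_prod_nat (f := fun k K => pmean (pruned_rate r theta lambda K k) _)) => k kr.
apply: cvg_pmean.
- by move=> m; have /andP[a b] := pow_z01 z01 (k * m); rewrite ger0_norm.
- by move=> K; exact: (pruned_rate_ge0 esym eirr r_gt1 C_gt0 c_inv sets_cvg degrees_cvg K kr).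
- by apply: limit_rate_ge0 => //; exact: Z1_rate_ge0.
- exact: pruned_rate_cvg.
Qed.

Lemma mono_count_pmf_cvg j :
  avg_pmf (C := C n) (R := R) (mono_count (e n) r) j @[n --> F] --> p j.
Proof.
have h n : is_pgf (avg_pmf (R := R) (mono_count (C := C n) (e n) r))
    (fun z => avg (fun x => z ^+ mono_count (C := C n) (e n) r x)) by exact: avg_is_pgf.
apply: (pgf_coef_cvg h (limit_is_pgf LV th0 la0 star_rate_ge0)).
move=> z z01; apply: (star_pgf_cvg esym eirr r_gt1 C_gt0 c_inv sets_cvg degrees_cvg).
  by case/andP: z01 => ? ?; rewrite !ltW.
exact: limit_pgf_cvg.
Qed.

Lemma mono_count_mean_cvg (g : nat -> R) : (forall j, 0 <= g j) ->
  (exists2 M, 0 <= M & exists m, forall j, g j * j%:R <= M * j%:R ^+ m) ->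
  cvgn (series (fun j => p j * g j)) /\
  avg (fun x => g (mono_count (C := C n) (e n) r x)) @[n --> F] --> rsum (fun j => p j * g j).
Proof.
move=> g0 [M M0 [m gM]]; apply: avg_law_cvg => //; first exact: mono_count_pmf_cvg.
have [B hB] := star_moments_bounded esym eirr C_gt0 sets_cvg degrees_cvg m.
exists (M * B); apply: filterS hB => n hn.
apply: le_trans (ler_wpM2l M0 hn); rewrite -avgZ; apply: le_avg => x; exact: gM.
Qed.

(** The convergence of means is applied to the constant 1, whose average is 1 for every [n]; the
    moment bounds prevent any loss of mass. *)
Lemma limit_pmf_sum : series p @ \oo --> (1 : R).
Proof.
have [] := @mono_count_mean_cvg (fun=> 1) (fun=> ler01).
  by exists 1; rewrite ?ler01//; exists 1%N => j; rewrite expr1.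
rewrite (_ : (fun j => p j * 1) = p); last by apply/funext => j; rewrite mulr1.
move=> cp h; suff <- : rsum p = 1 by [].
rewrite -(cvg_lim _ h)//.
rewrite (_ : (fun n => _) = cst 1) ?lim_cst//.
by apply/funext => n; rewrite avg_cst.
Qed.

Let p_law j : Q [set w | limit_sum r T Z w = j%:R%:E] = (p j)%:E.
Proof. by rewrite /p /limit_pmf fineK// fin_num_measure//; exact: measurable_limit_sum_eq. Qed.

Lemma measurable_limit_sum : measurable_fun [set: Om] (limit_sum r T Z).
Proof.
apply: (emeasurable_fun_cvg (fun K w => (partial_sum r T Z K w)%:R%:E)) => [K|w _].
  apply/measurable_EFinP; apply: (measurable_nat_comp (fun m => m%:R)).
  exact: measurable_partial_sum.
exact: limit_sum_lim.
Qed.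

Lemma limit_sum_ae_fin : {ae Q, forall w, limit_sum r T Z w \is a fin_num}.
Proof.
by apply: filterS (ae_natural measurable_limit_sum p_law limit_pmf_sum) => w ->.
Qed.

Lemma mono_count_mean_cvg_limit (h : R -> R) : measurable_fun [set: R] h ->
  (forall j : nat, 0 <= h j%:R) ->
  (exists2 M, 0 <= M & exists m, forall j : nat, h j%:R * j%:R <= M * j%:R ^+ m) ->
  exists2 L : R, (\int[Q]_w (h (fine (limit_sum r T Z w)))%:E = L%:E)%E &
  avg (fun x => h (mono_count (C := C n) (e n) r x)%:R) @[n --> F] --> L.
Proof.
move=> mh h0 hM; have [cs cL] := mono_count_mean_cvg h0 hM.
exists (rsum (fun j => p j * h j%:R)) => //.
apply: (natural_integral measurable_limit_sum p_law limit_pmf_sum) => //.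
exact: (measurableT_comp mh).
Qed.

(** Adding [M] makes [f] nonnegative, so that the previous lemma applies; the constant is then
    subtracted from both sides. *)
Lemma mono_count_mean_cvg_bounded (f : R -> R) (M : R) : measurable_fun [set: R] f ->
  (forall x, `|f x| <= M) ->
  exists2 L : R, (\int[Q]_w (f (fine (limit_sum r T Z w)))%:E = L%:E)%E &
  avg (fun x => f (mono_count (C := C n) (e n) r x)%:R) @[n --> F] --> L.
Proof.
move=> mf fM; have M0 : 0 <= M := le_trans (normr_ge0 _) (fM 0).
have [|||L] := @mono_count_mean_cvg_limit (fun x => f x + M).
- by apply: measurable_funD => //.
- by move=> j; have := fM j%:R; rewrite ler_norml -lerBlDr sub0r => /andP[].
- exists (M + M); first exact: addr_ge0.
  exists 1%N => j; rewrite expr1 ler_wpM2r// lerD2r.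
  exact: le_trans (ler_norm _) (fM _).
move=> EL cL; exists (L - M).
  have mY : measurable_fun [set: Om] (fun w => fine (limit_sum r T Z w)).
    exact: (measurableT_comp _ measurable_limit_sum).
  have iM : Q.-integrable [set: Om] (fun w => M%:E).
    exact: finite_measure_integrable_cst.
  have iF : Q.-integrable [set: Om] (fun w => (f (fine (limit_sum r T Z w)))%:E).
    apply: (le_integrable _ _ _ iM) => //.
      by apply/measurable_EFinP; exact: measurableT_comp mf mY.
    by move=> w _; rewrite lee_fin (le_trans (fM _))// ler_norm.
  have := EL; under eq_integral do rewrite EFinD.
  have EM : (\int[Q]_(w in [set: Om]) M%:E = M%:E)%E.
    by rewrite -[RHS]mule1 -(probability_setT Q); exact: integral_cst.
  rewrite integralD// EM => E.
  by rewrite EFinB -E addeK.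
rewrite (_ : (fun n => _) = fun n => avg (fun x => f (mono_count (C := C n) (e n) r x)%:R + M) - M).
  by apply: cvgB => //; exact: cvg_cst.
by apply/funext => n; rewrite avgD avg_cst// addrK.
Qed.

End limit_variables.
End star_count_limit.

(** * Random colourings *)

Section graph_colorings.
Context {V : finType} (G : sgraph V).

Lemma adj_sym : symmetric (adj G).
Proof. by move=> u v; rewrite /adj finset.setUC. Qed.

Lemma adj_irr : irreflexive (adj G).
Proof.
move=> v; apply/negbTE/negP => /(forall_inP (edgesP G)).
by rewrite finset.setUid cards1.
Qed.

Lemma mono_starsE (C : finType) (i : C -> nat) r (x : {ffun V -> C}) : injective i ->
  mono_stars r G (fun v => i (x v)) = mono_count (adj G) r x.
Proof.
move=> ii; rewrite mono_countE; apply: eq_bigr => v _.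
rewrite -cards_draws -sum1_card big_mkcond [RHS]big_mkcond /=; apply: eq_bigr => A _.
rewrite finset.in_set andbC; case: eqP => //= _.
have [/fintype.subsetP h|/subsetPn[u uA nu]] := boolP (A \subset _).
  rewrite big1 => [|u /h]; last by rewrite !inE => /andP[->].
  rewrite mul1n; apply/eqP; rewrite eqb1; apply/forall_inP => u /h.
  by rewrite !inE => /andP[_ /eqP ->].
move: nu; rewrite !inE negb_and => /orP[nu|nu].
  by rewrite (bigD1 u)//= (negbTE nu) !mul0n.
suff -> : [forall u in A, i (x u) == i (x v)] = false by rewrite muln0.
apply/negbTE/forall_inPn.
by exists u => //; rewrite (inj_eq ii).
Qed.

End graph_colorings.

Section uniform_coloring.
Local Open Scope classical_set_scope.
Context {R : realType} {d : measure_display} {Om : measurableType d}.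
Context {P : probability Om R} {V : finType} (c : nat).
Variable X : V -> {RV P >-> nat}.
Hypothesis c_gt0 : (0 < c)%N.
Hypothesis X_unif : forall v, uniform_color (X v) c.
Hypothesis X_indep : mutually_independent [set: V] X.

Let mX v A : measurable (X v @^-1` A).
Proof. by apply: measurable_nat_preimage; exact: measurable_funPT. Qed.

(** For arbitrary [h], a preimage is a countable union of cells on which the whole colouring is
    constant; [pickle] enumerates these colourings. *)
Lemma measurable_coloring (h : (V -> nat) -> R) :
  measurable_fun [set: Om] (fun w => h (fun v => X v w)).
Proof.
move=> _ A _; rewrite setTI.
pose cell (y : {ffun V -> nat}) := \bigcap_(v in [set` enum V]) X v @^-1` [set y v].
pose part k := if (unpickle k : option {ffun V -> nat}) is Some y then if `[< A (h y) >] then cell y else set0 else set0.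
have -> : (fun w => h (fun v => X v w)) @^-1` A = \bigcup_k part k.
  apply/seteqP; split=> w /=.
    move=> Aw; exists (pickle [ffun v => X v w]) => //; rewrite /part pickleK.
    have E : (fun v => X v w) = [ffun v => X v w] by apply/funext => v; rewrite ffunE.
    rewrite asboolT; last by rewrite -E.
    by move=> v _ /=; rewrite ffunE.
  move=> [k _]; rewrite /part; case: unpickle => // y; case: asboolP => // Ay wy.
  suff -> : (fun v => X v w) = y by [].
  by apply/funext => v; apply: (wy v); rewrite /= mem_enum.
apply: bigcup_measurable => k _; rewrite /part; case: unpickle => // y; case: ifP => // _.
by apply: fin_bigcap_measurable => // v _; exact: mX.
Qed.

Let color_prob v (i : 'I_c) : P (X v @^-1` [set i.+1]) = (c%:R^-1)%:E.
Proof. exact: (X_unif v (ltn_ord i : 1 <= i.+1 <= c)%N). Qed.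

(** [uniform_color] prescribes only the masses of [1], ..., [c]; as they add up to 1, all other
    values form a null event. *)
Let ae_color : {ae P, forall w, forall v, (1 <= X v w <= c)%N}.
Proof.
apply: filter_forall => v.
pose B := \big[setU/set0]_(i < c) (X v @^-1` [set (i : nat).+1]).
have mB : measurable B by apply: bigsetU_measurable => i _; exact: mX.
have PB : P B = 1%E.
  have tF : trivIset setT (fun i => X v @^-1` [set i.+1]).
    by move=> i k _ _ [w [/= -> []]].
  rewrite [LHS](@measure_bigsetU _ _ _ P (fun i => X v @^-1` [set i.+1]) (fun i => mX _ _) tF c).
  transitivity (\sum_(i < c) (c%:R^-1 : R)%:E)%E.
    by apply: eq_bigr => i _; exact: color_prob.
  by rewrite sumEFin sumr_const card_ord -[c%:R^-1 *+ c]mulr_natr mulVf// pnatr_eq0 -lt0n.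
exists (~` B); split; first exact: measurableC.
  by rewrite probability_setC// PB subee.
move=> w /= h Bw; apply: h; move: Bw; rewrite /B -(bigcup_mkord c (fun i => X v @^-1` [set i.+1])) => -[i /= ic ->].
by rewrite ltnS.
Qed.

(** Almost every outcome lies in exactly one cell of constant colouring, and by independence all
    cells have the same probability. *)
Lemma expectation_coloring (h : (V -> nat) -> R) :
  ('E_P[fun w => h (fun v => X v w)] =
   (avg (fun x : {ffun V -> 'I_c} => h (fun v => (x v).+1)))%:E)%E.
Proof.
pose cell (x : {ffun V -> 'I_c}) := \bigcap_(v in [set` enum V]) X v @^-1` [set (x v).+1].
have mcell x : measurable (cell x) by apply: fin_bigcap_measurable => // v _; exact: mX.
have Pcell x : P (cell x) = ((#|{ffun V -> 'I_c}|%:R)^-1)%:E.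
  rewrite /cell (X_indep (enum_uniq _))//.
  transitivity (\prod_(v <- enum V) (c%:R^-1 : R)%:E)%E.
    by apply: eq_bigr => v _; exact: color_prob.
  rewrite prodEFin; congr EFin.
  by rewrite big_enum_cond /= prodr_const card_ffun card_ord natrX exprVn.
have intcell x : (\int[P]_w (\1_(cell x) w)%:E = ((#|{ffun V -> 'I_c}|%:R)^-1)%:E)%E.
  by rewrite integral_indic// setIT; exact: Pcell.
rewrite unlock; transitivity (\int[P]_w (\sum_(x : {ffun V -> 'I_c}) (h (fun v => (x v).+1))%:E * (\1_(cell x) w)%:E))%E.
  apply: ae_eq_integral => //.
  - by apply/measurable_EFinP; exact: measurable_coloring.
  - apply: emeasurable_sum => x; apply: emeasurable_funM => //.
    by apply/measurable_EFinP; exact: measurable_indic.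
  - apply: filterS ae_color => w hw _.
    have ltc v : ((X v w).-1 < c)%N by case/andP: (hw v) => ? ?; rewrite prednK.
    have Xw : (fun v => X v w) = fun v => ([ffun v => Ordinal (ltc v)] v).+1.
      by apply/funext => v; rewrite ffunE /= prednK//; case/andP: (hw v).
    rewrite (bigD1 [ffun v => Ordinal (ltc v)])//= big1 ?adde0 => [|y yx].
      rewrite -Xw indicE mem_set ?mule1// => v _ /=.
      by rewrite ffunE /= prednK//; case/andP: (hw v).
    rewrite indicE memNset ?mule0// => wy; case/eqP: yx; apply/ffunP => v.
    rewrite ffunE; apply: val_inj => /=.
    by rewrite (wy v) //= mem_enum.
rewrite integral_sum//; last first.
  move=> x; apply: integrableZl => //; exact: integrable_indic.
under eq_bigr => x _.
  rewrite integralZl//; last exact: integrable_indic.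
  rewrite intcell -EFinM; over.
by rewrite sumEFin /avg mulr_suml.
Qed.

Lemma expectation_mono_stars (G : sgraph V) r (f : R -> R) :
  ('E_P[fun w => f (mono_stars r G (fun v => X v w))%:R] =
   (avg (fun x : {ffun V -> 'I_c} => f (mono_count (adj G) r x)%:R))%:E)%E.
Proof.
rewrite (expectation_coloring (fun x => f (mono_stars r G x)%:R)); congr EFin.
apply: eq_avg => x; rewrite (@mono_starsE _ G _ (fun i : 'I_c => i.+1))//.
by move=> i j [] /val_inj.
Qed.

End uniform_coloring.

(** * Isomorphism classes *)

Section copies.
Implicit Types (U V : finType).

Lemma is_copyP U V (H : sgraph U) (W : {set V}) (E : {set {set V}}) :
  reflect (exists f : U -> V, [/\ injective f, f @: [set: U] = W &
    [set f @: (e : {set U}) | e in edges H] = E]) (is_copy H W E).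
Proof.
apply: (iffP existsP) => [[f /and3P[/injectiveP fi /eqP fW /eqP fE]]|[f [fi fW fE]]].
  by exists f.
have ff (A : {set U}) : finfun f @: A = f @: A by apply: eq_imset => u; rewrite ffunE.
exists (finfun f); apply/and3P; split; first by apply/injectiveP => u v; rewrite !ffunE; exact: fi.
  by rewrite ff fW.
by rewrite -fE; apply/eqP; apply: eq_imset => e; exact: ff.
Qed.

Lemma is_copy_comp U U' V (F : sgraph U) (F' : sgraph U') (W : {set V}) E :
  isomorphic F F' -> is_copy F' W E -> is_copy F W E.
Proof.
move=> /is_copyP[f [fi fW fE]] /is_copyP[g [gi gW gE]]; apply/is_copyP.
exists (g \o f); split; first exact: inj_comp.
  by rewrite imset_comp fW.
rewrite -gE -fE -imset_comp; apply: eq_imset => e /=; exact: imset_comp.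
Qed.

Lemma isomorphic_of_copies U V (F F' : sgraph U) (W : {set V}) E :
  is_copy F W E -> is_copy F' W E -> isomorphic F' F.
Proof.
move=> /is_copyP[f [fi fW fE]] /is_copyP[g [gi gW gE]].
(* The composition of [g] with the inverse of [f]; the default is never reached because both maps
   have image [W]. *)
pose h u := odflt u [pick x | f x == g u].
have fh u : f (h u) = g u.
  rewrite /h; case: pickP => [x /eqP //|no].
  have : g u \in f @: [set: U] by rewrite fW -gW imset_f.
  by case/imsetP => x _ E'; have := no x; rewrite E' eqxx.
have hi : injective h by move=> u v E'; apply: gi; rewrite -!fh E'.
have fhE (e : {set U}) : f @: (h @: e) = g @: e.
  by rewrite -imset_comp; apply: eq_imset.
apply/is_copyP; exists h; split=> //.
  by apply/eqP; rewrite eqEcard finset.subsetT card_imset//=.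
apply: (imset_inj (imset_inj fi)); rewrite fE -gE -imset_comp.
by apply: eq_imset => e /=; exact: fhE.
Qed.

Lemma isomorphic_refl U (F : sgraph U) : isomorphic F F.
Proof.
apply/is_copyP; exists id; split=> //; first by rewrite imset_id.
by rewrite -[RHS]imset_id; apply: eq_imset => e; exact: imset_id.
Qed.

Lemma isomorphic_sym U (F F' : sgraph U) : isomorphic F F' -> isomorphic F' F.
Proof. by move=> h; exact: (isomorphic_of_copies h (isomorphic_refl F')). Qed.

Lemma isomorphic_equiv U : {in [set: sgraph U] & &, equivalence_rel (fun F F' : sgraph U => isomorphic F F')}.
Proof.
move=> F F' F'' _ _ _; split; first exact: isomorphic_refl.
move=> FF'; apply/idP/idP => h; last exact: is_copy_comp FF' h.
exact: is_copy_comp (isomorphic_sym FF') h.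
Qed.

Section spokes.
Context {U : finType}.
Implicit Types (F : sgraph U) (u v : U).

Definition spokes v : {set {set U}} := [set [set v; u] | u in [set~ v]].

(** A third vertex is needed: on two vertices both stars consist of the same single edge. This is
    one place where [r >= 2] enters. *)
Lemma spokes_inj : (2 < #|U|)%N -> injective spokes.
Proof.
move=> U2 v w E; apply/eqP/negPn/negP => vw.
have [u] : exists u, u \notin [set v; w].
  apply/existsP; rewrite -negb_forall; apply/negP => /forallP h.
  move: U2; rewrite -cardsT (_ : [set: U] = [set v; w]) ?cards2 ?vw//.
  by apply/setP => x; rewrite (h x) inE.
rewrite !inE negb_or => /andP[uv uw].
have : [set v; u] \in spokes w by rewrite -E; apply/imsetP; exists u; rewrite ?inE.
case/imsetP => x; rewrite !inE => xw /setP /(_ w); rewrite !inE eqxx /=.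
by rewrite [w == v]eq_sym (negbTE vw) [w == u]eq_sym (negbTE uw).
Qed.

Definition hubs F : {set U} := [set v | [set~ v] \subset nbr (adj F) v].

Lemma spokes_sub F v : (spokes v \subset edges F) = (v \in hubs F).
Proof.
rewrite inE; apply/fintype.subsetP/fintype.subsetP => h u.
  by move=> uv; rewrite inE /adj; apply: h; exact: imset_f.
by case/imsetP => x /h; rewrite inE /adj => + ->.
Qed.

End spokes.

Lemma star_is_copy r v : is_copy (star r) [set: 'I_r.+1] (spokes v).
Proof.
apply/is_copyP; exists (tperm ord0 v); split; first exact: perm_inj.
  by apply/eqP; rewrite eqEcard finset.subsetT card_imset//=; exact: perm_inj.
rewrite /star /= /star_edges -imset_comp; apply/setP => e; apply/imsetP/imsetP.
  move=> [i _ ->] /=; exists (tperm ord0 v (lift ord0 i)).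
    rewrite !inE; apply/eqP => E; have := @perm_inj _ (tperm ord0 v) (lift ord0 i) ord0.
    by rewrite E tpermL => /(_ erefl).
  by rewrite imsetU1 imset_set1 tpermL.
move=> [u]; rewrite !inE => uv ->.
have : tperm ord0 v u != ord0.
  by apply/eqP => E; case/eqP: uv; rewrite -(tpermK ord0 v u) E tpermL.
rewrite eq_sym => /unlift_some[i E _]; exists i => //=.
by rewrite imsetU1 imset_set1 tpermL -E tpermK.
Qed.

Lemma star_copyE r (S : {set 'I_r.+1} * {set {set 'I_r.+1}}) :
  is_copy (star r) S.1 S.2 -> exists v, S = ([set: _], spokes v).
Proof.
move=> /is_copyP[f [fi fW fE]]; exists (f ord0); rewrite [S]surjective_pairing.
have ST : S.1 = [set: 'I_r.+1].
  by apply/eqP; rewrite eqEcard finset.subsetT -fW (card_imset _ fi) leqnn.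
congr (_, _) => //; rewrite -fE /= /star_edges -imset_comp.
apply/setP => e; apply/imsetP/imsetP.
  move=> [i _ ->] /=; exists (f (lift ord0 i)); last by rewrite imsetU1 imset_set1.
  by rewrite !inE (inj_eq fi) eq_sym neq_lift.
move=> [u]; rewrite !inE => uv ->.
have : u \in f @: [set: 'I_r.+1] by rewrite fW ST inE.
case/imsetP => x _ ux; have : x != ord0 by apply: contraNneq uv => <-; rewrite ux.
rewrite eq_sym => /unlift_some[i E _]; exists i => //=.
by rewrite imsetU1 imset_set1 ux E.
Qed.

(** A copy of the star in a graph on [r.+1] vertices is spanning, hence determined by its centre. *)
Lemma Nsub_star r (F : sgraph 'I_r.+1) : (1 < r)%N -> Nsub (star r) F = #|hubs F|.
Proof.
move=> r1; rewrite /Nsub.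
rewrite -(card_in_imset (f := fun v => ([set: 'I_r.+1], spokes v)) (D := mem (hubs F))); last first.
  by move=> v w _ _ [] /spokes_inj; apply; rewrite card_ord.
congr #|pred_of_set _|; apply/setP => S; rewrite finset.in_set; apply/and3P/imsetP.
  move=> [sub _ /star_copyE[v SE]]; exists v => //.
  by rewrite -spokes_sub; move: sub; rewrite SE.
move=> [v hv ->] /=; split; first by rewrite spokes_sub.
  by apply/forall_inP => e _; exact: finset.subsetT.
exact: star_is_copy.
Qed.

Section induced.
Context {V : finType} (G : sgraph V) (r : nat).
Implicit Types (W : {set V}) (F : sgraph 'I_r.+1).

Definition induced_edges W : {set {set V}} := [set e in edges G | e \subset W].

Lemma hubs_copy F W : is_copy F W (induced_edges W) -> #|hubs F| = #|dominating (adj G) W|.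
Proof.
move=> /is_copyP[f [fi fW fE]].
have fin u : f u \in W by rewrite -fW imset_f.
have fadj u v : adj G (f u) (f v) = adj F u v.
  have -> : adj G (f u) (f v) = (f @: [set u; v] \in induced_edges W).
    rewrite inE imsetU1 imset_set1 /adj; case: (_ \in edges G) => //=.
    by apply/esym/fintype.subsetP => x; rewrite !inE => /orP[] /eqP ->.
  by rewrite -fE mem_imset//; exact: imset_inj.
rewrite -(card_imset _ fi); congr #|pred_of_set _|; apply/setP => x.
rewrite inE; apply/imsetP/andP.
  move=> [v hv ->]; split=> //; apply/fintype.subsetP => y.
  rewrite !inE -fW => /andP[yv /imsetP[u _ yu]]; rewrite yu fadj.
  move: hv; rewrite inE => /fintype.subsetP /(_ u); rewrite !inE; apply.
  by apply: contraNneq yv => <-; rewrite yu.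
move=> [+ /fintype.subsetP h]; rewrite -fW => /imsetP[v _ E]; exists v => //.
rewrite inE; apply/fintype.subsetP => u; rewrite !inE => uv.
have := h (f u); rewrite !inE E fadj; apply.
by rewrite (inj_eq fi) uv fin.
Qed.

Lemma induced_copy W : #|W| = r.+1 -> exists F, is_copy F W (induced_edges W).
Proof.
move=> Wr; pose g (i : 'I_r.+1) : V := enum_val (cast_ord (esym Wr) i).
have gi : injective g by move=> i j /enum_val_inj /cast_ord_inj.
have gW : g @: [set: 'I_r.+1] = W.
  apply/eqP; rewrite eqEcard (card_imset _ gi) cardsT card_ord Wr leqnn andbT.
  by apply/fintype.subsetP => _ /imsetP[i _ ->]; exact: enum_valP.
have P2 : [forall e in [set e : {set 'I_r.+1} | g @: e \in edges G], #|e| == 2].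
  by apply/forall_inP => e; rewrite inE -(card_imset _ gi) => /(forall_inP (edgesP G)).
exists (SGraph P2); apply/is_copyP; exists g; split=> //=.
apply/setP => e; rewrite inE; apply/imsetP/andP.
  move=> [e']; rewrite inE => h ->; split=> //.
  by rewrite -gW imsetS// finset.subsetT.
move=> [eG eW]; have E : e = g @: (g @^-1: e).
  apply/setP => x; apply/idP/imsetP => [xe|[i]]; last by rewrite inE => ? ->.
  have : x \in g @: [set: 'I_r.+1] by rewrite gW (fintype.subsetP eW).
  by case/imsetP => i _ xi; exists i => //; rewrite inE -xi.
by exists (g @^-1: e) => //; rewrite inE -E.
Qed.

Lemma copy_card F W E : is_copy F W E -> #|W| = r.+1.
Proof. by move=> /is_copyP[f [fi <- _]]; rewrite card_imset// cardsT card_ord. Qed.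

Let classes := equivalence_partition (fun F F' : sgraph 'I_r.+1 => isomorphic F F') [set: _].

(** The induced subgraph transports to ['I_r.+1], so its class is not empty, and a transversal meets
    each class exactly once. *)
Lemma card_representatives W : #|W| = r.+1 ->
  #|[set F in transversal classes [set: _] | is_copy F W (induced_edges W)]| = 1%N.
Proof.
move=> Wr; have [F0 h0] := induced_copy Wr.
have part : finset.partition classes [set: _] := equivalence_partitionP (@isomorphic_equiv _).
have /and3P[_ _ /forall_inP X1] := transversalP part.
have inP : finset.pblock classes F0 \in classes.
  by apply: finset.pblock_mem; rewrite (finset.cover_partition part) inE.
have /eqP <- := X1 _ inP; congr #|pred_of_set _|; apply/setP => F.
rewrite finset.in_set finset.in_setI; congr (_ && _).
rewrite (finset.pblock_equivalence_partition (@isomorphic_equiv _)) ?finset.in_setT//.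
apply/idP/idP => h; first exact: isomorphic_of_copies h h0.
exact: is_copy_comp (isomorphic_sym h) h0.
Qed.

(** Translates hypothesis (1) into [star_sets]: after exchanging the sums, each vertex set is
    counted once, through the representative of its induced subgraph. *)
Lemma sum_Nind_star_class k : (1 < r)%N -> (0 < k)%N ->
  (\sum_(F in star_class r k) Nind F G = #|star_sets (adj G) r k|)%N.
Proof.
move=> r1 k0; under eq_bigr => F _ do rewrite /Nind -sum1_card big_mkcond.
rewrite exchange_big /= -sum1_card [RHS]big_mkcond; apply: eq_bigr => W _.
rewrite finset.in_set -big_mkcondr sum1dep_card.
have [Wr|Wr] := eqVneq #|W| r.+1; last first.
  apply: eq_card0 => F; rewrite finset.in_set; apply/negP => /andP[_].
  by rewrite finset.in_set => /copy_card /eqP; rewrite (negbTE Wr).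
have E F : is_copy F W (induced_edges W) ->
    (0 < Nsub (star r) F)%N && (Nsub (star r) F == k) = (#|dominating (adj G) W| == k).
  move=> h; rewrite Nsub_star// (hubs_copy h).
  by case: eqP => [->|_]; rewrite ?andbF// k0.
case: ifP => /= hk; last first.
  apply: eq_card0 => F; rewrite !finset.in_set; apply/negP => /andP[/andP[_ hF] hc].
  by move: hF; rewrite E// hk.
rewrite -(card_representatives Wr); apply: eq_card => F.
rewrite !finset.in_set -andbA; congr (_ && _).
by apply/andP/idP => [[]//|hc]; rewrite E.
Qed.

End induced.
End copies.

(** * Sufficiency, for random variables *)

Section sufficiency.
Local Open Scope classical_set_scope.
Context {R : realType} (r : nat) (r_gt1 : (1 < r)%N).
Variables (V : nat -> finType) (G : forall n, sgraph (V n)) (c : nat -> nat).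
Hypothesis c_gt0 : forall n, (0 < c n)%N.
Hypothesis c_cvg : c @ \oo --> \oo.
Variables (d : nat -> measure_display) (Om : forall n, measurableType (d n)).
Variables (P : forall n, probability (Om n) R) (X : forall n, V n -> {RV (P n) >-> nat}).
Arguments G : clear implicits.
Arguments X : clear implicits.
Hypothesis X_unif : forall n v, uniform_color (X n v) (c n).
Hypothesis X_indep : forall n, mutually_independent [set: V n] (X n).

Lemma inv_colors_cvg : (#|'I_(c n)|%:R)^-1 @[n --> \oo] --> (0 : R).
Proof.
apply/(gtr0_cvgV0 (f := fun n => #|'I_(c n)|%:R)).
  by apply: nearW => n; rewrite ltr0n card_ord.
under eq_fun do rewrite card_ord.
exact: (cvg_comp c (fun m => m%:R : R) c_cvg (cvgr_idn (R := R))).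
Qed.

Lemma colors_gt0 n : (0 < #|'I_(c n)|)%N. Proof. by rewrite card_ord. Qed.

Let stars n (w : Om n) : R := (mono_stars r (G n) (fun v => X n v w))%:R.

Lemma expectation_starsE (f : R -> R) n : ('E_(P n)[f \o @stars n] =
  (avg (fun x : {ffun V n -> 'I_(c n)} => f (mono_count (adj (G n)) r x)%:R))%:E)%E.
Proof. exact: (expectation_mono_stars (c_gt0 n) (@X_unif n) (@X_indep n)). Qed.

Lemma star_law_limit (theta lambda : nat -> R) :
  (forall k, (1 <= k <= r.+1)%N ->
    (\sum_(F in star_class r k) Nind F (G n))%N%:R / (c n)%:R ^+ r @[n --> \oo] --> lambda k) ->
  (forall v, (ordered_degree (G n) v)%:R / (c n)%:R @[n --> \oo] --> theta v) ->
  (0 <= Z1_rate r theta lambda)%E /\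
  forall (d' : measure_display) (Om' : measurableType d')
    (Q : probability Om' R) (T Z : nat -> {RV Q >-> nat}),
    limit_variables r theta lambda T Z ->
    [/\ {ae Q, forall w, limit_sum r T Z w \is a fin_num},
        cvg_in_distribution P stars Q (fine \o limit_sum r T Z)
      & cvg_in_moments P stars Q (fine \o limit_sum r T Z)].
Proof.
move=> hl hd.
pose e n := adj (G n).
have esym n : symmetric (e n) := adj_sym (G n).
have eirr n : irreflexive (e n) := adj_irr (G n).
have sets k : (1 <= k <= r.+1)%N ->
    #|star_sets (e n) r k|%:R / #|'I_(c n)|%:R ^+ r @[n --> \oo] --> lambda k.
  move=> kr.
  suff -> : (fun n => #|star_sets (e n) r k|%:R / #|'I_(c n)|%:R ^+ r) =
      fun n => (\sum_(F in star_class r k) Nind F (G n))%N%:R / (c n)%:R ^+ r :> R.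
    exact: hl.
  by apply/funext => n; rewrite sum_Nind_star_class// ?card_ord//; case/andP: kr.
have degs v : (ranked_degree (e n) v)%:R / #|'I_(c n)|%:R @[n --> \oo] --> theta v.
  by under eq_fun do rewrite card_ord; exact: hd.
split; first exact: (star_rate_ge0 esym eirr r_gt1 colors_gt0 inv_colors_cvg sets degs).
move=> d' Om' Q T Z LV; split.
- exact: (limit_sum_ae_fin esym eirr r_gt1 colors_gt0 inv_colors_cvg sets degs LV).
- move=> f cf [M fM].
  have [|L EL cL] := mono_count_mean_cvg_bounded esym eirr r_gt1 colors_gt0 inv_colors_cvg sets degs LV _ fM.
    exact: continuous_measurable_fun.
  have -> : ('E_Q[f \o (fine \o limit_sum r T Z)] = L%:E)%E by rewrite unlock.
  under eq_fun do rewrite expectation_starsE.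
  by apply: cvg_EFin => //; exact: nearW.
- move=> m.
  have mY := measurable_limit_sum r T Z.
  have Y0 w : 0 <= fine (limit_sum r T Z w).
    by apply: fine_ge0; apply: le_trans (partial_sum_le_limit r T Z 0 w); rewrite lee_fin.
  have [|j||L EL cL] := mono_count_mean_cvg_limit esym eirr r_gt1 colors_gt0 inv_colors_cvg sets degs LV (h := fun x => x ^+ m).
  + exact: exprn_measurable.
  + exact: exprn_ge0.
  + by exists 1 => //; exists m.+1 => j; rewrite mul1r exprSr.
  split.
    apply/integrableP; split.
      apply/measurable_EFinP; apply: measurable_funX.
      exact: (measurableT_comp _ mY).
    rewrite (_ : (\int[Q]_w _ = L%:E)%E) ?ltry// -EL.
    by apply: eq_integral => w _; rewrite gee0_abs// lee_fin exprn_ge0//=.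
  have -> : ('E_Q[fun w => ((fine \o limit_sum r T Z) w ^+ m)%R] = L%:E)%E by rewrite unlock.
  under eq_fun do rewrite (expectation_starsE (fun x => x ^+ m)).
  by apply: cvg_EFin => //; exact: nearW.
Qed.

End sufficiency.

(** * Independent Poisson variables *)

Section affine_image.
Local Open Scope classical_set_scope.
Context {R : realType}.
Local Notation mu := (@lebesgue_measure R).

Lemma measurable_affine (a b : R) :
  measurable_fun [set: measurableTypeR R] (fun u => ((u - a) / b : measurableTypeR R)).
Proof.
apply: measurable_funM; last exact: measurable_cst.
by apply: measurable_funB; [exact: measurable_id|exact: measurable_cst].
Qed.

(** By uniqueness of Lebesgue measure it is enough to compare lengths of half-open intervals. *)
Lemma lebesgue_affine (a b : R) (E : set (measurableTypeR R)) : 0 < b -> measurable E ->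
  mu ((fun u => (u - a) / b) @^-1` E) = (b%:E * mu E)%E.
Proof.
move=> b0 mE; have bi0 : 0 <= b^-1 by rewrite invr_ge0 ltW.
pose f (u : measurableTypeR R) : measurableTypeR R := (u - a) / b.
have mf : measurable_fun [set: measurableTypeR R] f by exact: measurable_affine.
suff H A : measurable A -> mu A = mscale (NngNum bi0) (pushforward mu f) A.
  by rewrite (H mf E mE) /mscale /= /pushforward muleA -EFinM divff ?mul1e ?gt_eqF.
apply: lebesgue_measure_unique => _ [[x y] _ <-] /=.
rewrite /mscale /= /pushforward.
have -> : f @^-1` `]x, y] = `](a + b * x), (a + b * y)]%classic.
  apply/seteqP; split=> u; rewrite /= !in_itv /= /f => /andP[].
    by rewrite ltr_pdivlMr// ler_pdivrMr// => h1 h2; apply/andP; split; lra.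
  by move=> h1 h2; rewrite ltr_pdivlMr// ler_pdivrMr//; apply/andP; split; lra.
rewrite !lebesgue_measure_itv /= !lte_fin ltrD2l ltr_pM2l//.
case: ifP => _; last by rewrite mule0.
by rewrite -!EFinB -EFinM; congr EFin; field; rewrite gt_eqF.
Qed.

End affine_image.

Section digit.
Local Open Scope classical_set_scope.
Context {R : realType}.
Local Notation mu := (@lebesgue_measure R).
Variable p : nat -> R.
Hypothesis p_ge0 : forall j, 0 <= p j.
Hypothesis p_sum : series p @ \oo --> (1 : R).

Definition cdf_cell (j : nat) (u : R) := series p j <= u < series p j.+1.

(* Inverse transform sampling: for [u] uniform on [0, 1[, [digit u] has law [p], and [rest u],
   which rescales the cell of [u] to [0, 1[, is again uniform and independent of [digit u];
   the default value 0 is only taken outside [0, 1[. *)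
Definition digit (u : R) : nat := xget 0%N [set j | cdf_cell j u].

Definition rest (u : R) : R := (u - series p (digit u)) / p (digit u).

Let cdf_homo : nondecreasing_seq (series p).
Proof. by apply/nondecreasing_seqP => n; rewrite seriesSr lerDl. Qed.

Let cdf_le1 j : series p j <= 1.
Proof.
rewrite -(cvg_lim _ p_sum)//; apply: nondecreasing_cvgn_le => //.
by apply/cvg_ex; exists 1.
Qed.

Let cdf_ge0 j : 0 <= series p j. Proof. exact: sumr_ge0. Qed.

Lemma digitP u j : cdf_cell j u -> digit u = j.
Proof.
have uniq i k : cdf_cell i u -> cdf_cell k u -> (i <= k)%N.
  move=> /andP[iu _] /andP[_ uk]; rewrite leqNgt; apply/negP => ki.
  by have := cdf_homo ki; rewrite leNgt (le_lt_trans iu uk).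
move=> ju; rewrite /digit; case: xgetP => [i _ /= iu|/(_ j)//].
by apply/eqP; rewrite eqn_leq !uniq.
Qed.

Lemma digit_cell u : 0 <= u < 1 -> cdf_cell (digit u) u.
Proof.
move=> /andP[u0 u1].
have ex : exists m, u < series p m.
  have /filter_ex[m hm] : \forall m \near \oo, u < series p m.
    by move/cvgr_gt : p_sum; exact.
  by exists m.
suff [j ju] : exists j, cdf_cell j u by rewrite (digitP ju).
case: (ex_minnP ex) => -[|j] um mmin.
  by move: um; rewrite /series /= big_geq// ltNge u0.
exists j; rewrite /cdf_cell um andbT leNgt; apply/negP => /mmin.
by rewrite ltnn.
Qed.

Let measurable_cell j : measurable [set u : measurableTypeR R | cdf_cell j u].
Proof.
by rewrite (_ : [set u | _] = `[series p j, series p j.+1[%classic).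
Qed.

Lemma measurable_digit : measurable_fun [set: measurableTypeR R] digit.
Proof.
move=> _ A _; rewrite setTI.
have -> : digit @^-1` A = (\bigcup_(j in A) [set u | cdf_cell j u]) `|`
    (~` (\bigcup_j [set u | cdf_cell j u]) `&` [set u | A 0%N]).
  apply/seteqP; split=> u /=.
    move=> Au; have [[j _ /= ju]|nu] := pselect ((\bigcup_j [set u | cdf_cell j u]) u).
      by left; exists j => //; rewrite -(digitP ju).
    right; split=> //; move: Au; rewrite /digit; case: xgetP => // i _ iu.
    by exfalso; apply: nu; exists i.
  case=> [[j Aj /= /digitP ->]//|[nu A0]].
  by rewrite /digit; case: xgetP => // i _ iu; exfalso; apply: nu; exists i.
apply: measurableU; first by apply: bigcup_measurable => j _; exact: measurable_cell.
apply: measurableI.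
  by apply: measurableC; apply: bigcup_measurable => j _; exact: measurable_cell.
have [A0|nA0] := pselect (A 0%N); [rewrite (_ : [set _ | _] = setT)|rewrite (_ : [set _ | _] = set0)] => //.
  by apply/seteqP; split.
by apply/seteqP; split.
Qed.

Lemma measurable_rest : measurable_fun [set: measurableTypeR R] (rest : _ -> measurableTypeR R).
Proof.
apply: measurable_funM; last exact: (measurable_nat_comp (fun j => (p j)^-1) measurable_digit).
apply: measurable_funB; first exact: measurable_id.
exact: (measurable_nat_comp (fun j => series p j) measurable_digit).
Qed.

Lemma rest_itv u : 0 <= u < 1 -> 0 <= rest u < 1.
Proof.
move=> /digit_cell; rewrite /cdf_cell /rest seriesSr => /andP[h1 h2].
have pu : 0 < p (digit u) by rewrite -(ltrD2l (series p (digit u))) addr0 (le_lt_trans h1).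
by rewrite divr_ge0 ?subr_ge0// ltr_pdivrMr// mul1r ltrBlDl.
Qed.

Definition weight (B : set nat) : \bar R := (\sum_(0 <= j <oo) (\1_B j * p j)%:E)%E.

Lemma weightT : weight setT = 1%E.
Proof.
rewrite /weight (_ : 1%E = (limn (series p))%:E); last by rewrite (cvg_lim _ p_sum).
rewrite -EFin_lim; last by apply/cvg_ex; exists 1.
apply/congr_lim/funext => n /=; rewrite sumEFin; congr EFin.
by apply: eq_bigr => i _; rewrite indicT mul1r.
Qed.

Lemma measurable_digit_rest (B : set nat) (E : set (measurableTypeR R)) : measurable E ->
  measurable [set u : measurableTypeR R | [/\ 0 <= u < 1, B (digit u) & E (rest u)]].
Proof.
move=> mE; rewrite (_ : [set u | _] = `[0, 1[ `&` (digit @^-1` B `&` rest @^-1` E)).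
  apply: measurableI; first exact: measurable_itv.
  apply: measurableI.
    by rewrite -[X in measurable X]setTI; apply: measurable_digit.
  by rewrite -[X in measurable X]setTI; apply: measurable_rest.
apply/seteqP; split=> u /=; first by case=> *; rewrite in_itv.
by rewrite in_itv /= => -[? []].
Qed.

(** On the cell of [j], [rest] is the affine bijection onto [0, 1[ with slope [1 / p j], so this
    cell contributes [p j * mu E]; a cell with [p j = 0] is empty. The product form is the
    independence of digit and rest. *)
Lemma digit_rest_measure (B : set nat) (E : set (measurableTypeR R)) :
  measurable E -> E `<=` `[0, 1[ ->
  mu [set u | [/\ 0 <= u < 1, B (digit u) & E (rest u)]] = (weight B * mu E)%E.
Proof.
move=> mE E01.
have [x Ex] : exists x : R, mu E = x%:E.
  have : mu E \is a fin_num.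
    rewrite ge0_fin_numE//; apply: (@le_lt_trans _ _ (mu `[0, 1[)).
      by apply: le_measure; rewrite ?inE.
    by rewrite lebesgue_measure_itv /= lte_fin ltr01 ltry.
  by exists (fine (mu E)); rewrite fineK.
pose F j : set (measurableTypeR R) := [set u | [/\ 0 <= u < 1, [set j] (digit u) & E (rest u)]].
have mF j : measurable (F j) by exact: measurable_digit_rest.
have muF j : mu (F j) = (p j * x)%:E.
  have := p_ge0 j; rewrite le_eqVlt => /orP[/eqP pj|pj].
    rewrite -pj mul0r (_ : F j = set0) ?measure0//; rewrite -subset0 => u [/digit_cell + du _].
    by rewrite /cdf_cell (du : digit u = j) seriesSr -pj addr0 leNgt => /andP[/negP].
  rewrite EFinM -Ex -(lebesgue_affine (series p j) pj mE); congr (mu _).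
  apply/seteqP; split=> u /=; first by case=> _; rewrite /rest => ->.
  move=> Eu; have := E01 _ Eu; rewrite /= in_itv /= => /andP[h1 h2].
  have cu : cdf_cell j u.
    move: h1 h2; rewrite pmulr_lge0 ?invr_gt0// subr_ge0 ltr_pdivrMr// mul1r => h1 h2.
    by rewrite /cdf_cell h1 seriesSr /= -ltrBlDl.
  have du := digitP cu; split=> //; last by rewrite /rest du.
  move: cu => /andP[a1 a2]; rewrite (le_trans _ a1)//=.
  exact: lt_le_trans a2 _.
have -> : [set u | [/\ 0 <= u < 1, B (digit u) & E (rest u)]] = \bigcup_(j in B) F j.
  by apply/seteqP; split=> u; [case=> h Bu Eu; exists (digit u)|case=> j Bj [h /= -> Eu]].
rewrite measure_bigcup//; last by move=> i j _ _ [u [[_ /= <- _] [_ /= <- _]]].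
rewrite Ex /weight muleC -nneseriesZl; last first.
  by move=> j _; rewrite lee_fin mulr_ge0// indicE.
rewrite [LHS]eseries_mkcond; apply: eq_eseriesr => j _; rewrite indicE.
by case: (j \in B); rewrite ?mul1r ?mul0r ?mule0// -EFinM mulrC; exact: muF.
Qed.

End digit.

Section digits.
Local Open Scope classical_set_scope.
Context {R : realType}.
Local Notation mu := (@lebesgue_measure R).
Variable p : nat -> nat -> R.
Hypothesis p_ge0 : forall i j, 0 <= p i j.
Hypothesis p_sum : forall i, series (p i) @ \oo --> (1 : R).

Fixpoint state (i n : nat) (u : R) : R :=
  if n is n'.+1 then state i.+1 n' (rest (p i) u) else u.

(** Peeling off the first digit in the recursion makes [digit_rest_measure] apply at each step, the
    rest being again uniform. *)
Fixpoint digits_event (i N : nat) (A : nat -> set nat) : set (measurableTypeR R) :=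
  if N is N'.+1 then [set u | [/\ 0 <= u < 1, A 0%N (digit (p i) u) &
    digits_event i.+1 N' (fun n => A n.+1) (rest (p i) u)]]
  else `[0, 1[.

Lemma digits_eventE i N A : digits_event i N A =
  [set u | 0 <= u < 1 /\ forall n, (n < N)%N -> A n (digit (p (i + n)) (state i n u))].
Proof.
elim: N i A => [|N IH] i A /=.
  by apply/seteqP; split=> u /=; rewrite in_itv /=; [split|case].
apply/seteqP; split=> u /=; rewrite IH.
  case=> u01 A0 [_ AS]; split=> // -[|n] nN /=; first by rewrite addn0.
  by rewrite addnS -addSn; exact: AS.
case=> u01 AS; split=> //; first by have := AS 0%N isT; rewrite addn0.
split; first exact: rest_itv.
by move=> n nN; have := AS n.+1 nN; rewrite addnS -addSn.
Qed.

Lemma measurable_digits_event i N A : measurable (digits_event i N A).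
Proof.
elim: N i A => [|N IH] i A /=; first exact: measurable_itv.
exact: measurable_digit_rest.
Qed.

Lemma digits_event_measure i N A :
  mu (digits_event i N A) = (\prod_(n < N) weight (p (i + n)) (A n))%E.
Proof.
elim: N i A => [|N IH] i A.
  by rewrite big_ord0 /= lebesgue_measure_itv /= lte_fin ltr01 -EFinB subr0.
rewrite big_ord_recl /= digit_rest_measure//; last 2 first.
- exact: measurable_digits_event.
- by rewrite digits_eventE => u [/=]; rewrite in_itv.
rewrite IH addn0; congr (_ * _)%E; apply: eq_bigr => n _.
by rewrite /bump /= addnCA.
Qed.

Definition digit_at (n : nat) (u : R) : nat := digit (p n) (state 0 n u).

Lemma measurable_digit_at n : measurable_fun [set: measurableTypeR R] (digit_at n).
Proof.
suff h : measurable_fun [set: measurableTypeR R] (state 0 n : _ -> measurableTypeR R).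
  by apply: (measurableT_comp (f := digit (p n)) _ h); exact: measurable_digit.
elim: n 0%N => [|n IH] i /=; first exact: measurable_id.
by apply: (measurableT_comp (IH i.+1)); exact: measurable_rest.
Qed.

Lemma measurable_unit_itv : measurable (`[0, 1[ : set (measurableTypeR R)).
Proof. exact: measurable_itv. Qed.

Definition unit_lebesgue : set (measurableTypeR R) -> \bar R := mrestr mu measurable_unit_itv.

HB.instance Definition _ := Measure.on unit_lebesgue.

Let unit_lebesgueT : unit_lebesgue setT = 1%E.
Proof.
by rewrite /unit_lebesgue /mrestr setTI lebesgue_measure_itv /= lte_fin ltr01 -EFinB subr0.
Qed.

HB.instance Definition _ := Measure_isProbability.Build _ _ R unit_lebesgue unit_lebesgueT.

Lemma digit_at_indep (J : seq nat) (A : nat -> set nat) : uniq J ->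
  unit_lebesgue (\bigcap_(n in [set` J]) (digit_at n @^-1` A n)) =
  (\prod_(n <- J) weight (p n) (A n))%E.
Proof.
move=> uJ; pose N := (\max_(n <- J) n).+1.
have JN n : n \in J -> (n < N)%N by move=> nJ; rewrite ltnS; exact: leq_bigmax_seq.
(* Indices outside [J] get the full set, of weight 1, so an initial segment of indices can be
   treated at once. *)
pose A' n := if n \in J then A n else setT.
have -> : unit_lebesgue (\bigcap_(n in [set` J]) (digit_at n @^-1` A n)) = mu (digits_event 0 N A').
  congr (mu _); rewrite digits_eventE; apply/seteqP; split=> u /=.
    rewrite in_itv /= => -[h u01]; split=> // n nN; rewrite /A' add0n.
    by case: ifP => // nJ; exact: h.
  rewrite in_itv /= => -[u01 h]; split=> // n /= nJ.
  by have := h n (JN n nJ); rewrite /A' nJ add0n.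
rewrite digits_event_measure -(big_mkord xpredT (fun n => weight (p (0 + n)) (A' n))).
under eq_bigr do rewrite add0n.
transitivity (\prod_(n <- index_iota 0 N | n \in J) weight (p n) (A n))%E.
  rewrite [RHS]big_mkcond; apply: eq_bigr => n _; rewrite /A'.
  by case: ifP => // _; exact: weightT.
rewrite -big_filter; apply: perm_big; apply: uniq_perm => //.
  by rewrite filter_uniq// iota_uniq.
move=> n; rewrite mem_filter mem_index_iota /=.
by case: (boolP (n \in J)) => //= /JN ->.
Qed.

End digits.

Section independent_poissons.
Local Open Scope classical_set_scope.
Context {R : realType}.
Variable rate : nat -> R.
Hypothesis rate_ge0 : forall n, 0 <= rate n.

Definition poisson_weights (n j : nat) : R := exp_coeff (rate n) j * expR (- rate n).

Let pw_ge0 n j : 0 <= poisson_weights n j.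
Proof. by rewrite mulr_ge0 ?expR_ge0// exp_coeff_ge0. Qed.

Let pw_sum n : series (poisson_weights n) @ \oo --> (1 : R).
Proof.
rewrite (_ : series _ = fun N => series (exp_coeff (rate n)) N * expR (- rate n)); last first.
  by apply/funext => N; rewrite /series /= mulr_suml.
rewrite -(expRxMexpNx_1 (rate n)); apply: cvgM; last exact: cvg_cst.
exact: is_cvg_series_exp_coeff.
Qed.

Lemma weight_poisson n (B : set nat) : weight (poisson_weights n) B = poisson_prob (rate n) 0 B.
Proof.
rewrite /poisson_prob; case: ifPn => [r0|]; last first.
  rewrite -leNgt => r0; have r00 : rate n = 0 by apply/eqP; rewrite eq_le r0 rate_ge0.
  rewrite /weight (nneseriesD1 (n := 0%N))//; last first.
    by move=> k _; rewrite lee_fin mulr_ge0// indicE.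
  rewrite eseries0 ?adde0; last first.
    move=> k _ /= /negPf k0.
    by rewrite /poisson_weights r00 /exp_coeff /= expr0n k0 /= !mul0r mulr0.
  by rewrite /poisson_weights r00 oppr0 expR0 /exp_coeff /= fact0 expr0 divr1 !mulr1 indicE diracE.
rewrite /weight -[B in RHS]set_mem_set -nneseries_esum; last by move=> k _; rewrite lee_fin poisson_pmf_ge0.
rewrite [RHS]eseries_mkcond; apply: eq_eseriesr => k _; rewrite indicE.
case: (k \in B); rewrite ?mul1r ?mul0r//; congr EFin.
by rewrite /poisson_weights /poisson_pmf r0.
Qed.

Definition poisson_digit (n : nat) : {RV (@unit_lebesgue R) >-> nat} :=
  @mfun_Sub _ _ (measurableTypeR R) nat (digit_at poisson_weights n)
    (mem_set (measurable_digit_at pw_ge0 n)).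

Lemma poisson_digit_indep : mutually_independent [set: nat] poisson_digit.
Proof.
move=> J uJ _ A mA; rewrite [LHS](digit_at_indep pw_ge0 pw_sum A uJ).
apply: eq_bigr => n _; have := digit_at_indep pw_ge0 pw_sum A (isT : uniq [:: n]).
rewrite big_seq1 => <-; congr (unit_lebesgue _).
by apply/seteqP; split=> u /=; [apply; exact: mem_head|move=> h m /=; rewrite inE => /eqP ->].
Qed.

Lemma poisson_digit_law n : poisson_law (poisson_digit n) (rate n).
Proof.
move=> A; rewrite -weight_poisson /distribution /pushforward.
have := digit_at_indep pw_ge0 pw_sum (fun=> A) (isT : uniq [:: n]).
rewrite big_seq1 => <-; congr (unit_lebesgue _).
by apply/seteqP; split=> u /=; [move=> h m /=; rewrite inE => /eqP ->|apply; exact: mem_head].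
Qed.

End independent_poissons.

Lemma exists_limit_variables (R : realType) (r : nat) (theta lambda : nat -> R) :
  (forall v, 0 <= theta v) -> (forall k, (1 <= k <= r.+1)%N -> 0 <= lambda k) ->
  (0 <= Z1_rate r theta lambda)%E ->
  exists T Z : nat -> {RV (@unit_lebesgue R) >-> nat}, limit_variables r theta lambda T Z.
Proof.
move=> th0 la0 z0.
(* The index set [nat + nat] is coded into [nat]. The maximum with 0 is there because [limit_rate]
   is known to be nonnegative only for [1 <= k <= r.+1]. *)
pose rate n := match (unpickle n : option (nat + nat)) with
  | Some (inl v) => theta v
  | Some (inr k) => Num.max 0 (limit_rate r theta lambda k)
  | None => 0 end.
have rate0 n : 0 <= rate n.
  by rewrite /rate; case: unpickle => // -[v|k]//; rewrite le_max lexx.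
pose X := poisson_digit rate0.
exists (fun v => X (pickle (inl v : nat + nat))), (fun k => X (pickle (inr k : nat + nat))).
have law_k k : (1 <= k <= r.+1)%N ->
    poisson_law (X (pickle (inr k : nat + nat))) (limit_rate r theta lambda k).
  move=> kr; rewrite (_ : limit_rate _ _ _ _ = rate (pickle (inr k : nat + nat))).
    exact: poisson_digit_law.
  by rewrite /rate pickleK; apply/esym/max_r; exact: limit_rate_ge0.
split.
- move=> J uJ JD A mA.
  have XE i : limit_family (fun v => X (pickle (inl v : nat + nat)))
      (fun k => X (pickle (inr k : nat + nat))) i = X (pickle i) by case: i.
  pose A' n := if unpickle n is Some i then A i else setT.
  have A'E i : A' (pickle i) = A i by rewrite /A' pickleK.
  have uJ' : uniq (map pickle J) by rewrite map_inj_uniq//; exact: (pcan_inj pickleK).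
  have mA' n : measurable (A' n) by [].
  have := poisson_digit_indep rate0 uJ' (@subsetT _ _) mA'; rewrite big_map.
  under eq_bigr do rewrite A'E.
  under [in X in _ = X -> _]eq_bigr do rewrite -/X.
  move=> h; under [RHS]eq_bigr do rewrite XE.
  rewrite -h; congr (unit_lebesgue _); apply/seteqP; split=> u /= hu.
    by move=> _ /= /mapP[i iJ ->]; rewrite A'E; have := hu i iJ; rewrite XE.
  by move=> i /= iJ; rewrite XE -A'E; apply: hu; rewrite /= map_f.
- move=> v; rewrite (_ : theta v = rate (pickle (inl v : nat + nat))).
    exact: poisson_digit_law.
  by rewrite /rate pickleK.
- by have := law_k 1%N; rewrite /limit_rate eqxx; apply.
- move=> k /andP[k2 kr]; have := law_k k; rewrite /limit_rate.
  by rewrite gtn_eqF//; apply; rewrite (ltnW k2).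
Qed.

(** * Tightness *)

Section second_moments.
Context {R : realType} {V C : finType}.
Hypothesis C_gt0 : (0 < #|C|)%N.
Let c : R := #|C|%:R.
Let c_gt0 : 0 < c. Proof. by rewrite ltr0n. Qed.

(** Pointwise, [1 - 4 * (T - m) ^+ 2 / m ^+ 2] is at most the indicator of [m / 2 <= T]. The
    variance is at most [m * s], so the mean of the subtracted term is at most [4 * s / m], which
    [8 * s <= m] makes at most one half. *)
Lemma chebyshev_half (T : {ffun V -> C} -> R) (m s : R) : 0 < m -> avg T = m ->
  avg (fun x => T x ^+ 2) <= m * (m + s) -> 8 * s <= m ->
  2^-1 <= avg (fun x => (m / 2 <= T x)%R%:R) :> R.
Proof.
move=> m0 Tm T2 sm.
have h : avg (fun x => 1 - (T x - m) ^+ 2 * (4 / m ^+ 2)) <= avg (fun x => (m / 2 <= T x)%R%:R) :> R.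
  apply: le_avg => x; have [_|Tx] := leP (m / 2) (T x).
    by rewrite lerBlDr lerDl mulr_ge0 ?sqr_ge0// divr_ge0// sqr_ge0.
  rewrite subr_le0 mulrA ler_pdivlMr ?exprn_gt0// mul1r.
  by have : 0 <= (T x - m / 2 * 3) * (T x - m / 2); [rewrite nmulr_lge0; lra|nra].
apply: le_trans h; rewrite avgB avg_cst// avgZr.
have -> : avg (fun x => (T x - m) ^+ 2) = avg (fun x => T x ^+ 2) - m ^+ 2.
  rewrite (@eq_avg _ _ _ _ (fun x => T x ^+ 2 - 2 * m * T x + m ^+ 2)); last by move=> x; ring.
  by rewrite avgD avgB avg_cst// avgZ Tm; ring.
rewrite lerBrDr -lerBrDl mulrA ler_pdivrMr ?exprn_gt0//.
by nra.
Qed.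

Variable (e : rel V).
Hypothesis eirr : irreflexive e.

Let M (v : V) (x : {ffun V -> C}) : nat := #|[set u in nbr e v | x u == x v]|.

Let ME v x : (M v x)%:R = \sum_(u in nbr e v) (mono [set v; u] x)%:R :> R.
Proof.
rewrite -natr_sum; congr _%:R; rewrite /M -sum1_card big_mkcond [RHS]big_mkcond.
apply: eq_bigr => u _; rewrite inE; case: (u \in nbr e v) => //=.
suff -> : mono [set v; u] x = (x u == x v) by case: eqP.
apply/forall_inP/eqP => [h|E u1].
  by have /forall_inP/(_ v) := h u (set22 _ _); rewrite set21 => /(_ isT)/eqP.
by rewrite !inE => u1E; apply/forall_inP => u2; rewrite !inE => /orP[] /eqP ->; case/orP: u1E => /eqP ->; rewrite ?E.
Qed.

Let nbr_neq u v : u \in nbr e v -> v != u.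
Proof. by rewrite inE; apply: contraTneq => ->; rewrite eirr. Qed.

Lemma avg_same_color v : avg (fun x => (M v x)%:R) = #|nbr e v|%:R / c.
Proof.
under eq_avg => x do rewrite ME.
rewrite avg_sum (eq_bigr (fun=> c^-1)) => [|u uv].
  by rewrite sumr_const -[c^-1 *+ _]mulr_natl.
by rewrite (avg_mono C_gt0 (set21 v u)) cards2 nbr_neq.
Qed.

(** Distinct neighbours match the colour of [v] independently, each with probability [c^-1]; the
    diagonal contributes one more mean. *)
Lemma avg_same_color_sqr v : avg (fun x => (M v x)%:R ^+ 2) <=
  #|nbr e v|%:R / c * (#|nbr e v|%:R / c + 1).
Proof.
have ci0 : 0 <= c^-1 by rewrite invr_ge0 ltW.
under eq_avg => x do rewrite ME expr2 mulr_suml (eq_bigr _ (fun u _ => mulr_sumr _ _ _ _)).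
rewrite avg_sum; under eq_bigr => u uv do rewrite avg_sum (bigD1 u)//=.
rewrite big_split /= mulrDr mulr1 addrC; apply: lerD.
  apply: (@le_trans _ _ (\sum_(u in nbr e v) \sum_(w in nbr e v) c^-1 ^+ 2)).
    apply: ler_sum => u uv; rewrite [leRHS](bigD1 u)//= -[leLHS]add0r lerD ?exprn_ge0 ?ci0//.
    apply: ler_sum => w /andP[wv wu].
    under eq_avg => x do rewrite -natrM mulnb.
    apply: (@le_trans _ _ (avg (fun x : {ffun V -> C} => (mono (v |: [set u; w]) x)%:R))).
      apply: le_avg => x; rewrite ler_nat; case: andP => // -[/forall_inP h1 /forall_inP h2].
      have uvx : x u = x v by have /forall_inP/(_ v) := h1 u (set22 _ _); rewrite set21 => /(_ isT)/eqP.
      have wvx : x w = x v by have /forall_inP/(_ v) := h2 w (set22 _ _); rewrite set21 => /(_ isT)/eqP.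
      rewrite (_ : mono _ _ = true)//; apply/forall_inP => a; rewrite !inE => aE.
      have ax : x a = x v by case/or3P: aE => /eqP ->.
      apply/forall_inP => b; rewrite !inE => bE.
      have bx : x b = x v by case/or3P: bE => /eqP ->.
      by rewrite ax bx.
    rewrite (avg_mono C_gt0 (v := v)) ?setU11// cardsU1 cards2 !inE negb_or.
    by rewrite (nbr_neq uv) (nbr_neq wv) eq_sym wu /= exprVn.
  rewrite !sumr_const -[c^-1 ^+ 2 *+ _]mulr_natl -[leLHS]mulr_natl.
  by rewrite (_ : _ * (_ * _) = #|nbr e v|%:R / c * (#|nbr e v|%:R / c))//; ring.
apply: (@le_trans _ _ (\sum_(u in nbr e v) c^-1)).
  apply: ler_sum => u uv; under eq_avg => x do rewrite -natrM mulnb andbb.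
  by rewrite (avg_mono C_gt0 (set21 v u)) cards2 nbr_neq.
by rewrite sumr_const -[c^-1 *+ _]mulr_natl.
Qed.

(** The stars centred at [v] already number ['C(m, r)], and from [m = r] on this binomial grows by
    at least 1 at each step. *)
Lemma same_color_le_mono_count r v x : (0 < r)%N -> (M v x <= mono_count e r x + r)%N.
Proof.
move=> r0; rewrite mono_countE (bigD1 v)//= -/(M v x).
suff bin_ge m : (m <= 'C(m, r) + r)%N.
  by apply: leq_trans (bin_ge _) _; rewrite leq_add2r leq_addr.
have [/ltnW mr|rm] := ltnP m r; first exact: leq_trans mr (leq_addl _ _).
rewrite addnC -leq_subLR -{2}(subnKC rm); elim: (m - r)%N => [//|k IH].
case: r r0 {rm} IH => // r _ IH; rewrite addnS binS -addn1 leq_add//.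
by rewrite bin_gt0 addSn -addnS leq_addr.
Qed.

Section tight_count.
Variables (r N : nat).
Hypothesis r_gt0 : (0 < r)%N.
Hypothesis tight : avg (fun x : {ffun V -> C} => (N <= mono_count e r x)%N%:R) < 2^-1 :> R.

(** The 8 is the condition of [chebyshev_half] with [s = 1]. A larger degree would give, with
    probability at least one half, more than [N + r] neighbours coloured like [v], hence at least
    [N] monochromatic stars. *)
Lemma degree_le_of_tight v : #|nbr e v|%:R / c <= 8 + 2 * (N + r)%:R.
Proof.
rewrite leNgt; apply/negP => h; set m := _ / c in h.
have Nr0 : 0 <= (N + r)%:R :> R by [].
have m0 : 0 < m by lra.
have := chebyshev_half m0 (avg_same_color v) (avg_same_color_sqr v).
rewrite mulr1 => /(_ _)/wrap[]; first by lra.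
rewrite leNgt => /negP; apply; apply: le_lt_trans tight; apply: le_avg => x.
rewrite ler_nat; case: leP => // mM; rewrite lt0b.
have : ((N + r)%:R : R) <= (M v x)%:R by lra.
by rewrite ler_nat => /leq_trans/(_ (same_color_le_mono_count v x r_gt0)); rewrite leq_add2r.
Qed.

(** The same argument for the star count, with [s = cond_bound r.+1 B], which is available once the
    degrees are bounded; the absolute value makes the bound visibly nonnegative. *)
Lemma star_mean_le_of_tight (B : R) : symmetric e -> 0 <= B ->
  (forall v, #|nbr e v|%:R <= B * c) ->
  star_mean (C := C) e r <= `|8 * cond_bound r.+1 B| + 2 * N%:R.
Proof.
move=> esym B0 degB; rewrite leNgt; apply/negP => h.
have N0 : 0 <= N%:R :> R by [].
have k0 := ler_norm (8 * cond_bound r.+1 B).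
have mu0 : 0 < star_mean (C := C) e r :> R by rewrite (le_lt_trans _ h)// addr_ge0// mulr_ge0.
have := chebyshev_half mu0 (avg_mono_count eirr C_gt0 r) (avg_mono_count_sqr esym eirr C_gt0 B0 degB r).
move=> /(_ _)/wrap[]; first by lra.
rewrite leNgt => /negP; apply; apply: le_lt_trans tight; apply: le_avg => x.
rewrite ler_nat; case: leP => // mM; rewrite lt0b -(ler_nat R).
have half (a b y t : R) : b + 2 * y < a -> a / 2 <= t -> 0 <= b -> y <= t by lra.
exact: (half _ _ _ _ h mM (normr_ge0 _)).
Qed.

End tight_count.
End second_moments.

Section ultrafilter_limits.
Local Open Scope classical_set_scope.
Context {R : realType} {F : set_system nat} {FU : UltraFilter F}.

(** Compactness of [0, b] gives a cluster point, and the image of an ultrafilter converges to each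
    of its cluster points. *)
Lemma ultrafilter_bounded_cvg (u : nat -> R) (b : R) :
  (\forall n \near F, 0 <= u n <= b) -> exists l : R, u n @[n --> F] --> l.
Proof.
move=> ub; have FF : ProperFilter F by exact: ultra_proper.
have [l [_ lu]] : `[0, b] `&` cluster (u @ F) !=set0.
  apply: (@segment_compact R 0 b).
  by rewrite /= ; apply: filterS ub => n h; rewrite /= in_itv.
exists l => A lA; have [//|nFA] := in_ultra_setVsetC (u @^-1` A) FU.
have [x [nx Ax]] : ~` A `&` A !=set0 by apply: lu => //; exact: nFA.
by [].
Qed.

End ultrafilter_limits.

Section clamp.
Local Open Scope classical_set_scope.
Context {R : realType}.
Implicit Types x y : R.

(* [clamp y = min 1 (max 0 y)], written so that continuity is immediate. *)
Definition clamp y : R := (`|y| - `|y - 1| + 1) / 2.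

Lemma clamp_continuous : continuous clamp.
Proof.
move=> y; apply: cvgM; last exact: cvg_cst.
apply: cvgD; last exact: cvg_cst.
apply: cvgB; first exact: norm_continuous.
apply: (continuous_comp (f := fun y => y - 1) (g := fun y => `|y|)); last exact: norm_continuous.
by apply: cvgB; [exact: cvg_id|exact: cvg_cst].
Qed.

Lemma clamp_le0 y : y <= 0 -> clamp y = 0.
Proof.
by move=> y0; rewrite /clamp (ler0_norm y0) ler0_norm; lra.
Qed.

Lemma clamp_ge1 y : 1 <= y -> clamp y = 1.
Proof.
by move=> y1; rewrite /clamp !ger0_norm; lra.
Qed.

Lemma clamp_itv y : 0 <= clamp y <= 1.
Proof.
have [y0|/ltW y0] := leP y 0; first by rewrite clamp_le0// lexx ler01.
have [y1|/ltW y1] := leP 1 y; first by rewrite clamp_ge1// lexx ler01.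
rewrite /clamp (ger0_norm y0) ler0_norm ?subr_le0//; apply/andP; split; lra.
Qed.

Lemma clamp_norm y : `|clamp y| <= 1.
Proof. by have /andP[y0 y1] := clamp_itv y; rewrite ger0_norm. Qed.

End clamp.

Section limit_in_distribution.
Local Open Scope classical_set_scope.
Context {R : realType} {d : measure_display} {Om : measurableType d} {Q : probability Om R}.
Implicit Types (h : Om -> R) (A : set Om).

Lemma integral_le_probability h A : measurable_fun [set: Om] h -> measurable A ->
  (forall w, 0 <= h w <= 1) -> (forall w, ~ A w -> h w = 0) -> (\int[Q]_w (h w)%:E <= Q A)%E.
Proof.
move=> mh mA h01 hA; rewrite -[A in leRHS]setIT -integral_indic//.
apply: ge0_le_integral => //.
- by move=> w _; rewrite lee_fin; case/andP: (h01 w).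
- exact/measurable_EFinP.
- by apply/measurable_EFinP; exact: measurable_indic.
- move=> w _; rewrite lee_fin indicE; have [Aw|nAw] := pselect (A w).
    by rewrite mem_set//; case/andP: (h01 w).
  by rewrite hA.
Qed.

Lemma probability_le_integral h A : measurable_fun [set: Om] h -> measurable A ->
  (forall w, 0 <= h w) -> (forall w, A w -> h w = 1) -> (Q A <= \int[Q]_w (h w)%:E)%E.
Proof.
move=> mh mA h0 hA; rewrite -[A in leLHS]setIT -integral_indic//.
apply: ge0_le_integral => //.
- by apply/measurable_EFinP; exact: measurable_indic.
- exact/measurable_EFinP.
- move=> w _; rewrite lee_fin indicE; have [Aw|nAw] := pselect (A w).
    by rewrite mem_set// hA.
  by rewrite memNset// h0.
Qed.

Variable Y : {RV Q >-> R}.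

Let mY : measurable_fun [set: Om] Y. Proof. exact: measurable_funPT. Qed.

Lemma tail_cvg0 : Q [set w | M%:R < Y w] @[M --> \oo] --> 0%E.
Proof.
have E : \bigcap_(M : nat) [set w | M%:R < Y w] = set0.
  rewrite -subset0 => w /= h; have := h (Num.truncn (Y w)).+1 I => /= /ltW.
  by rewrite leNgt truncnS_gt.
rewrite -(measure0 Q) -E.
have mM M : measurable [set w | M%:R < Y w].
  rewrite (_ : [set w | _] = Y @^-1` `]M%:R, +oo[).
    by rewrite -[X in measurable X]setTI; apply: mY.
  by apply/seteqP; split=> w /=; rewrite in_itv /= andbT.
apply: nonincreasing_cvg_mu => //.
- by rewrite (le_lt_trans (probability_le1 _ _))// ltry.
- by rewrite E.
- by move=> m n mn; apply/subsetPset => w /=; apply: le_lt_trans; rewrite ler_nat.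
Qed.

Lemma measurable_near_point (j : R) m : measurable [set w | `|Y w - j| * m.+1%:R < 1].
Proof.
have mg : measurable_fun [set: Om] (fun w => `|Y w - j| * m.+1%:R).
  apply: measurable_funM => //; apply: measurableT_comp => //.
  exact: measurable_funB.
rewrite (_ : [set w | _] = (fun w => `|Y w - j| * m.+1%:R) @^-1` `]-oo, 1[).
  by rewrite -[X in measurable X]setTI; apply: mg.
by apply/seteqP; split=> w /=; rewrite in_itv.
Qed.

Lemma point_cvg (j : R) : Q [set w | `|Y w - j| * m.+1%:R < 1] @[m --> \oo] --> Q [set w | Y w = j].
Proof.
have E : \bigcap_(m : nat) [set w | `|Y w - j| * m.+1%:R < 1] = [set w | Y w = j].
  apply/seteqP; split=> w /= h; last by move=> m _ /=; rewrite h subrr normr0 mul0r.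
  apply/eqP; rewrite -subr_eq0 -normr_le0 leNgt; apply/negP => h0.
  have := h (Num.truncn (`|Y w - j|^-1)) I => /=.
  rewrite ltNge -ler_pdivrMl// mulr1 => /negP; apply.
  by apply: ltW; exact: truncnS_gt.
have mM := measurable_near_point j.
rewrite -E; apply: nonincreasing_cvg_mu => //.
- by rewrite (le_lt_trans (probability_le1 _ _))// ltry.
- exact: bigcap_measurable.
- move=> m n mn; apply/subsetPset => w /=; apply: le_lt_trans.
  by rewrite ler_wpM2l// ler_nat.
Qed.

End limit_in_distribution.

(** * The converse: limits along an ultrafilter and identification of the law *)

Section converse.
Local Open Scope classical_set_scope.
Context {R : realType} (r : nat) (r_gt1 : (1 < r)%N).
Variables (V : nat -> finType) (G : forall n, sgraph (V n)) (c : nat -> nat).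
Hypothesis c_gt0 : forall n, (0 < c n)%N.
Hypothesis c_cvg : c @ \oo --> \oo.
Variables (d : nat -> measure_display) (Om : forall n, measurableType (d n)).
Variables (P : forall n, probability (Om n) R) (X : forall n, V n -> {RV (P n) >-> nat}).
Arguments G : clear implicits.
Arguments X : clear implicits.
Hypothesis X_unif : forall n v, uniform_color (X n v) (c n).
Hypothesis X_indep : forall n, mutually_independent [set: V n] (X n).

Let stars n (w : Om n) : R := (mono_stars r (G n) (fun v => X n v w))%:R.

Variables (d' : measure_display) (Om' : measurableType d') (Q : probability Om' R).
Variable Y : {RV Q >-> R}.
Hypothesis stars_cvg : cvg_in_distribution P stars Q Y.

Let T n (x : {ffun V n -> 'I_(c n)}) := mono_count (adj (G n)) r x.

Let mY : measurable_fun [set: Om'] Y. Proof. exact: measurable_funPT. Qed.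

Let clamp_fun (f : R -> R) := clamp \o f.

Lemma clamp_law_cvg (f : R -> R) : continuous f -> exists2 L : R,
  (\int[Q]_w (clamp (f (Y w)))%:E = L%:E)%E &
  avg (fun x => clamp (f (@T n x)%:R)) @[n --> \oo] --> L.
Proof.
move=> cf.
have cg : continuous (clamp_fun f).
  by move=> x; apply: continuous_comp; [exact: cf|exact: clamp_continuous].
have bg : exists M : R, forall x, `|clamp_fun f x| <= M.
  by exists 1 => x; exact: clamp_norm.
have mg : measurable_fun [set: Om'] (fun w => clamp (f (Y w))).
  by apply: (measurableT_comp (f := clamp_fun f) _ mY); exact: continuous_measurable_fun.
have c0 w : (0%:E <= (clamp (f (Y w)))%:E)%E.
  by rewrite lee_fin; case/andP: (clamp_itv (f (Y w))).
have fin : (\int[Q]_w (clamp (f (Y w)))%:E)%E \is a fin_num.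
  rewrite ge0_fin_numE ?integral_ge0//.
  apply: le_lt_trans (integral_le_probability mg measurableT _ _) _.
  - by move=> w; exact: clamp_itv.
  - by move=> w [].
  - by rewrite probability_setT ltry.
exists (fine (\int[Q]_w (clamp (f (Y w)))%:E)); rewrite ?fineK//.
have EQ : ('E_Q[clamp_fun f \o Y] = \int[Q]_w (clamp (f (Y w)))%:E)%E by rewrite unlock.
have := stars_cvg cg bg; rewrite EQ.
under eq_fun do rewrite (expectation_starsE r G c_gt0 X_unif X_indep).
by rewrite -(fineK fin); exact: fine_cvg.
Qed.

(** Take [M] with [Q (Y > M)] below one half. The test function [clamp (y - M)] lies between the
    indicators of [y >= M + 1] and [y > M], whence [N = M + 1]. *)
Lemma stars_tight : exists N, \forall n \near \oo,
  avg (fun x => (N <= @T n x)%N%:R) < 2^-1 :> R.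
Proof.
have /filter_ex[M hM] : \forall M \near \oo, (Q [set w | (M%:R < Y w)%R] < (2^-1 : R)%:E)%E.
  have := @tail_cvg0 _ _ _ Q Y; move/fine_cvgP => -[fQ hQ].
  near=> M; rewrite -(fineK (_ : Q [set w | (M%:R < Y w)%R] \is a fin_num)) ?lte_fin; last first.
    by near: M.
  by near: M; move/cvgr_lt : hQ; apply; rewrite invr_gt0.
have [|L EL cL] := @clamp_law_cvg (fun y => y - M%:R).
  by move=> y; apply: cvgB; [exact: cvg_id|exact: cvg_cst].
have L2 : L < 2^-1.
  rewrite -lte_fin -EL; apply: le_lt_trans hM; apply: integral_le_probability.
  - apply: (measurableT_comp (f := clamp)); last exact: measurable_funB.
    exact: continuous_measurable_fun (@clamp_continuous R).
  - rewrite (_ : [set w | _] = Y @^-1` `]M%:R, +oo[).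
      by rewrite -[X in measurable X]setTI; apply: mY.
    by apply/seteqP; split=> w /=; rewrite in_itv /= andbT.
  - by move=> w; exact: clamp_itv.
  - by move=> w /negP; rewrite -leNgt => h; rewrite clamp_le0// subr_le0.
exists M.+1; move/cvgr_lt : cL => /(_ _ L2); apply: filterS => n; apply: le_lt_trans.
apply: le_avg => x; have /andP[k0 _] := clamp_itv ((@T n x)%:R - M%:R : R).
by case: leqP => //= h; rewrite clamp_ge1// lerBrDl natr1 ler_nat.
Unshelve. all: by end_near.
Qed.

Lemma converse_limit : exists theta lambda : nat -> R,
  [/\ forall v, 0 <= theta v, forall v, theta v.+1 <= theta v,
      forall k, (1 <= k <= r.+1)%N -> 0 <= lambda k,
      (0 <= Z1_rate r theta lambda)%E &
      exists (T Z : nat -> {RV (@unit_lebesgue R) >-> nat}),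
        limit_variables r theta lambda T Z /\
        forall A : set (\bar R), measurable A ->
          Q ((EFin \o Y) @^-1` A) = unit_lebesgue (limit_sum r T Z @^-1` A)].
Proof.
have r_gt0 : (0 < r)%N by exact: ltnW.
have C0 n : (0 < #|'I_(c n)|)%N := colors_gt0 c_gt0 n.
have esym n : symmetric (adj (G n)) := adj_sym (G n).
have eirr n : irreflexive (adj (G n)) := adj_irr (G n).
have c0 n : 0 < #|'I_(c n)|%:R :> R by rewrite ltr0n.
have [N tight] := stars_tight.
pose B : R := 8 + 2 * (N + r)%:R; have B0 : 0 <= B by rewrite addr_ge0// mulr_ge0.
pose D : R := `|8 * cond_bound r.+1 B| + 2 * N%:R.
have degB n : avg (fun x => (N <= @T n x)%N%:R) < 2^-1 :> R ->
    forall v, #|nbr (adj (G n)) v|%:R <= B * #|'I_(c n)|%:R.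
  by move=> tn v; rewrite -ler_pdivrMr//; exact: degree_le_of_tight.
(* The ultrafilter refines convergence at infinity, so everything that holds or converges for large
   [n] does so along [F]. *)
have [F [FU ooF]] := ultraFilterLemma eventually_filter.
have [theta degs] : exists theta : nat -> R, forall v,
    (ranked_degree (adj (G n)) v)%:R / #|'I_(c n)|%:R @[n --> F] --> theta v.
  pose L v l := (ranked_degree (adj (G n)) v)%:R / #|'I_(c n)|%:R @[n --> F] --> (l : R).
  suff /choice[theta h] : forall v, exists l, L v l by exists theta.
  move=> v.
  apply: (@ultrafilter_bounded_cvg _ _ _ _ B); apply: ooF; apply: filterS tight => n /degB h.
  rewrite divr_ge0//= ler_pdivrMr//.
  have [vs|vs] := ltnP v (size (sort geq [seq #|nbr (adj (G n)) u| | u <- enum (V n)])).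
    have := mem_nth 0%N vs; rewrite mem_sort => /mapP[u _]; rewrite /ranked_degree => ->.
    exact: h.
  by rewrite /ranked_degree nth_default// mulr_ge0.
have [lambda sets] : exists lambda : nat -> R, forall k, (1 <= k <= r.+1)%N ->
    #|star_sets (adj (G n)) r k|%:R / #|'I_(c n)|%:R ^+ r @[n --> F] --> lambda k.
  pose L k l := (1 <= k <= r.+1)%N ->
    #|star_sets (adj (G n)) r k|%:R / #|'I_(c n)|%:R ^+ r @[n --> F] --> (l : R).
  suff /choice[lambda h] : forall k, exists l, L k l by exists lambda.
  move=> k; have [kr|nkr] := pselect (1 <= k <= r.+1)%N; last by exists 0.
  suff [l hl] : exists l : R, #|star_sets (adj (G n)) r k|%:R / #|'I_(c n)|%:R ^+ r @[n --> F] --> l.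
    by exists l.
  apply: (@ultrafilter_bounded_cvg _ _ _ _ D); apply: ooF; apply: filterS tight => n tn.
  rewrite divr_ge0 ?exprn_ge0//=.
  apply: le_trans (star_mean_le_of_tight (C0 n) (eirr n) tn (esym n) B0 (degB n tn)).
  (* Each set counted here spans [k >= 1] stars, so there are no more such sets than stars. *)
  rewrite /star_mean ler_wpM2r ?invr_ge0 ?exprn_ge0// ler_nat (card_stars_star_sets _ (eirr n)).
  case/andP: kr => k1 kr; rewrite (bigD1_seq k) ?iota_uniq ?mem_index_iota ?k1//=.
  by rewrite (leq_trans _ (leq_addr _ _))// leq_pmull.
have FF : ProperFilter F by exact: ultra_proper.
have c_inv : (#|'I_(c n)|%:R)^-1 @[n --> F] --> (0 : R).
  by move=> A A0; apply: ooF; exact: (inv_colors_cvg c_gt0 c_cvg A0).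
have th0 v : 0 <= theta v by exact: (theta_ge0 C0 degs).
have la0 k : (1 <= k <= r.+1)%N -> 0 <= lambda k by exact: (lambda_ge0 C0 sets).
have z0 : (0 <= Z1_rate r theta lambda)%E.
  exact: (star_rate_ge0 esym eirr r_gt1 C0 c_inv sets degs).
exists theta, lambda; split=> //.
  by move=> v; apply: (theta_nonincr C0 degs (leqnSn v)).
have [Tl [Zl LV]] := exists_limit_variables th0 la0 z0.
exists Tl, Zl; split=> //.
pose p := limit_pmf r Tl Zl.
have p_sum : series p @ \oo --> (1 : R).
  exact: (limit_pmf_sum esym eirr r_gt1 C0 c_inv sets degs LV).
have mW := measurable_limit_sum r Tl Zl.
have p_law j : unit_lebesgue [set w | limit_sum r Tl Zl w = j%:R%:E] = (p j)%:E.
  by rewrite /p /limit_pmf fineK// fin_num_measure//; exact: measurable_limit_sum_eq.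
have clampE (f : R -> R) : continuous f ->
    (\int[Q]_w (clamp (f (Y w)))%:E = \int[unit_lebesgue]_w (clamp (f (fine (limit_sum r Tl Zl w))))%:E)%E.
  move=> cf; have [L -> cL] := clamp_law_cvg cf.
  have [|L' -> cL'] := mono_count_mean_cvg_bounded (f := clamp_fun f) esym eirr r_gt1 C0 c_inv sets degs LV _ (fun x => clamp_norm (f x)).
    apply: continuous_measurable_fun => x; apply: continuous_comp; [exact: cf|exact: clamp_continuous].
  (* Both integrals are limits along [F] of the same averages. *)
  congr EFin; apply: (cvg_unique (@Rhausdorff R) _ cL').
  by move=> A LA; apply: ooF; exact: cL.
have mYj j : measurable [set w | Y w = j%:R].
  rewrite -[X in measurable X]setTI; exact: (mY measurableT (measurable_set1 (j%:R : R))).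
pose q j := fine (Q [set w | Y w = j%:R]).
have qE j : Q [set w | Y w = j%:R] = (q j)%:E by rewrite fineK// fin_num_measure.
have pq j : p j <= q j.
  (* The test functions below decrease to the indicator of [j]. *)
  rewrite -lee_fin -qE -p_law -(cvg_lim _ (@point_cvg _ _ _ Q Y j%:R))//; apply: lime_ge.
    by apply/cvg_ex; exists (Q [set w | Y w = j%:R]); exact: point_cvg.
  apply: nearW => m; pose f (y : R) := 1 - `|y - j%:R| * m.+1%:R.
  have cf : continuous f.
    move=> y; apply: cvgB; first exact: cvg_cst.
    apply: cvgM; last exact: cvg_cst.
    by apply: cvg_norm; apply: cvgB; [exact: cvg_id|exact: cvg_cst].
  have mcf : measurable_fun [set: R] (clamp_fun f).
    by apply: continuous_measurable_fun => y; apply: continuous_comp; [exact: cf|exact: clamp_continuous].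
  apply: (@le_trans _ _ (\int[Q]_w (clamp (f (Y w)))%:E)%E).
    rewrite (clampE f cf); apply: probability_le_integral.
    - apply: (measurableT_comp mcf); exact: (measurableT_comp _ mW).
    - exact: measurable_limit_sum_eq.
    - by move=> w; case/andP: (clamp_itv (f (fine (limit_sum r Tl Zl w)))).
    - by move=> w /= ->; rewrite clamp_ge1// /f subrr normr0 mul0r subr0.
  apply: integral_le_probability.
  - exact: (measurableT_comp mcf mY).
  - exact: measurable_near_point.
  - by move=> w; exact: clamp_itv.
  - by move=> w /negP; rewrite -leNgt => h; rewrite clamp_le0// subr_le0.
(* The masses [p] add up to 1 and the masses [q] to at most 1, so [p <= q] forces equality; in
   particular [Y] is almost surely a natural number. *)
have q_eq : q = p.
  apply/funext => j; apply/eqP; rewrite eq_le pq andbT.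
  have h : q j - p j <= 1 - 1.
    have cN : (1 - series p N') @[N' --> \oo] --> (1 - 1 : R).
      by apply: cvgB; [exact: cvg_cst|exact: p_sum].
    apply: (ler_cvg_to (cvg_cst (q j - p j)) cN); exists j.+1 => // N' jN.
    have q1 : \sum_(0 <= i < N') q i <= 1.
      apply: (sum_probability_le1 Q (A := fun i => [set w | Y w = i%:R])) => // i k _ _ [w [/= -> /eqP]].
      by rewrite eqr_nat => /eqP.
    apply: le_trans (lerB q1 (lexx _)); rewrite /series /= -sumrB.
    rewrite (bigD1_seq j) ?iota_uniq ?mem_index_iota//= lerDl sumr_ge0// => i _.
    by rewrite subr_ge0.
  by rewrite subrr subr_le0 in h.
move=> A mA.
rewrite (natural_law (q := p) mW p_law p_sum mA) (natural_law (q := p) (Y := EFin \o Y))//.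
  by apply/measurable_EFinP.
move=> j; rewrite -q_eq -qE; congr (Q _).
by apply/seteqP; split=> w /=; [case|move=> ->].
Qed.

End converse.

Unset Implicit Arguments.
Set Strict Implicit.
Set Printing Implicit Defensive.
Local Open Scope classical_set_scope.
Local Open Scope ring_scope.

Theorem theorem1p1 (R : realType) (r : nat) (hr : (2 <= r)%N)
  (V : nat -> finType) (G : forall n, sgraph (V n))
  (c : nat -> nat) (hc_pos : forall n, (0 < c n)%N) (hc : c @ \oo --> \oo)
  (d : nat -> measure_display) (Om : forall n, measurableType (d n))
  (P : forall n, probability (Om n) R)
  (X : forall n, V n -> {RV (P n) >-> nat})
  (hX_unif : forall n v, uniform_color (X n v) (c n))
  (hX_indep : forall n, mutually_independent [set: V n] (X n)) :
  let stars n (w : Om n) : R := (mono_stars r (G n) (fun v => X n v w))%:R in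
  (* sufficiency *)
  (forall theta lambda : nat -> R,
    (forall k, (1 <= k <= r.+1)%N ->
      0 <= lambda k /\
      (\sum_(F in star_class r k) Nind F (G n))%N%:R / (c n)%:R ^+ r
        @[n --> \oo] --> lambda k) ->
    (forall v, (ordered_degree (G n) v)%:R / (c n)%:R
        @[n --> \oo] --> theta v) ->
    (0 <= Z1_rate r theta lambda)%E /\
    forall (d' : measure_display) (Om' : measurableType d')
      (Q : probability Om' R) (T Z : nat -> {RV Q >-> nat}),
      limit_variables r theta lambda T Z ->
      [/\ {ae Q, forall w, limit_sum r T Z w \is a fin_num},
          cvg_in_distribution P stars Q (fine \o limit_sum r T Z)
        & cvg_in_moments P stars Q (fine \o limit_sum r T Z)]) /\
  (* converse *)
  (forall (d' : measure_display) (Om' : measurableType d')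
    (Q : probability Om' R) (Y : {RV Q >-> R}),
    cvg_in_distribution P stars Q Y ->
    exists theta lambda : nat -> R,
      [/\ forall v, 0 <= theta v,
          forall v, theta v.+1 <= theta v,
          forall k, (1 <= k <= r.+1)%N -> 0 <= lambda k,
          (0 <= Z1_rate r theta lambda)%E
        & exists (d'' : measure_display) (Om'' : measurableType d'')
            (Q' : probability Om'' R) (T Z : nat -> {RV Q' >-> nat}),
            limit_variables r theta lambda T Z /\
            forall A : set (\bar R), measurable A ->
              Q ((EFin \o Y) @^-1` A) = Q' (limit_sum r T Z @^-1` A)]).
Proof.
move=> stars; split=> [theta lambda hl hd|d' Om' Q Y hY].
  apply: (star_law_limit hr hc_pos hc hX_unif hX_indep) => // k kr.
  by case: (hl k kr).
have [theta [lambda [th0 th_nonincr la0 z0 [T [Z [LV law]]]]]] :=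
  converse_limit hr hc_pos hc hX_unif hX_indep hY.
by exists theta, lambda; split=> //; exists _, _, (@unit_lebesgue R), T, Z.
Qed.
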